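(* Assume the generalized Riemann hypothesis. Let $A>0$ and let $q$ be a positive integer. Suppose $h:\mathbb{Z}\to\mathbb{C}$ is periodic modulo $q$ with $|h(n)|\le A$ for all $n$. Then for every $\varepsilon>0$, $$\sum_{n\le N}\sum_{d\mid n}\mu\!\left(\frac{n}{d}\right)h(d)\ll A\,q\,N^{1/2+\varepsilon},$$ where the implied constant depends only on $\varepsilon$.
   Context: $\mu$ is the Möbius function. *)

(* Defs.v *)
From HB Require Import structures.
From mathcomp Require Import all_boot all_order all_algebra.
From mathcomp Require Import all_real_closed.
From mathcomp Require Import all_classical all_reals all_analysis.

Set Implicit Arguments.
Unset Strict Implicit.
Unset Printing Implicit Defensive.

Import Order.TTheory GRing.Theory Num.Theory.
Import numFieldNormedType.Exports.

Local Open Scope classical_set_scope.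
Local Open Scope complex_scope.
Local Open Scope ring_scope.

Definition moebius (n : nat) : int :=
  if (0 < n)%N && all (fun p => logn p n == 1%N) (primes n)
  then (-1) ^+ size (primes n) else 0.

Definition cexp (R : realType) (z : R[i]) : R[i] :=
  (expR (complex.Re z))%:C * (cos (complex.Im z) +i* sin (complex.Im z)).

(* n ^ s with the real branch of log n; meaningful for n > 0 only. *)
Definition natcpow (R : realType) (n : nat) (s : R[i]) : R[i] :=
  cexp (s * (ln n%:R)%:C).

Definition periodic_mod (T : Type) (q : nat) (f : int -> T) : Prop :=
  forall n : int, f (n + q%:Z) = f n.

(* chi 1 = 1 is a consequence of the last two conditions. *)
Definition dirichlet_character (R : realType) (q : nat)
    (chi : int -> R[i]) : Prop :=
  [/\ periodic_mod q chi,
      forall m n : int, chi (m * n) = chi m * chi n &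
      forall n : int, (chi n != 0) = coprimez n q%:Z].

(* L is the analytic continuation to Re s > 0, s != 1, of the Dirichlet series
   of chi. It is unique on that connected open set; L 1 is arbitrary, which
   accommodates the pole at 1 when chi is principal. The exponent ^o makes
   derivability with respect to the field R[i], i.e. complex. *)
Definition continued_L_function (R : realType)
    (chi : int -> R[i]) (L : R[i] -> R[i]) : Prop :=
  (forall s : R[i], 1 < complex.Re s ->
     (\sum_(1 <= n < N) chi n%:Z * natcpow n (- s) : R[i]^o) @[N --> \oo]
       --> (L s : R[i]^o)) /\
  (forall s : R[i], 0 < complex.Re s -> s != 1 ->
     derivable (L : R[i]^o -> R[i]^o) s 1).

(* All Dirichlet characters are included: q = 1 gives the Riemann zeta
   function, and imprimitive characters add no zeros in the open strip. *)
Definition generalized_riemann_hypothesis (R : realType) : Prop :=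
  forall (q : nat) (chi : int -> R[i]) (L : R[i] -> R[i]),
    (0 < q)%N -> dirichlet_character q chi -> continued_L_function chi L ->
    forall s : R[i], 0 < complex.Re s < 1 -> L s = 0 -> complex.Re s = 2^-1.

(* Main.v *)
Require Import Defs.
From HB Require Import structures.
From mathcomp Require Import all_boot all_order all_algebra.
From mathcomp Require Import all_real_closed.
From mathcomp Require Import all_classical all_reals all_analysis.
From mathcomp Require Import ring lra.
Set Implicit Arguments.
Unset Strict Implicit.
Unset Printing Implicit Defensive.
Import Order.TTheory GRing.Theory Num.Theory.
Import numFieldNormedType.Exports.
Local Open Scope classical_set_scope.
Local Open Scope complex_scope.
Local Open Scope ring_scope.

(* Subtracting its mean (on a constant the divisor sum is trivial) we may assume
   that h has period sums 0, so that its partial sums are O(A q). Take K = floor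
   (sqrt N). The divisors d > K are summed first and contribute O(A q K). For
   d <= K the sum is, up to O(A K ln K), the difference quotient between N and
   N + K of the logarithmic means sum_{d <= K} h(d) sum_{m <= n/d} mu(m) ln (n/dm),
   and this quantity is (1/pi) int_0^oo Re (F(w) n^w / (w^2 zeta(w))) dt on the line
   w = 1/2 + 3 eta + i t, where F(w) = sum_{d <= K} h(d) d^-w; real coefficients
   let us work with t >= 0 only.

   On this line 1/zeta(w) = O(t^e) under RH: since zeta is free of zeros, Ahlfors'
   lemma and Harnack's inequality bound zeta'/zeta by O(ln t), three circles improve
   the bound to O((ln t)^theta) with theta < 1, and one integrates horizontally.
   The mean square of F over [0, T] is O((A q)^2 T ln K): for d <= T the
   frequencies ln d are separated well enough, and for d > T the same holds after
   an Abel summation, which costs a factor T/d and brings in the partial sums of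
   h. Hence F(w) behaves on average like a bounded function, with the crucial
   linear dependence on q, and the integral converges with a loss N^(O(e)). *)

(** The weight ln(n/(d m)) gives the Perron kernel 1/w^2, hence absolutely convergent integrals, and
    the difference over a short interval removes it again: pairs with d m <= N gain exactly th =
    ln((N+K)/N), of size N^(-1/2). The integrand must then be both small in th and integrable:
    |e^(th w) - 1| << (th |w|)^(1-2e) leaves |w|^(-1-2e), of which 1/zeta consumes e, and dividing
    by th costs only th^(-2e). Pointwise bounds for F lose a power of K or of |w|; a weighted L^1
    norm suffices, and it follows from the mean square.

    GRH speaks of an arbitrary continuation of a Dirichlet series, so (s-1) zeta(s) is built
    explicitly for Re s > 0, with all its derivatives as series. The line Re s = 1, outside the open
    strip, is settled by the 3-4-1 inequality.

    Complex analysis is reduced to real calculus: Cauchy's theorem becomes differentiation of a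
    vertical integral in its abscissa, and harmonic function theory becomes the sign of the
    Laplacian at a maximum. *)

Section RealDerivative.
Context {R : realType}.
Implicit Types (f g : R -> R) (x a b : R).

(** The quotient-free form makes sense at h = 0 as well and is the one in which error estimates
    arise; [is_derive1_ex] is the converse. *)
Lemma is_derive1P f x d :
  (forall e : R, 0 < e -> exists2 r : R, 0 < r &
     forall h : R, `|h| < r -> `|f (x + h) - f x - h * d| <= e * `|h|) ->
  is_derive x 1 f d.
Proof.
move=> H.
have cv : h^-1 *: (f (h *: 1 + x) - f x) @[h --> 0^'] --> d.
  apply/cvgrPdist_le => e e0.
  have [r r0 Hr] := H _ e0.
  near=> h.
  have h0 : h != 0 by near: h; exact: nbhs_dnbhs_neq.
  have hr : `|h| < r.
    near: h; apply: nbhs_dnbhs; apply/nbhs_ballP; exists r => //= y.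
    by rewrite /ball/= sub0r normrN.
  have := Hr _ hr.
  rewrite [h *: 1]mulr1 [h + x]addrC [_ *: _]mulrC => Hh.
  have -> : d - (f (x + h) - f x) / h = - ((f (x + h) - f x - h * d) / h).
    by field.
  by rewrite normrN normrM normfV ler_pdivrMr ?normr_gt0.
split; last exact: (cvg_lim _ cv).
by apply/cvg_ex; exists d.
Unshelve. all: by end_near. Qed.

Lemma is_derive1_ex f x d : is_derive x 1 f d ->
  (forall e : R, 0 < e -> exists2 r : R, 0 < r &
     forall h : R, `|h| < r -> `|f (x + h) - f x - h * d| <= e * `|h|).
Proof.
move=> [df dE] e e0.
have /cvgrPdist_le/(_ e e0) : h^-1 *: (f (h *: 1 + x) - f x) @[h --> 0^'] --> d.
  by rewrite -dE; exact: df.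
move=> /nbhs_ballP[r /= r0 Hr]; exists r => // h hr.
have [->|h0] := eqVneq h 0.
  by rewrite addr0 subrr mul0r subr0 normr0 mulr0.
have := Hr h; rewrite /ball/= sub0r normrN => /(_ hr h0).
rewrite [h *: 1]mulr1 [h + x]addrC [_ *: _]mulrC => Hh.
have -> : f (x + h) - f x - h * d = - ((d - (f (x + h) - f x) / h) * h).
  by field.
by rewrite normrN normrM ler_pM2r ?normr_gt0.
Qed.

Lemma rd_eq f x a b : is_derive x 1 f a -> a = b -> is_derive x 1 f b.
Proof. by move=> + <-. Qed.
Lemma rd_ext f g x a : f =1 g -> is_derive x 1 f a -> is_derive x 1 g a.
Proof. by move=> /funext ->. Qed.
Lemma rdc (c : R) x : is_derive x 1 (fun _ : R => c) 0.
Proof. exact: is_derive_cst. Qed.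
Lemma rdid x : is_derive x 1 (fun t : R => t) 1.
Proof. exact: is_derive_id. Qed.
Lemma rdD f g x a b : is_derive x 1 f a -> is_derive x 1 g b ->
  is_derive x 1 (fun t => f t + g t) (a + b).
Proof. by move=> ? ?; exact: is_deriveD. Qed.
Lemma rdN f x a : is_derive x 1 f a -> is_derive x 1 (fun t => - f t) (- a).
Proof. by move=> ?; exact: is_deriveN. Qed.
Lemma rdM f g x a b : is_derive x 1 f a -> is_derive x 1 g b ->
  is_derive x 1 (fun t => f t * g t) (a * g x + f x * b).
Proof.
move=> fa gb; apply: (rd_eq (is_deriveM fa gb)).
by rewrite /GRing.scale/= addrC [g x * _]mulrC.
Qed.
Lemma rd_comp f g x a b : is_derive x 1 f a -> is_derive (f x) 1 g b ->
  is_derive x 1 (fun t => g (f t)) (b * a).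
Proof. by move=> ? ?; exact: is_derive1_comp. Qed.
Lemma rdexp f x a : is_derive x 1 f a ->
  is_derive x 1 (fun t => expR (f t)) (expR (f x) * a).
Proof. by move=> fa; apply: rd_comp fa _. Qed.
Lemma rdcos f x a : is_derive x 1 f a ->
  is_derive x 1 (fun t => cos (f t)) (- sin (f x) * a).
Proof. by move=> fa; apply: rd_comp fa _. Qed.
Lemma rdsin f x a : is_derive x 1 f a ->
  is_derive x 1 (fun t => sin (f t)) (cos (f x) * a).
Proof. by move=> fa; apply: rd_comp fa _. Qed.
Lemma rdln f x a : 0 < f x -> is_derive x 1 f a ->
  is_derive x 1 (fun t => ln (f t)) ((f x)^-1 * a).
Proof. by move=> f0 fa; apply: rd_comp fa _; exact: is_derive1_ln. Qed.
Lemma rdV f x a : f x != 0 -> is_derive x 1 f a ->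
  is_derive x 1 (fun t => (f t)^-1) (- (f x) ^- 2 * a).
Proof. by move=> f0 fa; exact: (rd_eq (is_deriveV f0 fa)). Qed.

Lemma rd_cont f x a : is_derive x 1 f a -> {for x, continuous f}.
Proof. by case=> d _; apply/differentiable_continuous/derivable1_diffP. Qed.

Lemma mvt f (df : R -> R) a b : a <= b ->
  (forall x, a <= x <= b -> is_derive x 1 f (df x)) ->
  exists2 c, a <= c <= b & f b - f a = df c * (b - a).
Proof.
move=> ab fd.
have [||c cab ->] := @MVT_segment R f df a b ab.
- by move=> x /[!in_itv]/= /andP[/ltW ax /ltW xb]; apply: fd; rewrite ax.
- apply: continuous_in_subspaceT => x /[!inE]/= /[!in_itv]/= xab.
  exact: rd_cont (fd _ xab).
- by exists c => //; move: cab; rewrite in_itv.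
Qed.

Lemma mvt_nondecr f (df : R -> R) a b : a <= b ->
  (forall x, a <= x <= b -> is_derive x 1 f (df x)) ->
  (forall x, a <= x <= b -> 0 <= df x) -> f a <= f b.
Proof.
move=> ab fd f0; have [c cab E] := mvt ab fd.
by rewrite -subr_ge0 E mulr_ge0 ?f0 ?subr_ge0.
Qed.

Lemma mvt_bound f (df : R -> R) a b M : a <= b ->
  (forall x, a <= x <= b -> is_derive x 1 f (df x)) ->
  (forall x, a <= x <= b -> `|df x| <= M) -> `|f b - f a| <= M * (b - a).
Proof.
move=> ab fd f0; have [c cab E] := mvt ab fd.
by rewrite E normrM [`|b - a|]ger0_norm ?subr_ge0// ler_wpM2r ?subr_ge0 ?f0.
Qed.

Lemma mvt_const f a b : a <= b ->
  (forall x, a <= x <= b -> is_derive x 1 f 0) -> f b = f a.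
Proof.
move=> ab fd; have [c _] := mvt ab fd.
by rewrite mul0r => /eqP; rewrite subr_eq0 => /eqP.
Qed.

End RealDerivative.

Ltac rder := repeat first
 [ exact: rdid | exact: rdc | eassumption | eapply rdD | eapply rdN | eapply rdM | eapply rdexp
 | eapply rdcos | eapply rdsin ].

(** * Complex differentiation *)

Local Notation re := complex.Re.
Local Notation im := complex.Im.
Local Notation cm := Normc.normc.

Section Modulus.
Context {R : realType}.
Local Notation C := R[i].
Implicit Types (z w : C) (x y : R).

Lemma cmE z : cm z = Num.sqrt (re z ^+ 2 + im z ^+ 2).
Proof. by case: z. Qed.
Lemma cm_ge0 z : 0 <= cm z.
Proof. by rewrite cmE sqrtr_ge0. Qed.
Lemma cm_sqr z : cm z ^+ 2 = re z ^+ 2 + im z ^+ 2.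
Proof. by rewrite cmE sqr_sqrtr ?addr_ge0 ?sqr_ge0. Qed.
Lemma cm0 : cm (0 : C) = 0. Proof. exact: Normc.normc0. Qed.
Lemma cm1 : cm (1 : C) = 1. Proof. exact: Normc.normc1. Qed.
Lemma cmM z w : cm (z * w) = cm z * cm w. Proof. exact: Normc.normcM. Qed.
Lemma cmV z : cm z^-1 = (cm z)^-1. Proof. exact: Normc.normcV. Qed.
Lemma cmX z n : cm (z ^+ n) = cm z ^+ n.
Proof. by elim: n => [|n IH]; rewrite ?expr0 ?cm1// !exprS cmM IH. Qed.
Lemma cmD z w : cm (z + w) <= cm z + cm w. Proof. exact: le_normcD. Qed.
Lemma cmN z : cm (- z) = cm z. Proof. exact: normcN. Qed.
Lemma cmB z w : cm (z - w) <= cm z + cm w.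
Proof. by rewrite -(cmN w) cmD. Qed.
Lemma cmBC z w : cm (z - w) = cm (w - z).
Proof. by rewrite -cmN opprB. Qed.
Lemma cm_eq0 z : (cm z == 0) = (z == 0).
Proof. by apply/eqP/eqP => [/Normc.eq0_normc//|->]; rewrite cm0. Qed.
Lemma cm_gt0 z : (0 < cm z) = (z != 0).
Proof. by rewrite lt0r cm_eq0 cm_ge0 andbT. Qed.
Lemma cm_real x : cm x%:C = `|x|.
Proof. by rewrite cmE/= expr0n addr0 sqrtr_sqr. Qed.
Lemma cm_nat n : cm (n%:R : C) = n%:R.
Proof. by rewrite -(rmorph_nat (real_complex R)) cm_real ger0_norm. Qed.
Lemma cm_re z : `|re z| <= cm z.
Proof.
rewrite -(@ler_pXn2r _ 2) ?nnegrE ?cm_ge0// cm_sqr real_normK ?num_real//.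
by rewrite lerDl sqr_ge0.
Qed.
Lemma cm_im z : `|im z| <= cm z.
Proof.
rewrite -(@ler_pXn2r _ 2) ?nnegrE ?cm_ge0// cm_sqr real_normK ?num_real//.
by rewrite lerDr sqr_ge0.
Qed.
Lemma re_cm z : re z <= cm z.
Proof. exact: le_trans (ler_norm _) (cm_re z). Qed.
Lemma cm_reim z : cm z <= `|re z| + `|im z|.
Proof.
rewrite -(@ler_pXn2r _ 2) ?nnegrE ?cm_ge0 ?addr_ge0// cm_sqr.
rewrite sqrrD !real_normK ?num_real// lerD2r lerDl mulrn_wge0//.
Qed.
Lemma cm_sum (I : Type) (r : seq I) (P : pred I) (F : I -> C) :
  cm (\sum_(i <- r | P i) F i) <= \sum_(i <- r | P i) cm (F i).
Proof.
elim/big_ind2 : _ => [|a b c d ab cd|//]; first by rewrite cm0.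
by rewrite (le_trans (cmD _ _))// lerD.
Qed.
Lemma cm_dist z w : `|cm z - cm w| <= cm (z - w).
Proof.
rewrite ler_norml; apply/andP; split.
  have := cmD (w - z) z; rewrite subrK cmBC; lra.
have := cmD (z - w) w; rewrite subrK; lra.
Qed.
Lemma reD z w : re (z + w) = re z + re w. Proof. by case: z w => [? ?] []. Qed.
Lemma imD z w : im (z + w) = im z + im w. Proof. by case: z w => [? ?] []. Qed.
Lemma reN z : re (- z) = - re z. Proof. by case: z. Qed.
Lemma imN z : im (- z) = - im z. Proof. by case: z. Qed.
Lemma reB z w : re (z - w) = re z - re w. Proof. by rewrite reD reN. Qed.
Lemma imB z w : im (z - w) = im z - im w. Proof. by rewrite imD imN. Qed.
Lemma reM z w : re (z * w) = re z * re w - im z * im w.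
Proof. by case: z w => [? ?] []. Qed.
Lemma imM z w : im (z * w) = re z * im w + im z * re w.
Proof. by case: z w => [? ?] []. Qed.
Lemma re_sum (I : Type) (r : seq I) (P : pred I) (F : I -> C) :
  re (\sum_(i <- r | P i) F i) = \sum_(i <- r | P i) re (F i).
Proof. by elim/big_ind2 : _ => // [a b c d <- <-]; rewrite reD. Qed.
Lemma im_sum (I : Type) (r : seq I) (P : pred I) (F : I -> C) :
  im (\sum_(i <- r | P i) F i) = \sum_(i <- r | P i) im (F i).
Proof. by elim/big_ind2 : _ => // [a b c d <- <-]; rewrite imD. Qed.
Lemma re1 : re (1 : C) = 1. Proof. by []. Qed.
Lemma im1 : im (1 : C) = 0. Proof. by []. Qed.
Lemma reZ x z : re (x%:C * z) = x * re z.
Proof. by rewrite reM /= mul0r subr0. Qed.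
Lemma imZ x z : im (x%:C * z) = x * im z.
Proof. by rewrite imM /= mul0r addr0. Qed.
Lemma complex_ext z w : re z = re w -> im z = im w -> z = w.
Proof. by case: z w => [? ?] [? ?] /= -> ->. Qed.
Lemma cm_ge_re z : re z != 0 -> z != 0.
Proof. by apply: contraNneq => ->. Qed.

End Modulus.

Section ComplexDerivative.
Context {R : realType}.
Local Notation C := R[i].
Implicit Types (f g : C -> C) (z w h d a b : C).

(** The derivative is a value carried along, and errors are measured in [R] through [cm], because
    the norm of [R[i]] is itself complex valued. [cderiv_derivable] leads back to the notion used in
    the hypothesis. *)
Definition cderiv f z d := forall e : R, 0 < e -> exists2 r : R, 0 < r &
  forall h : C, cm h < r -> cm (f (z + h) - f z - h * d) <= e * cm h.

Lemma cd_eq f z a b : cderiv f z a -> a = b -> cderiv f z b.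
Proof. by move=> + <-. Qed.

Lemma cd_near f g z d (r : R) : 0 < r ->
  (forall w, cm (w - z) < r -> f w = g w) -> cderiv f z d -> cderiv g z d.
Proof.
move=> r0 fg fd e e0; have [r' r'0 H] := fd e e0.
exists (Num.min r r'); first by rewrite lt_min r0.
move=> h; rewrite lt_min => /andP[hr hr'].
rewrite -!fg ?subrr ?cm0//; first exact: H.
by rewrite [z + h]addrC addrK.
Qed.

Lemma cd_ext f g z d : f =1 g -> cderiv f z d -> cderiv g z d.
Proof. by move=> /funext ->. Qed.

Lemma cdc c z : cderiv (fun _ => c) z 0.
Proof.
move=> e e0; exists 1 => // h _.
by rewrite mulr0 subrr subr0 cm0 mulr_ge0 ?cm_ge0// ltW.
Qed.

Lemma cdid z : cderiv (fun w => w) z 1.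
Proof.
move=> e e0; exists 1 => // h _.
have -> : z + h - z - h * 1 = 0 by ring.
by rewrite cm0 mulr_ge0 ?cm_ge0// ltW.
Qed.

Lemma cd_lip f z d : cderiv f z d -> exists2 r : R, 0 < r &
  forall h : C, cm h < r -> cm (f (z + h) - f z) <= (1 + cm d) * cm h.
Proof.
move=> /(_ 1 ltr01)[r r0 H]; exists r => // h /H Hh.
have -> : f (z + h) - f z = (f (z + h) - f z - h * d) + h * d by ring.
rewrite (le_trans (cmD _ _))// cmM mulrDl [cm d * _]mulrC lerD//.
Qed.

Lemma cdD f g z a b : cderiv f z a -> cderiv g z b ->
  cderiv (fun w => f w + g w) z (a + b).
Proof.
move=> fa gb e e0; have e20 : 0 < e / 2 by rewrite divr_gt0.
have [r1 r10 H1] := fa _ e20; have [r2 r20 H2] := gb _ e20.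
exists (Num.min r1 r2); first by rewrite lt_min r10.
move=> h; rewrite lt_min => /andP[/H1 h1 /H2 h2].
have -> : f (z + h) + g (z + h) - (f z + g z) - h * (a + b) =
  (f (z + h) - f z - h * a) + (g (z + h) - g z - h * b) by ring.
by apply: le_trans (cmD _ _) _; lra.
Qed.

Lemma cdM f g z a b : cderiv f z a -> cderiv g z b ->
  cderiv (fun w => f w * g w) z (a * g z + f z * b).
Proof.
move=> fa gb e e0.
(* The last three summands bound the coefficients of the three error terms: remainder of f times g,
   f times remainder of g, product of the increments. The 1 keeps [K] positive. *)
pose K : R := 1 + cm (f z) + cm (g z) + (1 + cm a) * (1 + cm b).
have K0 : 0 < K.
  by rewrite /K -!addrA ltr_pwDl// !addr_ge0 ?cm_ge0// mulr_ge0 ?addr_ge0 ?cm_ge0.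
have eK : 0 < e / K by rewrite divr_gt0.
have [r1 r10 H1] := fa _ eK; have [r2 r20 H2] := gb _ eK.
have [r3 r30 H3] := cd_lip fa; have [r4 r40 H4] := cd_lip gb.
exists (Num.min (Num.min r1 r2) (Num.min (Num.min r3 r4) (e / K))).
  by rewrite !lt_min r10 r20 r30 r40 eK.
move=> h; rewrite !lt_min => /andP[/andP[/H1 h1 /H2 h2]].
move=> /andP[/andP[/H3 h3 /H4 h4] h5].
have -> : f (z + h) * g (z + h) - f z * g z - h * (a * g z + f z * b) =
  (f (z + h) - f z - h * a) * g z + f z * (g (z + h) - g z - h * b) +
  (f (z + h) - f z) * (g (z + h) - g z) by ring.
apply: le_trans (cmD _ _) _; rewrite cmM.
have A1 : cm ((f (z + h) - f z - h * a) * g z) <= e / K * cm h * cm (g z).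
  by rewrite cmM ler_wpM2r ?cm_ge0.
have A2 : cm (f z * (g (z + h) - g z - h * b)) <= cm (f z) * (e / K * cm h).
  by rewrite cmM ler_wpM2l ?cm_ge0.
have A3 : cm (f (z + h) - f z) * cm (g (z + h) - g z) <=
    (1 + cm a) * (e / K) * ((1 + cm b) * cm h).
  apply: ler_pM; rewrite ?cm_ge0//.
  by rewrite (le_trans h3)// ler_wpM2l ?addr_ge0 ?cm_ge0// ltW.
have -> : e * cm h = e / K * cm h * K.
  by rewrite mulrAC divfK ?gt_eqF.
have A12 := le_trans (cmD _ _) (lerD A1 A2).
apply: le_trans (lerD A12 A3) _; rewrite /K.
rewrite -subr_ge0; set t := e / K.
have -> : t * cm h * (1 + cm (f z) + cm (g z) + (1 + cm a) * (1 + cm b)) -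
  (t * cm h * cm (g z) + cm (f z) * (t * cm h) +
   (1 + cm a) * t * ((1 + cm b) * cm h)) = t * cm h by ring.
by rewrite mulr_ge0 ?cm_ge0// ltW.
Qed.

Lemma cdZ c f z a : cderiv f z a -> cderiv (fun w => c * f w) z (c * a).
Proof. by move=> fa; apply: (cd_eq (cdM (cdc c z) fa)); rewrite mul0r add0r. Qed.

Lemma cdN f z a : cderiv f z a -> cderiv (fun w => - f w) z (- a).
Proof.
move=> /(cdZ (-1)) fa; have -> : - a = -1 * a by rewrite mulN1r.
by apply: cd_ext fa => w; rewrite mulN1r.
Qed.

Lemma cdB f g z a b : cderiv f z a -> cderiv g z b ->
  cderiv (fun w => f w - g w) z (a - b).
Proof. by move=> fa /cdN; exact: cdD. Qed.

Lemma cd_cont f z d : cderiv f z d -> forall e : R, 0 < e ->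
  exists2 r : R, 0 < r & forall h : C, cm h < r -> cm (f (z + h) - f z) < e.
Proof.
move=> /cd_lip[r r0 H] e e0; have d0 : 0 < 1 + cm d by rewrite ltr_pwDl ?cm_ge0.
exists (Num.min r (e / (1 + cm d))); first by rewrite lt_min r0 divr_gt0.
move=> h; rewrite lt_min => /andP[/H hr he]; apply: le_lt_trans hr _.
by rewrite mulrC -ltr_pdivlMr.
Qed.

Lemma cd_comp f g z a b : cderiv f z a -> cderiv g (f z) b ->
  cderiv (fun w => g (f w)) z (b * a).
Proof.
move=> fa gb e e0.
have K0 : 0 < 1 + cm a by rewrite ltr_pwDl ?cm_ge0.
have L0 : 0 < 1 + cm b by rewrite ltr_pwDl ?cm_ge0.
have e1 : 0 < e / 2 / (1 + cm a) by rewrite !divr_gt0.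
have e2 : 0 < e / 2 / (1 + cm b) by rewrite !divr_gt0.
have [r1 r10 H1] := gb _ e1; have [r2 r20 H2] := fa _ e2.
have [r3 r30 H3] := cd_lip fa; have [r4 r40 H4] := cd_cont fa r10.
exists (Num.min (Num.min r2 r3) r4); first by rewrite !lt_min r20 r30.
move=> h; rewrite !lt_min => /andP[/andP[/H2 h2 /H3 h3] /H4 h4].
pose k := f (z + h) - f z.
have := H1 k h4; rewrite {1}/k [f z + _]addrC subrK => h1.
have -> : g (f (z + h)) - g (f z) - h * (b * a) =
  (g (f (z + h)) - g (f z) - k * b) + (f (z + h) - f z - h * a) * b.
  by rewrite /k; ring.
apply: le_trans (cmD _ _) _; rewrite cmM.
have -> : e * cm h = e / 2 / (1 + cm a) * ((1 + cm a) * cm h) +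
    e / 2 / (1 + cm b) * cm h * (1 + cm b).
  by field; rewrite !gt_eqF.
apply: lerD.
  by apply: le_trans h1 _; rewrite ler_wpM2l// ltW.
by apply: ler_pM; rewrite ?cm_ge0// lerDr.
Qed.

Lemma cdVid z : z != 0 -> cderiv (fun w => w^-1) z (- (z ^- 2)).
Proof.
move=> z0 e e0; have cz : 0 < cm z by rewrite cm_gt0.
pose K : R := cm z ^+ 3.
have K0 : 0 < K by rewrite exprn_gt0.
exists (Num.min (cm z / 2) (e * K / 2)).
  by rewrite lt_min !divr_gt0// mulr_gt0.
move=> h; rewrite lt_min => /andP[hz hK].
have zh : cm z / 2 <= cm (z + h).
  have := cmD (z + h) (- h); rewrite addrK cmN; lra.
have zh0 : z + h != 0 by rewrite -cm_gt0 (lt_le_trans _ zh)// divr_gt0.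
have -> : (z + h)^-1 - z^-1 - h * - z ^- 2 = h ^+ 2 * ((z + h)^-1 * z ^- 2).
  by field; rewrite z0.
have -> : cm (h ^+ 2 * ((z + h)^-1 * z ^- 2)) =
    cm h ^+ 2 * ((cm (z + h))^-1 * cm z ^- 2).
  by rewrite cmM cmX cmM !cmV cmX.
have A : cm h ^+ 2 * ((cm (z + h))^-1 * cm z ^- 2) <=
    cm h ^+ 2 * ((cm z / 2)^-1 * cm z ^- 2).
  rewrite ler_wpM2l ?sqr_ge0// ler_wpM2r ?invr_ge0 ?sqr_ge0// lef_pV2//.
    by rewrite posrE (lt_le_trans _ zh)// divr_gt0.
  by rewrite posrE divr_gt0.
apply: (le_trans A).
have -> : cm h ^+ 2 * ((cm z / 2)^-1 * cm z ^- 2) = (cm h * 2 / K) * cm h.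
  by rewrite /K; field; rewrite gt_eqF.
by rewrite ler_wpM2r ?cm_ge0// ler_pdivrMr// -ler_pdivlMr// ltW.
Qed.

Lemma cdV f z a : f z != 0 -> cderiv f z a ->
  cderiv (fun w => (f w)^-1) z (- (f z ^- 2) * a).
Proof. by move=> f0 fa; exact: cd_comp fa (cdVid f0). Qed.

Lemma cd_neq0 f z d : cderiv f z d -> f z != 0 -> exists2 r : R, 0 < r &
  forall h : C, cm h < r -> f (z + h) != 0.
Proof.
move=> fd f0; have := cd_cont fd; rewrite -cm_gt0 in f0 => /(_ _ f0)[r r0 H].
exists r => // h /H; apply: contraTneq => ->.
by rewrite sub0r cmN ltxx.
Qed.

(** The passage from complex to real calculus: direction w = 1 gives horizontal derivatives, w = i
    vertical ones, and w = h the segments of the mean value inequality. *)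
Lemma cd_rd f z d w (t : R) : cderiv f (z + t%:C * w) d ->
  is_derive t 1 (fun s : R => re (f (z + s%:C * w))) (re (w * d)) /\
  is_derive t 1 (fun s : R => im (f (z + s%:C * w))) (im (w * d)).
Proof.
move=> fd.
have key (e : R) : 0 < e -> exists2 r : R, 0 < r & forall h : R, `|h| < r ->
    cm (f (z + (t + h)%:C * w) - f (z + t%:C * w) - h%:C * (w * d)) <= e * `|h|.
  move=> e0; have W0 : 0 < 1 + cm w by rewrite ltr_pwDl ?cm_ge0.
  have [|r r0 H] := fd (e / (1 + cm w)); first by rewrite divr_gt0.
  exists (r / (1 + cm w)); first by rewrite divr_gt0.
  move=> h hr; have hw : cm (h%:C * w) <= `|h| * (1 + cm w).
    by rewrite cmM cm_real ler_wpM2l// lerDr.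
  have := H (h%:C * w) _.
  have -> : z + t%:C * w + h%:C * w = z + (t + h)%:C * w.
    by rewrite rmorphD/=; ring.
  rewrite -[h%:C * w * d]mulrA => Hh; apply: le_trans (Hh _) _.
    by rewrite (le_lt_trans hw)// -ltr_pdivlMr.
  rewrite mulrAC ler_pdivrMr// -mulrA ler_wpM2l// ltW//.
split; apply: is_derive1P => e /key[r r0 H]; exists r => // h /H.
  move=> Hh; apply: le_trans Hh; apply: le_trans (cm_re _).
  by rewrite !reB reZ.
move=> Hh; apply: le_trans Hh; apply: le_trans (cm_im _).
by rewrite !imB imZ.
Qed.

(* Projecting [g 1 - g 0] on its own direction reduces the vector-valued mean
   value inequality to the scalar one. *)
Lemma mvt_complex (g dg : R -> C) (M : R) :
  (forall t : R, 0 <= t <= 1 -> is_derive t 1 (fun s => re (g s)) (re (dg t)) /\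
     is_derive t 1 (fun s => im (g s)) (im (dg t))) ->
  (forall t : R, 0 <= t <= 1 -> cm (dg t) <= M) -> cm (g 1 - g 0) <= M.
Proof.
move=> gd gM; set D := g 1 - g 0.
have [D0|D0] := eqVneq D 0.
  by rewrite D0 cm0 (le_trans (cm_ge0 (dg 0)))// gM// lexx ler01.
have cD : 0 < cm D by rewrite cm_gt0.
pose p (s : R) := re D * re (g s) + im D * im (g s).
have pd (t : R) : 0 <= t <= 1 ->
    is_derive t 1 p (re D * re (dg t) + im D * im (dg t)).
  move=> /gd[g1 g2]; eapply rd_eq; [rewrite /p; rder|cbv beta; ring].
have [c /gM cM] := mvt (@ler01 R) pd.
rewrite subr0 mulr1 /p.
have -> : re D * re (g 1) + im D * im (g 1) - (re D * re (g 0) + im D * im (g 0))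
    = cm D ^+ 2.
  by rewrite cm_sqr /D !reB !imB; ring.
move=> E; have : cm D ^+ 2 <= cm D * M.
  rewrite E; apply: le_trans (ler_wpM2l (cm_ge0 _) cM).
  have -> : re D * re (dg c) + im D * im (dg c) = re (D^* * dg c).
    by case: (D) (dg c) => [? ?] [? ?] /=; ring.
  apply: le_trans (re_cm _) _; rewrite cmM.
  by have -> // : cm D^* = cm D; rewrite !cmE; case: (D) => ? ? /=; rewrite sqrrN.
by rewrite expr2 ler_pM2l.
Qed.

Lemma mvt_cderiv f (f' : C -> C) z h (M : R) :
  (forall t : R, 0 <= t <= 1 -> cderiv f (z + t%:C * h) (f' (z + t%:C * h))) ->
  (forall t : R, 0 <= t <= 1 -> cm (f' (z + t%:C * h)) <= M) ->
  cm (f (z + h) - f z) <= M * cm h.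
Proof.
move=> fd fM; pose g (s : R) := f (z + s%:C * h).
have -> : f (z + h) - f z = g 1 - g 0 by rewrite /g mul1r mul0r addr0.
apply: (@mvt_complex g (fun t => h * f' (z + t%:C * h))).
  by move=> t /fd; exact: cd_rd.
by move=> t /fM H; rewrite cmM mulrC ler_wpM2r ?cm_ge0.
Qed.

End ComplexDerivative.

(** * The complex exponential and its Taylor remainders *)

Section ComplexExponential.
Context {R : realType}.
Local Notation C := R[i].
Implicit Types (z w h : C).

Lemma re_cexp z : re (cexp z) = expR (re z) * cos (im z).
Proof. by rewrite /cexp reZ. Qed.
Lemma im_cexp z : im (cexp z) = expR (re z) * sin (im z).
Proof. by rewrite /cexp imZ. Qed.
Lemma cm_cexp z : cm (cexp z) = expR (re z).
Proof.
rewrite /cexp cmM cm_real ger0_norm ?expR_ge0//.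
by rewrite cmE/= cos2Dsin2 sqrtr1 mulr1.
Qed.
Lemma cexpD z w : cexp (z + w) = cexp z * cexp w.
Proof.
apply: complex_ext.
  by rewrite [RHS]reM !re_cexp !im_cexp reD imD expRD cosD; ring.
by rewrite [RHS]imM !re_cexp !im_cexp reD imD expRD sinD; ring.
Qed.
Lemma cexp0 : cexp (0 : C) = 1.
Proof. by apply: complex_ext; [rewrite re_cexp|rewrite im_cexp];
  rewrite /= expR0 ?cos0 ?sin0 mul1r. Qed.
Lemma cexp_curve h (t : R) :
  is_derive t 1 (fun s : R => re (cexp (s%:C * h))) (re (h * cexp (t%:C * h))) /\
  is_derive t 1 (fun s : R => im (cexp (s%:C * h))) (im (h * cexp (t%:C * h))).
Proof.
rewrite [re (h * _)]reM [im (h * _)]imM !re_cexp !im_cexp !reZ !imZ; split.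
  apply: (@rd_ext _ (fun s => expR (s * re h) * cos (s * im h))).
    by move=> s; rewrite re_cexp reZ imZ.
  by eapply rd_eq; [rder | cbv beta; ring].
apply: (@rd_ext _ (fun s => expR (s * re h) * sin (s * im h))).
  by move=> s; rewrite im_cexp reZ imZ.
by eapply rd_eq; [rder | cbv beta; ring].
Qed.

(** Along the segment from 0 to h each Taylor remainder has h times the preceding remainder as
    derivative, so the mean value inequality raises the order by one in this and the next two
    bounds; the factorials are given up. *)
Lemma cexp1_bound h : cm (cexp h - 1) <= cm h * expR (cm h).
Proof.
have := @mvt_complex R (fun s => cexp (s%:C * h)) (fun t => h * cexp (t%:C * h))
  (cm h * expR (cm h)) (fun t _ => cexp_curve h t).
rewrite mul1r mul0r cexp0; apply => t /andP[t0 t1].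
rewrite cmM ler_wpM2l ?cm_ge0// cm_cexp ler_expR reZ.
apply: (@le_trans _ _ (t * cm h)); first by rewrite ler_wpM2l// re_cm.
by rewrite ler_piMl ?cm_ge0.
Qed.

Lemma expR_scale_le (t x : R) : 0 <= t <= 1 -> 0 <= x ->
  expR (t * x) <= expR x.
Proof. by move=> /andP[t0 t1] x0; rewrite ler_expR ler_piMl. Qed.

Lemma cexp2_bound h : cm (cexp h - 1 - h) <= cm h ^+ 2 * expR (cm h).
Proof.
have := @mvt_complex R (fun s => cexp (s%:C * h) - 1 - s%:C * h)
  (fun t => h * (cexp (t%:C * h) - 1)) (cm h ^+ 2 * expR (cm h)).
rewrite mul1r mul0r cexp0 !subrr subr0; apply.
- move=> t _; have [d1 d2] := cexp_curve h t.
  split.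
    apply: (@rd_ext _ (fun s => re (cexp (s%:C * h)) + (- 1) + - (s * re h))).
      by move=> s; rewrite !reB (reZ s h) re1.
    by eapply rd_eq; [rder | cbv beta; rewrite mulrBr mulr1 reB; ring].
  apply: (@rd_ext _ (fun s => im (cexp (s%:C * h)) + - (s * im h))).
    by move=> s; rewrite !imB (imZ s h) im1 subr0.
  by eapply rd_eq; [rder | cbv beta; rewrite mulrBr mulr1 imB; ring].
- move=> t t01; rewrite cmM expr2 -mulrA ler_wpM2l ?cm_ge0//.
  apply: le_trans (cexp1_bound _) _; rewrite cmM cm_real ger0_norm; last by case/andP: t01.
  apply: ler_pM; rewrite ?mulr_ge0 ?cm_ge0 ?expR_ge0 ?expR_scale_le ?cm_ge0//.
    by case/andP: t01.
  by rewrite ler_piMl ?cm_ge0//; case/andP: t01.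
Qed.

Lemma cexp3_bound h :
  cm (cexp h - 1 - h - h ^+ 2 / 2) <= cm h ^+ 3 * expR (cm h).
Proof.
have := @mvt_complex R (fun s => cexp (s%:C * h) - 1 - s%:C * h - (s ^+ 2)%:C * (h ^+ 2 / 2))
  (fun t => h * (cexp (t%:C * h) - 1 - t%:C * h)) (cm h ^+ 3 * expR (cm h)).
rewrite expr1n expr0n/= !mul1r mul0r mul0r cexp0 !subrr !subr0; apply.
- move=> t _; have [d1 d2] := cexp_curve h t.
  have hE : h * (cexp (t%:C * h) - 1 - t%:C * h) =
      h * cexp (t%:C * h) - h - (t * 2)%:C * (h ^+ 2 / 2).
    by rewrite rmorphM/= rmorph_nat; field.
  split.
    apply: (@rd_ext _ (fun s => re (cexp (s%:C * h)) + (- 1) + - (s * re h) + - (s * s * re (h ^+ 2 / 2)))).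
      by move=> s; rewrite !reB (reZ s h) (reZ (s ^+ 2)) re1.
    eapply rd_eq; [rder|].
    by rewrite hE !reB (reZ (t * 2)); cbv beta; ring.
  apply: (@rd_ext _ (fun s => im (cexp (s%:C * h)) + - (s * im h) + - (s * s * im (h ^+ 2 / 2)))).
    by move=> s; rewrite !imB (imZ s h) (imZ (s ^+ 2)) im1 subr0.
  eapply rd_eq; [rder|].
  by rewrite hE !imB (imZ (t * 2)); cbv beta; ring.
- move=> t t01; rewrite cmM exprS -mulrA ler_wpM2l ?cm_ge0//.
  apply: le_trans (cexp2_bound _) _; rewrite cmM cm_real ger0_norm; last by case/andP: t01.
  apply: ler_pM; rewrite ?exprn_ge0 ?mulr_ge0 ?cm_ge0 ?expR_ge0 ?expR_scale_le ?cm_ge0//.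
    by case/andP: t01.
  rewrite lerXn2r ?nnegrE ?mulr_ge0 ?cm_ge0 //; first by case/andP: t01.
  by rewrite ler_piMl ?cm_ge0//; case/andP: t01.
Qed.

Lemma cd_cexp z : cderiv (@cexp R) z (cexp z).
Proof.
move=> e e0; have K0 : 0 < cm (cexp z) * expR 1 by rewrite mulr_gt0 ?expR_gt0// cm_cexp expR_gt0.
exists (Num.min 1 (e / (cm (cexp z) * expR 1))).
  by rewrite lt_min ltr01 divr_gt0.
move=> h; rewrite lt_min => /andP[h1 hK].
have -> : cexp (z + h) - cexp z - h * cexp z = cexp z * (cexp h - 1 - h).
  by rewrite cexpD; ring.
rewrite cmM; apply: le_trans (ler_wpM2l (cm_ge0 _) (cexp2_bound _)) _.
rewrite expr2 -mulrA mulrCA [e * _]mulrC ler_wpM2l ?cm_ge0//.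
apply: (@le_trans _ _ (cm h * (cm (cexp z) * expR 1))).
  rewrite mulrCA ler_wpM2l ?cm_ge0// ler_wpM2l ?cm_ge0// ler_expR ltW//.
by rewrite -ler_pdivlMr// ltW.
Qed.

Lemma cdexp (f : C -> C) z d : cderiv f z d ->
  cderiv (fun w => cexp (f w)) z (cexp (f z) * d).
Proof. by move=> fd; exact: cd_comp fd (cd_cexp _). Qed.

End ComplexExponential.

(** * Complex series and termwise differentiation *)

Section ComplexSeries.
Context {R : realType}.
Local Notation C := R[i].
Implicit Types (u a b : nat -> C) (l c : C) (M : nat -> R).

Definition climit u l := forall e : R, 0 < e -> exists N : nat,
  forall n, (N <= n)%N -> cm (u n - l) <= e.

Lemma climit_unique u l1 l2 : climit u l1 -> climit u l2 -> l1 = l2.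
Proof.
move=> h1 h2; apply/eqP; rewrite -subr_eq0 -cm_eq0; apply/eqP.
apply/eqP; rewrite eq_le cm_ge0 andbT; apply/ler_addgt0Pl => e e0; rewrite addr0.
have e20 : 0 < e / 2 by rewrite divr_gt0.
have [N1 H1] := h1 _ e20; have [N2 H2] := h2 _ e20.
have {}H1 := H1 _ (leq_maxl N1 N2); have {}H2 := H2 _ (leq_maxr N1 N2).
have -> : l1 - l2 = (u (maxn N1 N2) - l2) - (u (maxn N1 N2) - l1) by ring.
by apply: le_trans (cmB _ _) _; lra.
Qed.

Lemma climitD u v l m : climit u l -> climit v m ->
  climit (fun n => u n + v n) (l + m).
Proof.
move=> hu hv e e0; have e20 : 0 < e / 2 by rewrite divr_gt0.
have [N1 H1] := hu _ e20; have [N2 H2] := hv _ e20.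
exists (maxn N1 N2) => n; rewrite geq_max => /andP[/H1 h1 /H2 h2].
have -> : u n + v n - (l + m) = (u n - l) + (v n - m) by ring.
by apply: le_trans (cmD _ _) _; lra.
Qed.

Lemma climit_const c : climit (fun=> c) c.
Proof. by move=> e e0; exists 0%N => n _; rewrite subrr cm0 ltW. Qed.

Lemma climit_cM c u l : climit u l -> climit (fun n => c * u n) (c * l).
Proof.
move=> hu e e0; have K0 : 0 < 1 + cm c by rewrite ltr_pwDl ?cm_ge0.
have [|N H] := hu (e / (1 + cm c)); first by rewrite divr_gt0.
exists N => n /H h; rewrite -mulrBr cmM.
apply: (@le_trans _ _ ((1 + cm c) * (e / (1 + cm c)))).
  by apply: ler_pM; rewrite ?cm_ge0// lerDr.
by rewrite mulrC divfK ?gt_eqF.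
Qed.

Lemma climit_ext u v l : u =1 v -> climit u l -> climit v l.
Proof. by move=> /funext ->. Qed.

Lemma climit_bound u l (B : R) : climit u l -> (forall n, cm (u n) <= B) ->
  cm l <= B.
Proof.
move=> hu hB; apply/ler_addgt0Pl => e e0; have [N H] := hu _ e0.
have {}H := H N (leqnn _).
have -> : l = u N - (u N - l) by ring.
by apply: le_trans (cmB _ _) _; have := hB N; lra.
Qed.

Definition csums a l := climit (fun N => \sum_(0 <= i < N) a i) l.

(** A total function with value 0 on divergent series, so that series of functions can be written
    down before convergence is known; [csumE] identifies it. *)
Definition csum a : C := xget 0 [set l | csums a l].

Lemma csums_unique a l1 l2 : csums a l1 -> csums a l2 -> l1 = l2.
Proof. exact: climit_unique. Qed.

Lemma csumE a l : csums a l -> csum a = l.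
Proof.
move=> al; rewrite /csum; case: xgetP => [x _ /= ax|/(_ l)//].
exact: csums_unique ax al.
Qed.

Lemma bounded_tail M (B : R) : (forall n, 0 <= M n) ->
  (forall N, \sum_(0 <= i < N) M i <= B) ->
  forall e : R, 0 < e -> exists N0 : nat, forall N n, (N0 <= N)%N -> (N <= n)%N ->
    \sum_(N <= i < n) M i <= e.
Proof.
move=> M0 MB e e0.
pose s N := \sum_(0 <= i < N) M i.
have hs : has_sup (range s).
  by split; [exists (s 0%N); exists 0%N|exists B => _ [n _ <-]; exact: MB].
have [_ [N0 _ <-] hN0] := sup_adherent e0 hs.
have smono m n : (m <= n)%N -> s n = s m + \sum_(m <= i < n) M i.
  by move=> mn; rewrite /s (big_cat_nat (leq0n m) mn).
exists N0 => N n N0N Nn.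
have sn : s n <= sup (range s) by apply: ub_le_sup; [exact: hs.2|exists n].
have := smono _ _ N0N; have := smono _ _ Nn.
have : 0 <= \sum_(N0 <= i < N) M i by apply: sumr_ge0.
lra.
Qed.

Lemma bounded_csums a M (B : R) : (forall n, cm (a n) <= M n) ->
  (forall N, \sum_(0 <= i < N) M i <= B) -> csums a (csum a).
Proof.
move=> aM MB.
have M0 n : 0 <= M n := le_trans (cm_ge0 _) (aM n).
have cvM : cvgn (series M).
  apply: nondecreasing_is_cvgn; last by exists B => _ [n _ <-]; exact: MB.
  by apply/nondecreasing_seqP => n; rewrite /series/= big_nat_recr//= lerDl.
have part (u : nat -> R) : (forall n, `|u n| <= M n) -> exists l : R,
    forall e : R, 0 < e -> exists N : nat, forall n, (N <= n)%N ->
      `|\sum_(0 <= i < n) u i - l| <= e.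
  move=> uM; have /normed_cvg : cvgn [normed series u].
    by apply: (series_le_cvg _ M0 uM cvM) => n; exact: normr_ge0.
  move=> /cvg_ex[l /cvgrPdist_le H]; exists l => e /H[N _ {}H].
  by exists N => n /H; rewrite distrC.
have [lr Hr] := part _ (fun n => le_trans (cm_re _) (aM n)).
have [li Hi] := part _ (fun n => le_trans (cm_im _) (aM n)).
suff al : csums a (lr +i* li) by rewrite (csumE al).
move=> e e0; have e20 : 0 < e / 2 by rewrite divr_gt0.
have [N1 H1] := Hr _ e20; have [N2 H2] := Hi _ e20.
exists (maxn N1 N2) => n; rewrite geq_max => /andP[/H1 h1 /H2 h2].
apply: le_trans (cm_reim _) _; rewrite reB imB re_sum im_sum /=; lra.
Qed.

Lemma csums_bound a l M (B : R) : csums a l -> (forall n, cm (a n) <= M n) ->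
  (forall N, \sum_(0 <= i < N) M i <= B) -> cm l <= B.
Proof.
move=> al aM MB; apply: climit_bound al _ => n.
by apply: le_trans (cm_sum _ _ _) _; apply: le_trans (MB n); apply: ler_sum.
Qed.

Lemma csumsD a b l m : csums a l -> csums b m ->
  csums (fun n => a n + b n) (l + m).
Proof. by move=> al bm; apply: climit_ext (climitD al bm) => n; rewrite big_split. Qed.

Lemma csums_cM c a l : csums a l -> csums (fun n => c * a n) (c * l).
Proof. by move=> al; apply: climit_ext (climit_cM c al) => n; rewrite mulr_sumr. Qed.

(* A series of functions may be differentiated term by term as soon as the
   second derivatives are dominated by a convergent series near the point. *)
Lemma cderiv_series (f f1 f2 : nat -> C -> C) (z : C) (r : R) M (B : R)
    (F F1 : C -> C) : 0 < r ->
  (forall n w, cm (w - z) <= r -> cderiv (f n) w (f1 n w)) ->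
  (forall n w, cm (w - z) <= r -> cderiv (f1 n) w (f2 n w)) ->
  (forall n w, cm (w - z) <= r -> cm (f2 n w) <= M n) ->
  (forall N, \sum_(0 <= i < N) M i <= B) ->
  (forall w, cm (w - z) <= r -> csums (f ^~ w) (F w)) ->
  csums (f1 ^~ z) (F1 z) -> cderiv F z (F1 z).
Proof.
move=> r0 fd fd1 f2M MB FE F1E e e0.
have M0 n : 0 <= M n.
  by apply: le_trans (cm_ge0 (f2 n z)) _; apply: f2M; rewrite subrr cm0 ltW.
have B0 : 0 <= B by have := MB 0%N; rewrite big_nil.
have B1 : 0 < 1 + B by rewrite ltr_pwDl.
exists (Num.min r (e / (1 + B))); first by rewrite lt_min r0 divr_gt0.
move=> h; rewrite lt_min => /andP[hr he].
have zh (t : R) : 0 <= t <= 1 -> cm (z + t%:C * h - z) <= cm h.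
  move=> /andP[t0 t1]; rewrite [z + _]addrC addrK cmM cm_real ger0_norm//.
  by rewrite ler_piMl ?cm_ge0.
have zhr (t : R) (t01 : 0 <= t <= 1) := le_trans (zh t t01) (ltW hr).
have z01 : 0 <= (0 : R) <= 1 by rewrite lexx ler01.
have z11 : 0 <= (1 : R) <= 1 by rewrite lexx ler01.
have E0 := FE z; have E1 := FE (z + h).
have {}E0 : csums (f ^~ z) (F z) by apply: E0; rewrite subrr cm0 ltW.
have {}E1 : csums (f ^~ (z + h)) (F (z + h)).
  by apply: E1; have := zhr 1 z11; rewrite mul1r.
have S := csumsD (csumsD E1 (csums_cM (-1) E0)) (csums_cM (- h) F1E).
have -> : F (z + h) - F z - h * F1 z = F (z + h) + -1 * F z + - h * F1 z by ring.
apply: (@le_trans _ _ (cm h * (cm h * B))); last first.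
  rewrite mulrC ler_wpM2r ?cm_ge0//.
  apply: (@le_trans _ _ (cm h * (1 + B))); last by rewrite -ler_pdivlMr// ltW.
  by rewrite ler_wpM2l ?cm_ge0// lerDr.
apply: (csums_bound S (M := fun n => cm h * (cm h * M n))); last first.
  by move=> N; rewrite -!mulr_sumr !ler_wpM2l ?cm_ge0.
move=> n /=.
(* The Taylor remainder is the increment of [f n w - w * f1 n z]. The derivative of that function is
   an increment of [f1 n], hence O(|h|) by a second mean value inequality. *)
have -> : f n (z + h) + -1 * f n z + - h * f1 n z =
    (f n (z + h) - (z + h) * f1 n z) - (f n z - z * f1 n z) by ring.
rewrite [cm h * _]mulrC.
apply: (@mvt_cderiv _ (fun w => f n w - w * f1 n z) (fun w => f1 n w - f1 n z)).
  move=> t t01; apply: cd_eq (cdB (fd _ _ (zhr t t01)) (cdM (cdid _) (cdc _ _))) _.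
  by rewrite mul1r mulr0 addr0.
move=> t t01; rewrite [cm h * _]mulrC.
apply: (@le_trans _ _ (M n * cm (t%:C * h))); last first.
  by rewrite ler_wpM2l//; have := zh t t01; rewrite [z + _]addrC addrK.
apply: (@mvt_cderiv _ (f1 n) (f2 n)) => s s01.
  have -> : z + s%:C * (t%:C * h) = z + (s * t)%:C * h by rewrite rmorphM/= mulrA.
  apply: fd1; apply: zhr; case/andP: t01 => t0 t1; case/andP: s01 => s0 s1.
  by rewrite mulr_ge0//= mulr_ile1.
have -> : z + s%:C * (t%:C * h) = z + (s * t)%:C * h by rewrite rmorphM/= mulrA.
apply: f2M; apply: zhr; case/andP: t01 => t0 t1; case/andP: s01 => s0 s1.
by rewrite mulr_ge0//= mulr_ile1.
Qed.

End ComplexSeries.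

(** * The zeta function to the right of 0 *)

Section ZetaContinuation.
Context {R : realType}.
Local Notation C := R[i].
Implicit Types (s z w u : C) (k n : nat) (x t a : R).

(** Comparison with the integral of x^(-1-a) by telescoping: the mean value theorem for x^(-a)
    bounds every term after the first by the drop of x^(-a)/a over the preceding unit interval. *)
Lemma sum_powers a N : 0 < a ->
  \sum_(0 <= i < N) expR (- ((1 + a) * ln i.+1%:R)) <= 1 + a^-1.
Proof.
move=> a0; case: N => [|N].
  by rewrite big_geq// addr_ge0// invr_ge0 ltW.
suff : \sum_(0 <= i < N.+1) expR (- ((1 + a) * ln i.+1%:R)) <=
    1 + a^-1 * (1 - expR (- (a * ln N.+1%:R))).
  move=> /le_trans; apply; rewrite lerD2l ler_piMr ?invr_ge0 ?(ltW a0)//.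
elim: N => [|N IH].
  by rewrite big_nat1 ln1 !mulr0 oppr0 expR0 subrr mulr0 addr0.
rewrite big_nat_recr//=; move: IH; move: (\sum_(0 <= i < N.+1) _) => S IH.
suff : expR (- ((1 + a) * ln N.+2%:R)) <=
    a^-1 * (expR (- (a * ln N.+1%:R)) - expR (- (a * ln N.+2%:R))) by lra.
have N12 : N.+1%:R <= N.+2%:R :> R by rewrite ler_nat.
have d (x : R) : N.+1%:R <= x <= N.+2%:R ->
    is_derive x 1 (fun y => expR (- (a * ln y))) (- (a * expR (- ((1 + a) * ln x)))).
  move=> /andP[Nx _]; have x0 : 0 < x by apply: lt_le_trans Nx.
  have lnd := is_derive1_ln x0.
  eapply rd_eq; [rder|cbv beta].
  have -> : - ((1 + a) * ln x) = - ln x + - (a * ln x) by ring.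
  by rewrite expRD [expR (- ln x)]expRN lnK ?posrE//; ring.
have [c /andP[Nc cN]] := mvt N12 d.
have -> : N.+2%:R - N.+1%:R = 1 :> R by rewrite -natrB// subSnn.
rewrite mulr1 => E; rewrite ler_pdivlMl//.
have -> : expR (- (a * ln N.+1%:R)) - expR (- (a * ln N.+2%:R)) =
  a * expR (- ((1 + a) * ln c)) by lra.
have c0 : 0 < c by apply: lt_le_trans Nc.
by rewrite ler_pM2l// ler_expR lerN2 ler_pM2l ?addr_gt0// ler_ln ?posrE.
Qed.

Lemma cdX (f : C -> C) z d k : cderiv f z d ->
  cderiv (fun w => f w ^+ k) z (k%:R * f z ^+ k.-1 * d).
Proof.
move=> fd; elim: k => [|k IH].
  by rewrite !mul0r; exact: cdc.
apply: cd_eq (cd_ext _ (cdM fd IH)) _; first by move=> w; rewrite exprS.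
case: k {IH} => [|k] /=; first by rewrite mul0r; ring.
by rewrite exprS -[in RHS]natr1; ring.
Qed.

Lemma cd_rcomp (f : C -> C) (u : R -> R) t d (du : R) :
  cderiv f (u t)%:C d -> is_derive t 1 u du ->
  is_derive t 1 (fun s : R => re (f (u s)%:C)) (re (du%:C * d)) /\
  is_derive t 1 (fun s : R => im (f (u s)%:C)) (im (du%:C * d)).
Proof.
move=> fd ud; rewrite reZ imZ.
have [|d1 d2] := @cd_rd R f 0 d 1 (u t); first by rewrite add0r mulr1.
have {}d1 := rd_comp ud d1; have {}d2 := rd_comp ud d2.
rewrite mul1r in d1 d2; split.
  apply: (rd_eq (rd_ext _ d1)); last by rewrite mulrC.
  by move=> s; rewrite add0r mulr1.
apply: (rd_eq (rd_ext _ d2)); last by rewrite mulrC.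
by move=> s; rewrite add0r mulr1.
Qed.

(* With [u = ln x], [zG k s u] is the k-th s-derivative of [x `^ (1 - s)],
   [zG1 k s u] is its x-derivative and [zG2 k s u / x] the second one. *)
Definition zG k s u : C := (- u) ^+ k * cexp ((1 - s) * u).
Definition zG1 k s u : C :=
  ((1 - s) * (- u) ^+ k - k%:R * (- u) ^+ k.-1) * cexp (- s * u).
Definition zG2 k s u : C :=
  (- s * ((1 - s) * (- u) ^+ k - k%:R * (- u) ^+ k.-1)
   - ((1 - s) * (k%:R * (- u) ^+ k.-1) - k%:R * (k.-1%:R * (- u) ^+ k.-2)))
  * cexp (- s * u).

Lemma cd_zG_u k s u : cderiv (zG k s) u (zG1 k s u * cexp u).
Proof.
apply: cd_eq; first by apply: cdM; [apply: cdX; apply: cdN; exact: cdid|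
  apply: cdexp; apply: cdZ; exact: cdid].
have E : cexp (- s * u) * cexp u = cexp ((1 - s) * u).
  by rewrite -cexpD; congr cexp; ring.
by rewrite /zG1 -[RHS]mulrA E; ring.
Qed.

Lemma cd_zG1_u k s u : cderiv (zG1 k s) u (zG2 k s u).
Proof.
apply: cd_eq; first (apply: cdM; last by (apply: cdexp; apply: cdZ; exact: cdid)).
  by apply: cdB; apply: cdZ; apply: cdX; apply: cdN; exact: cdid.
by rewrite /zG2; ring.
Qed.

Lemma cd_zG_s k u s : cderiv (fun s => zG k s u) s (zG k.+1 s u).
Proof.
rewrite /zG; apply: cd_eq; first (apply: cdZ; apply: cdexp; apply: cdM; last exact: cdc).
  by apply: cdB; [exact: cdc|exact: cdid].
by rewrite exprSr; ring.
Qed.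

Lemma cd_zG1_s k u s : cderiv (fun s => zG1 k s u) s (zG1 k.+1 s u).
Proof.
rewrite /zG1; apply: cd_eq.
  apply: cdM; last by (apply: cdexp; apply: cdM; [apply: cdN; exact: cdid|exact: cdc]).
  by apply: cdB; [apply: cdM; [apply: cdB; [exact: cdc|exact: cdid]|exact: cdc]|exact: cdc].
case: k => [|k] /=; first by rewrite expr0 expr1; ring.
by rewrite !exprS -[k.+2%:R]natr1; ring.
Qed.

(** For k = 0, the error in replacing the increment of x^(1-s) over [n+1, n+2] by its first-order
    term at n+1. The increments telescope, the first-order terms are (1-s)(n+1)^(-s), and the error
    is of order (n+1)^(-1-Re s), so its series converges for Re s > 0. The index k counts
    derivatives in s. *)
Definition zterm k n s : C :=
  zG k s (ln n.+2%:R)%:C - zG k s (ln n.+1%:R)%:C - zG1 k s (ln n.+1%:R)%:C.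

Lemma cd_zterm k n s : cderiv (zterm k n) s (zterm k.+1 n s).
Proof. by apply: cdB; [apply: cdB; exact: cd_zG_s|exact: cd_zG1_s]. Qed.

Lemma zG2_bound k s x : 0 <= x ->
  cm (zG2 k s x%:C) <= (cm s + k%:R) * (cm (1 - s) + k%:R) * (1 + x) ^+ k * expR (- (re s * x)).
Proof.
move=> x0; rewrite /zG2 cmM cm_cexp.
have -> : re (- s * x%:C) = - (re s * x).
  by rewrite reM /= mulr0 subr0 reN mulNr.
rewrite ler_wpM2r ?expR_ge0//.
have P (j i : nat) : (j <= i)%N -> cm ((- x%:C) ^+ j) <= (1 + x) ^+ i.
  move=> ji; rewrite cmX cmN cm_real ger0_norm//.
  apply: (@le_trans _ _ ((1 + x) ^+ j)).
    by apply: lerXn2r; rewrite ?nnegrE ?addr_ge0// lerDr.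
  by apply: ler_weXn2l => //; rewrite lerDl.
have P0 := P k k (leqnn _); have P1 := P k.-1 k (leq_pred _).
have P2 : cm ((- x%:C) ^+ k.-2) <= (1 + x) ^+ k.
  by apply: P; exact: leq_trans (leq_pred _) (leq_pred _).
have X0 : 0 <= (1 + x) ^+ k by rewrite exprn_ge0// addr_ge0.
set X := (1 + x) ^+ k in P0 P1 P2 X0 *.
have kk : k.-1%:R <= k%:R :> R by rewrite ler_nat leq_pred.
have k0 : 0 <= k%:R :> R by [].
apply: le_trans (cmB _ _) _; rewrite cmM cmN.
apply: (@le_trans _ _ (cm s * (cm (1 - s) * X + k%:R * X) +
   (cm (1 - s) * (k%:R * X) + k%:R * (k%:R * X)))); last first.
  by rewrite -subr_ge0 [X in 0 <= X](_ : _ = 0)//; ring.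
apply: lerD.
  rewrite ler_wpM2l ?cm_ge0//; apply: le_trans (cmB _ _) _.
  by rewrite !cmM cm_nat lerD// ler_wpM2l// cm_ge0.
apply: le_trans (cmB _ _) _; rewrite !cmM !cm_nat lerD//.
  by rewrite ler_wpM2l ?cm_ge0// ler_wpM2l.
by rewrite ler_wpM2l// ler_pM// cm_ge0.
Qed.

(** A first-order Taylor remainder over a unit interval is at most the supremum of the second
    derivative, which at x is [zG2 k s (ln x)] divided by x. *)
Lemma zterm_bound_gen k n s (B : R) :
  (forall x, n.+1%:R <= x -> cm (zG2 k s (ln x)%:C) / x <= B) ->
  cm (zterm k n s) <= B.
Proof.
move=> HB.
have x0 t : 0 <= t -> 0 < n.+1%:R + t :> R.
  by move=> t0; rewrite ltr_pwDl.
have lnd t : 0 <= t -> is_derive t 1 (fun y : R => ln (n.+1%:R + y)) (n.+1%:R + t)^-1.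
  by move=> t0; apply: (rd_eq (rdln (x0 t t0) (rdD (rdc _ _) (rdid _)))); rewrite add0r mulr1.
have cln t : 0 <= t -> cexp (ln (n.+1%:R + t))%:C = (n.+1%:R + t)%:C.
  move=> t0; apply: complex_ext; rewrite ?re_cexp ?im_cexp/= ?cos0 ?sin0 ?mulr0//.
  by rewrite mulr1 lnK// posrE x0.
pose g1 t := zG1 k s (ln (n.+1%:R + t))%:C.
pose g2 t := ((n.+1%:R + t)^-1)%:C * zG2 k s (ln (n.+1%:R + t))%:C.
have dg1 t : 0 <= t -> is_derive t 1 (fun y => re (g1 y)) (re (g2 t)) /\
   is_derive t 1 (fun y => im (g1 y)) (im (g2 t)).
  by move=> t0; apply: cd_rcomp (lnd t t0); exact: cd_zG1_u.
pose g t := zG k s (ln (n.+1%:R + t))%:C.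
have dg t : 0 <= t -> is_derive t 1 (fun y => re (g y)) (re (g1 t)) /\
   is_derive t 1 (fun y => im (g y)) (im (g1 t)).
  move=> t0; have := cd_rcomp (cd_zG_u k s _) (lnd t t0); rewrite cln//.
  have -> : ((n.+1%:R + t)^-1)%:C * (zG1 k s (ln (n.+1%:R + t))%:C * (n.+1%:R + t)%:C) = g1 t.
    rewrite mulrC -mulrA -rmorphM/= divff ?mulr1// gt_eqF// x0//.
  by [].
have g2B t : 0 <= t -> cm (g2 t) <= B.
  move=> t0; apply: le_trans (HB (n.+1%:R + t) _); last by rewrite lerDl.
  by rewrite /g2 cmM cm_real ger0_norm ?invr_ge0 ?(ltW (x0 t t0))// mulrC.
have B0 : 0 <= B by apply: le_trans (g2B 0 (lexx _)); exact: cm_ge0.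
have -> : zterm k n s = (g 1 - 1%:C * g1 0) - (g 0 - 0%:C * g1 0).
  rewrite /zterm /g /g1 addr0 mul1r mul0r subr0 natr1.
  by rewrite addrAC.
apply: (@mvt_complex _ (fun t => g t - t%:C * g1 0) (fun t => g1 t - g1 0)) => t /andP[t0 t1].
  have [d1 d2] := dg t t0; split.
    apply: (@rd_ext _ (fun y : R => re (g y) + - (y * re (g1 0)))).
      by move=> y; rewrite reB reZ.
    by eapply rd_eq; [rder | cbv beta; rewrite reB; ring].
  apply: (@rd_ext _ (fun y : R => im (g y) + - (y * im (g1 0)))).
    by move=> y; rewrite imB imZ.
  by eapply rd_eq; [rder | cbv beta; rewrite imB; ring].
have -> : g1 t - g1 0 = g1 (1 * t) - g1 (0 * t) by rewrite mul1r mul0r.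
apply: (@mvt_complex _ (fun y => g1 (y * t)) (fun y => t%:C * g2 (y * t))) => y /andP[y0 y1].
  have yt : 0 <= y * t by rewrite mulr_ge0.
  have [d1 d2] := dg1 _ yt; rewrite reZ imZ.
  have dm : is_derive y 1 (fun v : R => v * t) t.
    by eapply rd_eq; [rder|cbv beta; ring].
  split; [have := rd_comp dm d1|have := rd_comp dm d2]; by rewrite mulrC.
have yt : 0 <= y * t by rewrite mulr_ge0.
rewrite cmM cm_real ger0_norm//; apply: le_trans (g2B _ yt).
by rewrite ler_piMl ?cm_ge0.
Qed.

Lemma zterm0_bound n s : 0 < re s ->
  cm (zterm 0 n s) <= cm s * cm (1 - s) * expR (- ((1 + re s) * ln n.+1%:R)).
Proof.
move=> s0; apply: zterm_bound_gen => x nx.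
have x0 : 0 < x by apply: lt_le_trans nx.
have x1 : 1 <= x by apply: le_trans nx; rewrite ler1n.
have := zG2_bound 0 s (ln_ge0 x1); rewrite expr0 !addr0 mulr1 => H.
apply: (@le_trans _ _ (cm s * cm (1 - s) * expR (- (re s * ln x)) / x)).
  by rewrite ler_wpM2r// invr_ge0 ltW.
rewrite -mulrA ler_wpM2l ?mulr_ge0 ?cm_ge0//.
have {1}-> : x^-1 = expR (- ln x) by rewrite expRN lnK.
rewrite -expRD ler_expR.
have : (1 + re s) * ln n.+1%:R <= (1 + re s) * ln x.
  by rewrite ler_pM2l ?addr_gt0// ler_ln ?posrE.
lra.
Qed.

(** One term of the exponential series. Differentiation in s produces powers of the logarithm; this
    absorbs them at the price of a part of the exponential decay. *)
Lemma poly_exp_bound k a x : 0 < a -> 0 <= x ->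
  (1 + x) ^+ k <= (k`!%:R / a ^+ k * expR a) * expR (a * x).
Proof.
move=> a0 x0; case: k => [|k].
  by rewrite !expr0 fact0 divr1 mul1r -expRD -expR0 ler_expR addr_ge0 ?mulr_ge0// ltW.
have y0 : 0 <= a * (1 + x) by rewrite mulr_ge0 ?addr_ge0// ltW.
have F0 : 0 < k.+1`!%:R :> R by rewrite ltr0n fact_gt0.
have A0 : 0 < a ^+ k.+1 by rewrite exprn_gt0.
have := expR_ge1Dxn k y0; rewrite mulrDr mulr1 expRD => H.
have {}H : (a + a * x) ^+ k.+1 / k.+1`!%:R <= expR a * expR (a * x).
  by apply: le_trans H; rewrite lerDr.
have -> : (1 + x) ^+ k.+1 = (a + a * x) ^+ k.+1 / k.+1`!%:R * (k.+1`!%:R / a ^+ k.+1).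
  have -> : a + a * x = a * (1 + x) by ring.
  by rewrite exprMn; field; rewrite !gt_eqF.
by rewrite mulrC -[leRHS]mulrA ler_wpM2l ?divr_ge0 ?(ltW F0) ?(ltW A0).
Qed.

Lemma zterm_bound k a : 0 < a -> exists2 K : R, 0 <= K & forall n s, a <= re s ->
  cm (zterm k n s) <= K * (cm s + k%:R) * (cm (1 - s) + k%:R) *
    expR (- ((1 + a / 2) * ln n.+1%:R)).
Proof.
move=> a0; have a20 : 0 < a / 2 by rewrite divr_gt0.
pose K : R := k`!%:R / (a / 2) ^+ k * expR (a / 2).
have K0 : 0 <= K by rewrite !mulr_ge0 ?expR_ge0// invr_ge0 exprn_ge0// ltW.
exists K => // n s sa; apply: zterm_bound_gen => x nx.
have x0 : 0 < x by apply: lt_le_trans nx.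
have x1 : 1 <= x by apply: le_trans nx; rewrite ler1n.
have l0 := ln_ge0 x1.
have S0 : 0 <= (cm s + k%:R) * (cm (1 - s) + k%:R).
  by rewrite mulr_ge0 ?addr_ge0 ?cm_ge0.
apply: (@le_trans _ _ ((cm s + k%:R) * (cm (1 - s) + k%:R) * (K * expR (a / 2 * ln x))
    * expR (- (a * ln x)) / x)).
  rewrite ler_wpM2r ?invr_ge0 ?(ltW x0)//.
  apply: le_trans (zG2_bound _ _ l0) _.
  rewrite ler_pM ?expR_ge0 ?mulr_ge0 ?exprn_ge0 ?addr_ge0 ?cm_ge0//.
    by rewrite ler_wpM2l// poly_exp_bound.
  by rewrite ler_expR lerN2 ler_wpM2r.
move: (cm s + _) (cm (1 - s) + _) S0 => P Q S0.
have -> : P * Q * (K * expR (a / 2 * ln x)) * expR (- (a * ln x)) / x =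
  K * P * Q * (expR (a / 2 * ln x) * expR (- (a * ln x)) / x) by ring.
rewrite -[K * P * Q]mulrA ler_wpM2l ?(mulr_ge0 K0)// -expRD.
have {1}-> : x^-1 = expR (- ln x) by rewrite expRN lnK.
rewrite -expRD ler_expR.
have : (1 + a / 2) * ln n.+1%:R <= (1 + a / 2) * ln x.
  by rewrite ler_pM2l ?addr_gt0// ler_ln ?posrE.
lra.
Qed.

(** [zetaZ 0] is (s-1) zeta(s) on Re s > 0, without a pole, and [zetaZ k] is its k-th derivative.
    The summand 1 is the term 1^(1-s) left over by the telescoping; it disappears on
    differentiation. *)
Definition zetaZ k s : C := (k == 0%N)%:R + csum (fun n => zterm k n s).

Lemma zterm_csums k s : 0 < re s ->
  csums (fun n => zterm k n s) (csum (fun n => zterm k n s)).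
Proof.
move=> s0; have [K K0 H] := zterm_bound k s0.
apply: (bounded_csums (M := fun n => K * (cm s + k%:R) * (cm (1 - s) + k%:R) *
    expR (- ((1 + re s / 2) * ln n.+1%:R)))
  (B := K * (cm s + k%:R) * (cm (1 - s) + k%:R) * (1 + (re s / 2)^-1))).
  by move=> n; exact: H.
move=> N; rewrite -mulr_sumr ler_wpM2l ?sum_powers ?divr_gt0//.
by rewrite !mulr_ge0 ?addr_ge0 ?cm_ge0.
Qed.

Lemma cd_zetaZ k s : 0 < re s -> cderiv (zetaZ k) s (zetaZ k.+1 s).
Proof.
move=> s0; rewrite /zetaZ /= -[X in cderiv _ _ X]/(0 + _).
apply: (@cdD _ (fun=> (k == 0)%:R) (fun s => csum (fun n => zterm k n s))); first exact: cdc.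
(* The disc of radius a about s stays in Re w >= a, where the bounds on the terms are uniform. *)
pose a := re s / 2; have a0 : 0 < a by rewrite divr_gt0.
have [K K0 H] := zterm_bound k.+2 a0.
have near w : cm (w - s) <= a -> a <= re w.
  move=> /(le_trans (cm_re _)); rewrite reB ler_norml => /andP[+ _].
  by rewrite /a; lra.
have near2 w : cm (w - s) <= a -> 0 < re w.
  by move=> /near; exact: lt_le_trans.
have P0 : 0 <= cm s + a + 1 + k.+2%:R by rewrite !addr_ge0 ?cm_ge0// ltW.
pose M n : R := K * (cm s + a + 1 + k.+2%:R) ^+ 2 * expR (- ((1 + a / 2) * ln n.+1%:R)).
apply: (@cderiv_series _ (zterm k) (zterm k.+1) (zterm k.+2) s a M
  (K * (cm s + a + 1 + k.+2%:R) ^+ 2 * (1 + (a / 2)^-1)) _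
  (fun s => csum (fun n => zterm k.+1 n s))) => //.
- by move=> n w _; exact: cd_zterm.
- by move=> n w _; exact: cd_zterm.
- move=> n w wa; apply: le_trans (H n w (near w wa)) _.
  have ws : cm w <= cm s + a.
    by have := cmD (w - s) s; rewrite subrK => /le_trans; apply; rewrite addrC lerD2l.
  have ws1 : cm (1 - w) <= cm s + a + 1.
    by apply: le_trans (cmB _ _) _; rewrite cm1 addrC lerD2r.
  rewrite /M ler_wpM2r ?expR_ge0// -mulrA ler_wpM2l// expr2.
  have := cm_ge0 w; have := cm_ge0 (1 - w); have : 0 <= k.+2%:R :> R by [].
  by move=> ? ? ?; apply: ler_pM; lra.
- move=> N; rewrite -mulr_sumr ler_wpM2l ?sum_powers ?divr_gt0//.
  by rewrite mulr_ge0// exprn_ge0.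
- by move=> w /near2; exact: zterm_csums.
- exact: zterm_csums.
Qed.

Lemma zetaZ_bound a s : 0 < a -> a <= re s ->
  cm (zetaZ 0 s) <= 1 + (1 + a^-1) * (cm s * cm (1 - s)).
Proof.
move=> a0 sa; have s0 := lt_le_trans a0 sa.
rewrite /zetaZ /=; apply: le_trans (cmD _ _) _; rewrite cm1 lerD2l.
apply: (csums_bound (zterm_csums 0 s0)); first by move=> n; exact: zterm0_bound.
move=> N; rewrite -mulr_sumr mulrC ler_wpM2r ?mulr_ge0 ?cm_ge0//.
apply: le_trans (sum_powers _ s0) _.
by rewrite lerD2l lef_pV2 ?posrE.
Qed.

Lemma natcpowE n s : natcpow n s = cexp (s * (ln n%:R)%:C).
Proof. by []. Qed.

Lemma cm_natcpow n s : cm (natcpow n s) = expR (re s * ln n%:R).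
Proof. by rewrite cm_cexp reM /= mulr0 subr0. Qed.

Lemma natcpow1 s : natcpow 1 s = 1.
Proof. by rewrite natcpowE ln1 mulr0 cexp0. Qed.

Lemma sum_zterm0 s N : \sum_(0 <= i < N) zterm 0 i s =
  natcpow N.+1 (1 - s) - 1 - (1 - s) * \sum_(0 <= i < N) natcpow i.+1 (- s).
Proof.
elim: N => [|N IH]; first by rewrite !big_geq// natcpow1 subrr mulr0 subr0.
rewrite big_nat_recr//= IH big_nat_recr//= mulrDr.
rewrite /zterm /zG /zG1 !expr0 mul0r subr0 !mul1r mulr1 -!natcpowE; ring.
Qed.

Lemma zeta_series s : 1 < re s ->
  csums (fun i => natcpow i.+1 (- s)) (zetaZ 0 s / (s - 1)).
Proof.
move=> s1; have s0 : 0 < re s by lra.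
have sn1 : s - 1 != 0 by apply: cm_ge_re; rewrite reB re1 gt_eqF// subr_gt0.
have L : climit (fun N => natcpow N.+1 (1 - s)) 0.
  move=> e e0; pose b := re s - 1; have b0 : 0 < b by rewrite subr_gt0.
  (* X is the power e^(-1/b), so that n + 1 >= X gives (n+1)^(-b) <= e. *)
  pose X := expR (- (ln e / b)); have X0 : 0 < X := expR_gt0 _.
  exists (Num.trunc X) => n nX; rewrite subr0 cm_natcpow reB re1.
  have Xn : X <= n.+1%:R.
    by apply: le_trans (ltW (truncnS_gt _)) _; rewrite ler_nat.
  rewrite -[leRHS]lnK ?posrE// ler_expR.
  have : ln X <= ln n.+1%:R by rewrite ler_ln ?posrE.
  rewrite /X expRK => H.
  have : b * - (ln e / b) <= b * ln n.+1%:R by rewrite ler_wpM2l// ltW.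
  by rewrite mulrN mulrC divfK ?gt_eqF// /b; lra.
rewrite /csums; have A := climitD (climit_const (1 : C)) (zterm_csums 0 s0).
have B := climitD A (climit_cM (-1) L).
have := climit_cM (s - 1)^-1 B; rewrite mulr0 addr0 [_ * (1 + _)]mulrC.
apply: climit_ext => N /=; rewrite sum_zterm0; field.
exact: sn1.
Qed.

End ZetaContinuation.

(** * Zeta as a continued L-function, and the use of GRH *)

Section Bridge.
Context {R : realType}.
Local Notation C := R[i].
Implicit Types (f : C -> C) (s z d : C).

Lemma pos_complex (e : C) : 0 < e -> exists2 x : R, 0 < x & e = x%:C.
Proof.
case: e => a b; rewrite ltcE /= => /andP[/eqP -> a0].
by exists a.
Qed.

Lemma cderiv_derivable f z d : cderiv f z d ->
  derivable (f : C^o -> C^o) z 1.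
Proof.
move=> H; apply/cvg_ex; exists (d : C^o).
apply/cvgrPdist_le => _ /pos_complex[e e0 ->].
have [r r0 Hr] := H _ e0.
near=> h.
have h0 : h != 0 by near: h; exact: nbhs_dnbhs_neq.
have hr : cm h < r.
  near: h; apply: nbhs_dnbhs; apply/nbhs_ballP; exists r%:C; first by rewrite /= ltcR.
  by move=> y; rewrite /ball/= sub0r normrN; rewrite ltcR; exact.
have := Hr _ hr.
rewrite [h *: 1]mulr1 /= [h + z]addrC [_ *: _]mulrC => Hh.
have -> : d - (f (z + h) - f z) / h = - ((f (z + h) - f z - h * d) / h).
  by field.
rewrite normrN normc_def -cmE lecR cmM cmV ler_pdivrMr ?cm_gt0//.
Unshelve. all: by end_near. Qed.

Lemma climit_cvg (u : nat -> C) (l : C) : climit u l ->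
  (u : nat -> C^o) @ \oo --> (l : C^o).
Proof.
move=> H; apply/cvgrPdist_le => _ /pos_complex[e e0 ->].
have [N HN] := H _ e0; exists N => // n /= /HN h.
by rewrite normc_def -cmE lecR cmBC.
Qed.

(** At s = 1 the convention for inverses gives 0, which is harmless since [continued_L_function]
    leaves the value at 1 free. *)
Definition zeta s : C := zetaZ 0 s / (s - 1).

Lemma continued_zeta : continued_L_function (fun _ : int => 1 : C) zeta.
Proof.
split=> [s s1|s s0 s1].
  apply: climit_cvg => e e0; have [N HN] := zeta_series s1 e0.
  exists N.+1 => -[//|n] nN.
  rewrite big_add1 /= (eq_bigr (fun i => natcpow i.+1 (- s))); last by move=> i _; rewrite mul1r.
  exact: HN.
have sn1 : s - 1 != 0 by rewrite subr_eq0.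
apply: cderiv_derivable; apply: cdM; first exact: cd_zetaZ.
by apply: cdV => //; apply: cdB; [exact: cdid|exact: cdc].
Qed.

Lemma character1 : dirichlet_character 1 (fun _ : int => 1 : C).
Proof.
split=> // [m n|n]; first by rewrite mulr1.
by rewrite oner_neq0 /coprimez gcdz1.
Qed.

(** GRH for the character modulo 1 that is constantly 1. Only the open strip is covered; Re s = 1 is
    treated in [zetaZ_neq0_line]. *)
Lemma zeta_rh s : generalized_riemann_hypothesis R -> 2^-1 < re s < 1 ->
  zetaZ 0 s != 0.
Proof.
move=> RH /andP[s12 s1]; apply/eqP => Z0.
have zs0 : zeta s = 0 by rewrite /zeta Z0 mul0r.
have h2 : 0 < 2^-1 :> R by rewrite invr_gt0.
have s01 : 0 < re s < 1 by rewrite s1 andbT (lt_trans h2).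
have := RH _ _ _ (ltn0Sn 0) character1 continued_zeta s s01 zs0.
by move=> E; rewrite E ltxx in s12.
Qed.

End Bridge.

(** * Dirichlet convolution and products of Dirichlet series *)

Section DirichletProduct.
Context {R : realType}.
Local Notation C := R[i].
Implicit Types (a b : nat -> C) (A B : nat -> R).

Lemma sum_divisors (V : nmodType) N (F : nat -> nat -> V) :
  \sum_(1 <= n < N.+1) \sum_(d <- divisors n) F (n %/ d)%N d =
  \sum_(1 <= d < N.+1) \sum_(1 <= m < (N %/ d).+1) F m d.
Proof.
have -> : \sum_(1 <= n < N.+1) \sum_(d <- divisors n) F (n %/ d)%N d =
    \sum_(1 <= n < N.+1) \sum_(1 <= d < N.+1 | (d %| n)%N) F (n %/ d)%N d.
  apply: eq_big_nat => n /andP[n0 nN].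
  rewrite -[RHS]big_filter; apply: perm_big.
  apply: uniq_perm; rewrite ?divisors_uniq ?filter_uniq ?iota_uniq// => d.
  rewrite -dvdn_divisors// mem_filter mem_index_iota.
  case: (boolP (d %| n)%N) => //= dn.
  by rewrite ltnS (dvdn_gt0 n0 dn) (leq_trans (dvdn_leq n0 dn)).
rewrite (exchange_big_dep_nat xpredT)//=; apply: eq_big_nat => d /andP[d0 dN].
have -> : \sum_(1 <= n < N.+1 | (d %| n)%N) F (n %/ d)%N d =
    \sum_(n <- [seq (m * d)%N | m <- index_iota 1 (N %/ d).+1]) F (n %/ d)%N d.
  rewrite -[LHS]big_filter; apply: perm_big; apply: uniq_perm.
  - by rewrite filter_uniq// iota_uniq.
  - by rewrite map_inj_uniq ?iota_uniq// => x y /eqP; rewrite eqn_pmul2r// => /eqP.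
  move=> n; rewrite mem_filter mem_index_iota; apply/idP/mapP.
    move=> /andP[dn /andP[n0 nN]]; exists (n %/ d)%N; last by rewrite divnK.
    by rewrite mem_index_iota ltnS leq_div2r// divn_gt0// dvdn_leq.
  move=> [m]; rewrite mem_index_iota => /andP[m0 mN] ->.
  rewrite dvdn_mull// muln_gt0 m0 d0 ltnS /= -leq_divRL//.
by rewrite big_map; apply: eq_big_nat => m _; rewrite mulnK.
Qed.

Lemma sum_divisors_compl (V : nmodType) n (f : nat -> V) : (0 < n)%N ->
  \sum_(d <- divisors n) f (n %/ d)%N = \sum_(d <- divisors n) f d.
Proof.
move=> n0; rewrite -(big_map (fun d => n %/ d)%N xpredT f); apply: perm_big.
have cK d : (d %| n)%N -> (n %/ (n %/ d))%N = d by move=> dn; rewrite divnA// mulKn.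
have I : {in divisors n &, injective (fun d => n %/ d)%N}.
  by move=> d e; rewrite -!dvdn_divisors// => /cK {2}<- /cK {2}<- ->.
apply: uniq_perm; rewrite ?map_inj_in_uniq ?divisors_uniq// => e.
apply/mapP/idP => [[d]|].
  by rewrite -!dvdn_divisors// => dn ->; exact: dvdn_div.
rewrite -dvdn_divisors// => en; exists (n %/ e)%N; last by rewrite cK.
by rewrite -dvdn_divisors// dvdn_div.
Qed.

(** The partial sum up to N of the convolution is the sum of b(d) A(N/d), with A the partial sums of
    a. For d <= D the argument N/d is large and A(N/d) is close to sa; for d > D the tail of b is
    small. *)
Lemma csums_dirichlet a b sa sb (Ba Bb : R) :
  (forall N, \sum_(0 <= i < N) cm (a i.+1) <= Ba) ->
  (forall N, \sum_(0 <= i < N) cm (b i.+1) <= Bb) ->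
  csums (fun i => a i.+1) sa -> csums (fun i => b i.+1) sb ->
  csums (fun i => \sum_(d <- divisors i.+1) a (i.+1 %/ d)%N * b d) (sa * sb).
Proof.
move=> HBa HBb Ha Hb e e0.
have Ba0 : 0 <= Ba by have := HBa 0%N; rewrite big_geq.
have Bb0 : 0 <= Bb by have := HBb 0%N; rewrite big_geq.
have saB : cm sa <= Ba.
  by apply: (climit_bound Ha) => n; apply: le_trans (cm_sum _ _ _) (HBa n).
(* Errors: [Bb * e1] from d <= D, [2 * Ba * e1] from d > D, and [Ba * e1] from the convergence of
   the series of b. *)
pose e1 := e / (3 * Ba + Bb + 1).
have K0 : 0 < 3 * Ba + Bb + 1 by lra.
have e10 : 0 < e1 by rewrite divr_gt0.
have [M0 HM] := Ha _ e10; have [N1 HN1] := Hb _ e10.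
have [D HD] := bounded_tail (fun n => cm_ge0 (b n.+1)) HBb e10.
(* N >= D (M0 + 1) ensures that N/d >= M0 for every d <= D. *)
exists (maxn N1 (D * M0.+1 + D)) => N; rewrite geq_max => /andP[NN1 ND].
have DN : (D <= N)%N by apply: leq_trans ND; rewrite leq_addl.
pose A x := \sum_(0 <= i < x) a i.+1.
have -> : \sum_(0 <= i < N) \sum_(d <- divisors i.+1) a (i.+1 %/ d)%N * b d =
    \sum_(0 <= i < N) b i.+1 * A (N %/ i.+1)%N.
  have := sum_divisors N (fun m d => a m * b d).
  rewrite big_add1 /= => ->; rewrite big_add1 /=.
  apply: eq_bigr => i _; rewrite /A big_add1 /= mulr_sumr.
  by apply: eq_bigr => j _; rewrite mulrC.
have -> : \sum_(0 <= i < N) b i.+1 * A (N %/ i.+1)%N - sa * sb =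
   \sum_(0 <= i < N) b i.+1 * (A (N %/ i.+1)%N - sa) +
   sa * (\sum_(0 <= i < N) b i.+1 - sb).
  rewrite [in LHS](eq_bigr (fun i => b i.+1 * (A (N %/ i.+1)%N - sa) + sa * b i.+1)).
    by rewrite big_split/= -mulr_sumr; ring.
  by move=> i _; ring.
apply: le_trans (cmD _ _) _.
have T2 : cm (sa * (\sum_(0 <= i < N) b i.+1 - sb)) <= Ba * e1.
  by rewrite cmM ler_pM ?cm_ge0// HN1.
have T1 : cm (\sum_(0 <= i < D) b i.+1 * (A (N %/ i.+1)%N - sa)) <= Bb * e1.
  apply: le_trans (cm_sum _ _ _) _.
  apply: (@le_trans _ _ (\sum_(0 <= i < D) cm (b i.+1) * e1)).
    apply: ler_sum_nat => i /andP[_ iD]; rewrite cmM ler_wpM2l ?cm_ge0//.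
    apply: HM; rewrite leq_divRL//.
    apply: leq_trans ND; apply: leq_trans (leq_addr _ _).
    by rewrite mulnC leq_mul.
  by rewrite -mulr_suml ler_wpM2r// ltW.
have T3 : cm (\sum_(D <= i < N) b i.+1 * (A (N %/ i.+1)%N - sa)) <= e1 * (2 * Ba).
  apply: le_trans (cm_sum _ _ _) _.
  apply: (@le_trans _ _ (\sum_(D <= i < N) cm (b i.+1) * (2 * Ba))).
    apply: ler_sum_nat => i _; rewrite cmM ler_wpM2l ?cm_ge0//.
    apply: le_trans (cmB _ _) _.
    have : cm (A (N %/ i.+1)%N) <= Ba by apply: le_trans (cm_sum _ _ _) (HBa _).
    lra.
  by rewrite -mulr_suml ler_wpM2r ?HD// mulr_ge0.
rewrite (big_cat_nat (leq0n D) DN)/=.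
have := cmD (\sum_(0 <= i < D) b i.+1 * (A (N %/ i.+1)%N - sa))
   (\sum_(D <= i < N) b i.+1 * (A (N %/ i.+1)%N - sa)).
have : e = e1 * (3 * Ba + Bb + 1) by rewrite /e1 divfK ?gt_eqF.
lra.
Qed.

End DirichletProduct.

(** * The Moebius function *)

Section Moebius.
Implicit Types (p d m n : nat).

Lemma primes_mul_prime p d : prime p -> (0 < d)%N -> ~~ (p %| d)%N ->
  perm_eq (primes (p * d)) (p :: primes d).
Proof.
move=> pp d0 pd; apply: uniq_perm; rewrite ?primes_uniq//=.
  by rewrite primes_uniq mem_primes pp d0 (negbTE pd).
by move=> r; rewrite primesM ?(prime_gt0 pp)// primes_prime// !inE.
Qed.

Lemma moebius_mul_prime p d : prime p -> (0 < d)%N -> ~~ (p %| d)%N ->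
  moebius (p * d) = - moebius d.
Proof.
move=> pp d0 pd; have P := primes_mul_prime pp d0 pd.
rewrite /moebius muln_gt0 prime_gt0// d0 /= (perm_size P) /= (perm_all _ P) /=.
rewrite lognM ?(prime_gt0 pp)// logn_prime// eqxx.
have -> : logn p d = 0%N by apply/eqP; rewrite -leqn0 leqNgt logn_gt0 mem_primes pp d0.
rewrite /=; have -> : all (fun r => logn r (p * d) == 1%N) (primes d) =
    all (fun r => logn r d == 1%N) (primes d).
  apply: eq_in_all => r; rewrite mem_primes => /and3P[rp _ rd].
  rewrite lognM ?(prime_gt0 pp)// logn_prime//.
  by case: (r =P p) => // E; rewrite -E rd in pd.
by case: all; rewrite ?oppr0// exprS mulN1r.
Qed.

Lemma moebius_sqr p n : prime p -> (0 < n)%N -> (p ^ 2 %| n)%N -> moebius n = 0.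
Proof.
move=> pp n0; rewrite pfactor_dvdn// => pn; rewrite /moebius n0 /=.
case: allP => // /(_ p); rewrite mem_primes pp n0 /=.
have -> : (p %| n)%N by rewrite -(expn1 p) pfactor_dvdn// ltnW.
by move=> /(_ isT)/eqP E; rewrite E in pn.
Qed.

Lemma moebius1 : moebius 1 = 1. Proof. by []. Qed.

(** Fix a prime p dividing n. Divisors divisible by p^2 contribute 0, and multiplication by p
    matches the divisors prime to p with those divisible by p exactly once, with opposite signs. *)
Lemma sum_moebius n : (0 < n)%N ->
  \sum_(d <- divisors n) moebius d = (n == 1%N)%:R.
Proof.
move=> n0; have [->|n1] := eqVneq n 1%N.
  by rewrite (_ : divisors 1 = [:: 1%N])// big_seq1 moebius1.
have {}n1 : (1 < n)%N by rewrite ltn_neqAle eq_sym n1.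
pose p := pdiv n; have pp : prime p by exact: pdiv_prime.
have pn : (p %| n)%N by exact: pdiv_dvd.
rewrite (bigID (fun d => p %| d)%N)/= (bigID (fun d => p ^ 2 %| d)%N)/=.
rewrite big_seq_cond big1 ?add0r; last first.
  move=> d /andP[dn /andP[_ p2d]]; apply: (moebius_sqr pp) p2d.
  by move: dn; rewrite -dvdn_divisors// => /(dvdn_gt0 n0).
suff -> : \sum_(d <- divisors n | (p %| d)%N && ~~ (p ^ 2 %| d)%N) moebius d =
    - \sum_(d <- divisors n | ~~ (p %| d)%N) moebius d by rewrite addNr.
rewrite -sumrN -big_filter.
rewrite (perm_big [seq (p * d)%N | d <- [seq d <- divisors n | ~~ (p %| d)%N]])/=; last first.
  apply: uniq_perm; rewrite ?filter_uniq ?divisors_uniq//.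
    by rewrite map_inj_uniq ?filter_uniq ?divisors_uniq// => x y /eqP;
      rewrite eqn_pmul2l ?(prime_gt0 pp)// => /eqP.
  move=> d; rewrite mem_filter -dvdn_divisors//; apply/idP/mapP.
    move=> /andP[/andP[pd p2d] dn]; exists (d %/ p)%N; last by rewrite mulnC divnK.
    rewrite mem_filter -dvdn_divisors// (dvdn_trans (dvdn_div pd) dn)// andbT.
    apply: contra p2d => ppd; rewrite -(divnK pd) mulnC expnS expn1.
    by rewrite dvdn_pmul2l ?(prime_gt0 pp).
  move=> [x]; rewrite mem_filter -dvdn_divisors// => /andP[px xn] ->.
  rewrite dvdn_mulr// expnS expn1 dvdn_pmul2l ?(prime_gt0 pp)// px /=.
  by rewrite Gauss_dvd ?pn// prime_coprime.
rewrite big_map big_filter big_seq_cond [RHS]big_seq_cond; apply: eq_bigr => d /andP[dn pd].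
by rewrite moebius_mul_prime//; move: dn; rewrite -dvdn_divisors// => /(dvdn_gt0 n0).
Qed.

Lemma moebius_norm n : `|moebius n| <= 1.
Proof. by rewrite /moebius; case: ifP => // _; rewrite normrX normrN1 expr1n. Qed.

End Moebius.

(** * The von Mangoldt function *)

Section VonMangoldt.
Context {R : realType}.
Implicit Types (p d m n : nat).

(** Having exactly one prime divisor characterises the prime powers with positive exponent, and
    [pdiv] then returns the prime. *)
Definition mangoldt n : R :=
  if size (primes n) == 1%N then ln (pdiv n)%:R else 0.

Lemma mangoldt_ge0 n : 0 <= mangoldt n.
Proof. by rewrite /mangoldt; case: ifP => // _; rewrite ln_ge0// ler1n pdiv_gt0. Qed.

Lemma mangoldt_pow p k : prime p -> mangoldt (p ^ k.+1) = ln p%:R.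
Proof.
move=> pp; rewrite /mangoldt primesX// primes_prime//=.
by rewrite pdiv_pfactor.
Qed.

(** Induction from m = n/p to n. The divisors of n that do not divide m carry the full power p^k of
    p in n, and among them only p^k itself is a prime power, which accounts for the additional ln
    p. *)
Lemma sum_mangoldt n : (0 < n)%N ->
  \sum_(d <- divisors n) mangoldt d = ln n%:R.
Proof.
elim/ltn_ind: n => n IH n0.
have [->|n1] := eqVneq n 1%N.
  by rewrite (_ : divisors 1 = [:: 1%N])// big_seq1 ln1.
have {}n1 : (1 < n)%N by rewrite ltn_neqAle eq_sym n1.
pose p := pdiv n; have pp : prime p by exact: pdiv_prime.
have pn : (p %| n)%N by exact: pdiv_dvd.
pose m := (n %/ p)%N; have nE : n = (p * m)%N by rewrite /m mulnC divnK.
have m0 : (0 < m)%N by rewrite divn_gt0 ?(prime_gt0 pp)// dvdn_leq.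
have mn : (m < n)%N by rewrite nE ltn_Pmull// prime_gt1.
rewrite [in RHS]nE natrM lnM ?posrE ?ltr0n ?(prime_gt0 pp)// addrC -(IH m)//.
rewrite (bigID (fun d => d %| m)%N)/=; congr (_ + _).
  rewrite -big_filter; apply: perm_big; apply: uniq_perm; rewrite ?filter_uniq ?divisors_uniq//.
  move=> d; rewrite mem_filter -!dvdn_divisors//.
  by apply/andb_idr => dm; rewrite nE dvdn_mull.
pose k := logn p n; have k0 : (0 < k)%N by rewrite logn_gt0 mem_primes pp n0.
have kk : (p ^ k %| n)%N by rewrite pfactor_dvdn.
have km : ~~ (p ^ k %| m)%N.
  rewrite pfactor_dvdn// -ltnNge /k nE lognM ?(prime_gt0 pp)// (logn_prime _ pp) eqxx add1n//.
rewrite -big_filter (bigD1_seq (p ^ k)%N) ?filter_uniq ?divisors_uniq//=; last first.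
  by rewrite mem_filter km -dvdn_divisors.
rewrite -[in X in X + _](prednK k0) mangoldt_pow// big_seq_cond big1 ?addr0// => d.
rewrite mem_filter -dvdn_divisors// => /andP[/andP[dm dn] dk].
rewrite /mangoldt; case: ifP => // /eqP sd.
have d0 : (0 < d)%N by exact: dvdn_gt0 dn.
pose r := pdiv d.
have d1 : (1 < d)%N.
  by rewrite ltn_neqAle d0 andbT; apply: contraTneq isT => E; rewrite -E in sd.
have rp : prime r by exact: pdiv_prime.
have rd : (r \in primes d) by rewrite mem_primes rp d0 pdiv_dvd.
have dE : d = (r ^ logn r d)%N.
  rewrite {1}(prod_prime_decomp d0) prime_decompE big_map /=.
  by case: (primes d) rd sd => [//|x [|//]]; rewrite inE => /eqP <- _; rewrite big_seq1.
exfalso; move: dm; rewrite dE pfactor_dvdn// -ltnNge => lm.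
have : (logn r d <= logn r n)%N by rewrite dvdn_leq_log.
rewrite nE lognM ?(prime_gt0 pp)// (logn_prime _ pp).
have [rpE|rpE] := eqVneq r p; last by rewrite add0n leqNgt lm.
rewrite rpE add1n => le; move: dk; rewrite {1}dE rpE => /negP[].
have -> : logn p d = (logn p m).+1 by apply/eqP; rewrite eqn_leq le -rpE.
by rewrite /k [in X in _ == X]nE lognM ?(prime_gt0 pp)// (logn_prime _ pp) eqxx add1n.
Qed.

End VonMangoldt.

(** * Zeta to the right of 1: inverse, logarithmic derivative, 3-4-1 *)

Section ZetaNonvanishing.
Context {R : realType}.
Local Notation C := R[i].
Implicit Types (s z w : C) (n m : nat) (x t : R).

Lemma natcpowM s m n : (0 < m)%N -> (0 < n)%N ->
  natcpow (m * n) s = natcpow m s * natcpow n s.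
Proof.
move=> m0 n0; rewrite !natcpowE natrM lnM ?posrE ?ltr0n//.
by rewrite rmorphD/= mulrDr cexpD.
Qed.

Lemma natcpow_sum s N : 1 < re s ->
  \sum_(0 <= i < N) cm (natcpow i.+1 (- s)) <= 1 + (re s - 1)^-1.
Proof.
move=> s1; have a0 : 0 < re s - 1 by rewrite subr_gt0.
apply: le_trans (sum_powers N a0); apply: ler_sum => i _.
by rewrite cm_natcpow reN mulNr [1 + _]addrC subrK.
Qed.

Lemma dirichlet_term (a b : nat -> C) n s : (0 < n)%N ->
  \sum_(d <- divisors n) (a (n %/ d)%N * natcpow (n %/ d) (- s)) * (b d * natcpow d (- s)) =
  (\sum_(d <- divisors n) a (n %/ d)%N * b d) * natcpow n (- s).
Proof.
move=> n0; rewrite mulr_suml big_seq [RHS]big_seq; apply: eq_bigr => d.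
rewrite -dvdn_divisors// => dn; have d0 := dvdn_gt0 n0 dn.
have -> : natcpow n (- s) = natcpow (n %/ d) (- s) * natcpow d (- s).
  have q0 : (0 < n %/ d)%N by rewrite divn_gt0// dvdn_leq.
  by have := natcpowM (- s) q0 d0; rewrite divnK.
exact: mulrACA.
Qed.

Definition moebius_series s : C :=
  csum (fun i => (moebius i.+1)%:~R * natcpow i.+1 (- s)).

Lemma cm_moebius n : cm ((moebius n)%:~R : C) <= 1.
Proof.
have -> : (moebius n)%:~R = ((moebius n)%:~R : R)%:C :> C by rewrite rmorph_int.
rewrite cm_real -intr_norm -[leRHS](mulr1z (1 : R)) ler_int; exact: moebius_norm.
Qed.

Lemma moebius_series_csums s : 1 < re s ->
  csums (fun i => (moebius i.+1)%:~R * natcpow i.+1 (- s)) (moebius_series s).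
Proof.
move=> s1; apply: (bounded_csums (M := fun i => cm (natcpow i.+1 (- s)))
  (B := 1 + (re s - 1)^-1)).
  by move=> i; rewrite cmM ler_piMl ?cm_ge0 ?cm_moebius.
by move=> N; exact: natcpow_sum.
Qed.

Lemma zeta_moebius s : 1 < re s -> zeta s * moebius_series s = 1.
Proof.
move=> s1; rewrite mulrC.
pose a n : C := (moebius n)%:~R * natcpow n (- s).
pose b n : C := 1 * natcpow n (- s).
have bE : (fun i => b i.+1) = (fun i => natcpow i.+1 (- s)).
  by apply/funext => i; rewrite /b mul1r.
have P := @csums_dirichlet R a b (moebius_series s) (zeta s) (1 + (re s - 1)^-1) (1 + (re s - 1)^-1).
have {P} : csums (fun i => \sum_(d <- divisors i.+1) a (i.+1 %/ d)%N * b d) (moebius_series s * zeta s).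
  apply: P.
  - move=> N; apply: le_trans (natcpow_sum N s1); apply: ler_sum => i _.
    by rewrite cmM ler_piMl ?cm_ge0 ?cm_moebius.
  - by move=> N; rewrite (eq_bigr (fun i => cm (natcpow i.+1 (- s)))) ?natcpow_sum// => i _; rewrite /b mul1r.
  - exact: moebius_series_csums.
  - by rewrite bE; exact: zeta_series.
move=> /csums_unique; apply.
move=> e e0; exists 1%N => -[//|n] _.
rewrite big_nat_recl// [X in _ + X - 1]big1 ?addr0.
  rewrite [X in \sum_(d <- X) _](_ : _ = [:: 1%N])// big_seq1 /a /b natcpow1 moebius1.
  by rewrite !mulr1 subrr cm0 ltW.
move=> i _; rewrite /a /b (dirichlet_term (fun n => (moebius n)%:~R) (fun=> 1))//.
rewrite (eq_bigr (fun d => (moebius (i.+2 %/ d)%N)%:~R)); last by move=> d _; rewrite mulr1.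
rewrite (sum_divisors_compl (fun d => (moebius d)%:~R : C))//.
rewrite -(rmorph_sum (intr : int -> C))/=.
by rewrite sum_moebius// mul0r.
Qed.

Lemma zeta_neq0 s : 1 < re s -> zeta s != 0.
Proof.
move=> /zeta_moebius E; apply: contra_eqN E => /eqP ->.
by rewrite mul0r eq_sym oner_neq0.
Qed.

Lemma moebius_series_bound s : 1 < re s ->
  cm (moebius_series s) <= 1 + (re s - 1)^-1.
Proof.
move=> s1; apply: (csums_bound (moebius_series_csums s1)).
  by move=> i; rewrite cmM; apply: ler_piMl; [exact: cm_ge0|exact: cm_moebius].
by move=> N; exact: natcpow_sum.
Qed.

Definition zterm1 i s : C := - (ln i.+1%:R)%:C * natcpow i.+1 (- s).
Definition zeta1 s : C := csum (fun i => zterm1 i s).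

Lemma log_power_bound i (a : R) : 0 < a -> forall k s, 1 + a <= re s ->
  cm ((ln i.+1%:R)%:C ^+ k * natcpow i.+1 (- s)) <=
   (k`!%:R / (a / 2) ^+ k * expR (a / 2)) * expR (- ((1 + a / 2) * ln i.+1%:R)).
Proof.
move=> a0 k s sa; have l0 : 0 <= ln (i.+1%:R : R) by rewrite ln_ge0// ler1n.
have a20 : 0 < a / 2 by rewrite divr_gt0.
rewrite cmM cmX cm_real ger0_norm// cm_natcpow reN.
apply: (@le_trans _ _ ((1 + ln i.+1%:R) ^+ k * expR (- (1 + a) * ln i.+1%:R))).
  apply: ler_pM; rewrite ?exprn_ge0 ?expR_ge0//.
    by apply: lerXn2r; rewrite ?nnegrE ?addr_ge0// lerDr.
  by rewrite ler_expR ler_wpM2r// lerN2.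
apply: le_trans (ler_wpM2r (expR_ge0 _) (poly_exp_bound k a20 l0)) _.
rewrite -[leLHS]mulrA -expRD; have -> // : a / 2 * ln i.+1%:R + - (1 + a) * ln i.+1%:R =
  - ((1 + a / 2) * ln i.+1%:R) :> R by field.
Qed.

Lemma zterm1_sum s : 1 < re s -> exists B : R, forall N,
  \sum_(0 <= i < N) cm (zterm1 i s) <= B.
Proof.
move=> s1; pose a := re s - 1; have a0 : 0 < a by rewrite subr_gt0.
have a20 : 0 < a / 2 by rewrite divr_gt0.
pose K := (1`!%:R / (a / 2) ^+ 1 * expR (a / 2)).
have K0 : 0 <= K by rewrite !mulr_ge0 ?expR_ge0// invr_ge0 exprn_ge0// ltW.
exists (K * (1 + (a / 2)^-1)) => N.
apply: (@le_trans _ _ (K * \sum_(0 <= i < N) expR (- ((1 + a / 2) * ln i.+1%:R)))).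
  rewrite mulr_sumr; apply: ler_sum => i _.
  have := @log_power_bound i a a0 1 s; rewrite expr1 => H; rewrite /zterm1 mulNr cmN.
  by apply: H; rewrite /a; lra.
by rewrite ler_wpM2l// sum_powers.
Qed.

Lemma zeta1_csums s : 1 < re s -> csums (fun i => zterm1 i s) (zeta1 s).
Proof.
move=> /zterm1_sum[B HB]; apply: (bounded_csums (M := fun i => cm (zterm1 i s))) HB.
by move=> n; exact: lexx.
Qed.

Lemma cd_zeta s : 1 < re s -> cderiv zeta s (zeta1 s).
Proof.
move=> s1; pose a := (re s - 1) / 2; have a0 : 0 < a by rewrite divr_gt0// subr_gt0.
pose K := (2`!%:R / (a / 2) ^+ 2 * expR (a / 2)).
have K0 : 0 <= K by rewrite !mulr_ge0 ?expR_ge0// invr_ge0 exprn_ge0// ltW// divr_gt0.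
have near w : cm (w - s) <= a -> 1 + a <= re w.
  move=> /(le_trans (cm_re _)); rewrite reB ler_norml => /andP[+ _].
  by rewrite /a; lra.
have dpow n w : cderiv (fun w => natcpow n (- w)) w (- (ln n%:R)%:C * natcpow n (- w)).
  apply: cd_eq; first (apply: cdexp; apply: cdM; last exact: cdc).
    by apply: cdN; exact: cdid.
  by rewrite -natcpowE; ring.
apply: (@cderiv_series _ (fun i w => natcpow i.+1 (- w)) zterm1
  (fun i w => (ln i.+1%:R)%:C ^+ 2 * natcpow i.+1 (- w)) s a
  (fun i => K * expR (- ((1 + a / 2) * ln i.+1%:R))) (K * (1 + (a / 2)^-1))) => //.
- by move=> n w _; rewrite /zterm1; apply: cd_eq (cdZ _ (dpow n.+1 w)) _; ring.
- by move=> n w /near wa; exact: (@log_power_bound n a a0 2 w wa).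
- by move=> N; rewrite -mulr_sumr; apply: ler_wpM2l K0 _ _ _; apply: sum_powers; rewrite divr_gt0.
- by move=> w /near wa; apply: zeta_series; lra.
- exact: zeta1_csums.
Qed.

Definition mangoldt_series s : C :=
  csum (fun i => (mangoldt i.+1)%:C * natcpow i.+1 (- s)).

Lemma mangoldt_le n : (0 < n)%N -> mangoldt n <= ln n%:R :> R.
Proof.
move=> n0; rewrite -sum_mangoldt// (bigD1_seq n) ?divisors_uniq//=; last by rewrite -dvdn_divisors.
by rewrite lerDl sumr_ge0// => d _; exact: mangoldt_ge0.
Qed.

Lemma mangoldt_sum s : 1 < re s -> exists B : R, forall N,
  \sum_(0 <= i < N) cm ((mangoldt i.+1)%:C * natcpow i.+1 (- s)) <= B.
Proof.
move=> /zterm1_sum[B HB]; exists B => N; apply: le_trans (HB N); apply: ler_sum => i _.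
rewrite /zterm1 mulNr cmN (cmM (mangoldt _)%:C) (cmM (ln _)%:C) ler_wpM2r ?cm_ge0// !cm_real.
have l0 : 0 <= ln (i.+1%:R : R) by rewrite ln_ge0// ler1n.
rewrite (ger0_norm l0) ger0_norm ?mangoldt_ge0//.
exact: mangoldt_le.
Qed.

Lemma mangoldt_csums s : 1 < re s ->
  csums (fun i => (mangoldt i.+1)%:C * natcpow i.+1 (- s)) (mangoldt_series s).
Proof.
move=> /mangoldt_sum[B HB].
by apply: (bounded_csums (M := fun i => cm ((mangoldt i.+1)%:C * natcpow i.+1 (- s)))) HB.
Qed.

Lemma zeta1_mangoldt s : 1 < re s -> zeta1 s = - (zeta s * mangoldt_series s).
Proof.
move=> s1; have [B HB] := mangoldt_sum s1.
have P := @csums_dirichlet R (fun n => 1 * natcpow n (- s))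
  (fun n => (mangoldt n)%:C * natcpow n (- s)) (zeta s) (mangoldt_series s)
  (1 + (re s - 1)^-1) B.
apply: (csums_unique (zeta1_csums s1)); rewrite -mulN1r.
have {P} := csums_cM (-1) (P _ HB _ (mangoldt_csums s1)).
have -> : (fun i => 1 * natcpow i.+1 (- s)) = (fun i => natcpow i.+1 (- s)).
  by apply/funext => i; rewrite mul1r.
move=> P; have {P} := P _ (zeta_series s1); rewrite -/(zeta s).
have H N : \sum_(0 <= i < N) cm (1 * natcpow i.+1 (- s)) <= 1 + (re s - 1)^-1.
  by rewrite (eq_bigr (fun i => cm (natcpow i.+1 (- s)))) ?natcpow_sum// => i _; rewrite mul1r.
move=> /(_ H); congr (csums _ _); apply/funext => i.
rewrite (dirichlet_term (fun=> 1) (fun n => (mangoldt n)%:C))// /zterm1.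
rewrite (eq_bigr (fun d => (mangoldt d)%:C)); last by move=> d _; rewrite mul1r.
by rewrite -rmorph_sum/= sum_mangoldt// mulN1r mulNr.
Qed.

Lemma re_mangoldt s (n : nat) : (0 < n)%N ->
  re ((mangoldt n)%:C * natcpow n (- s)) =
  mangoldt n * (expR (- (re s * ln n%:R)) * cos (im s * ln n%:R)).
Proof.
move=> n0; rewrite (reZ (mangoldt n)) re_cexp; congr (_ * (expR _ * _)).
  by rewrite reM /= mulr0 subr0 reN mulNr.
by rewrite imM /= mulr0 add0r imN mulNr cosN.
Qed.

(** Termwise 3 + 4 cos a + cos 2a = 2 (1 + cos a)^2 with a = t ln n, against the nonnegative weights
    Lambda(n) n^(-x). *)
Lemma mangoldt_341 x t : 1 < x ->
  0 <= re (3%:R * mangoldt_series x%:C + 4%:R * mangoldt_series (x +i* t)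
       + mangoldt_series (x +i* (2 * t))).
Proof.
move=> x1.
have h0 := @mangoldt_csums (x%:C) x1.
have h1 := @mangoldt_csums (x +i* t) x1.
have h2 := @mangoldt_csums (x +i* (2 * t)) x1.
have {h0 h1 h2} := csumsD (csumsD (csums_cM 3%:R h0) (csums_cM 4%:R h1)) h2.
set S := (X in csums _ X) => H.
rewrite leNgt; apply/negP => S0.
have e0 : 0 < - re S / 2 by rewrite divr_gt0// oppr_gt0.
have [N /(_ N (leqnn _)) HN] := H _ e0.
have : - re S <= cm (\sum_(0 <= i < N) (3%:R * ((mangoldt i.+1)%:C * natcpow i.+1 (- x%:C)) +
   4%:R * ((mangoldt i.+1)%:C * natcpow i.+1 (- (x +i* t))) +
   (mangoldt i.+1)%:C * natcpow i.+1 (- (x +i* (2 * t)))) - S); last by lra.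
apply: le_trans (re_cm _); rewrite reB lerDr re_sum; apply: sumr_ge0 => i _.
rewrite !reD -!(rmorph_nat (real_complex R)) (reZ 3) (reZ 4) !re_mangoldt//=.
set L := ln _; set E := expR _; rewrite mul0r cos0.
have -> : cos (2 * t * L) = 2 * cos (t * L) ^+ 2 - 1.
  have -> : 2 * t * L = t * L + t * L by ring.
  rewrite cosD -!expr2; have := cos2Dsin2 (t * L); lra.
have -> : 3 * (mangoldt i.+1 * (E * 1)) + 4 * (mangoldt i.+1 * (E * cos (t * L))) +
   mangoldt i.+1 * (E * (2 * cos (t * L) ^+ 2 - 1)) =
   mangoldt i.+1 * (E * (2 * (1 + cos (t * L)) ^+ 2)) by ring.
by rewrite mulr_ge0 ?mangoldt_ge0// mulr_ge0 ?expR_ge0// mulr_ge0// sqr_ge0.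
Qed.

(** Logarithms enter only through ln |f|, so no branch of the complex logarithm is chosen. The proof
    differentiates half the logarithm of |f|^2, which avoids the square root. *)
Lemma rd_ln_cm (f : C -> C) z w d t : cderiv f (z + t%:C * w) d ->
  f (z + t%:C * w) != 0 ->
  is_derive t 1 (fun y : R => ln (cm (f (z + y%:C * w)))) (re (w * d / f (z + t%:C * w))).
Proof.
move=> fd f0; have [d1 d2] := cd_rd fd.
have c0 : 0 < cm (f (z + t%:C * w)) by rewrite cm_gt0.
pose q y := re (f (z + y%:C * w)) * re (f (z + y%:C * w)) +
  im (f (z + y%:C * w)) * im (f (z + y%:C * w)).
have qE y : q y = cm (f (z + y%:C * w)) ^+ 2 by rewrite cm_sqr.
have q0 : 0 < q t by rewrite qE exprn_gt0.
have dq : is_derive t 1 q (2 * (re (f (z + t%:C * w)) * re (w * d) +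
    im (f (z + t%:C * w)) * im (w * d))).
  by eapply rd_eq; [rewrite /q; rder|cbv beta; ring].
apply: (@rd_ext _ (fun y => 2^-1 * ln (q y))).
  move=> y; have [y0|y0] := eqVneq (f (z + y%:C * w)) 0.
    by rewrite qE y0 cm0 expr0n/= ln0 ?mulr0.
  rewrite qE lnXn ?cm_gt0//. have E (x : R) : 2^-1 * (x *+ 2) = x by rewrite -[x *+ 2]mulr_natl mulKf.
  exact: E.
eapply rd_eq; first by eapply rdM; [exact: rdc|eapply rdln; [exact: q0|exact: dq]].
cbv beta; rewrite qE.
have -> : w * d / f (z + t%:C * w) = ((cm (f (z + t%:C * w)) ^+ 2)^-1)%:C * (w * d * (f (z + t%:C * w))^*).
  rewrite invc_norm normc_def -cmE -!exprVn rmorphXn/= rmorphV ?unitfE ?gt_eqF//=.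
  by rewrite exprVn; ring.
rewrite (reZ _ (w * d * _)).
move: q0; rewrite qE cm_sqr; case: (f _) (w * d) => [a b] [u v] /= q0; field.
by rewrite gt_eqF.
Qed.

End ZetaNonvanishing.

(** * No zeros on the line Re s = 1 *)

Section ZetaZeroFree.
Context {R : realType}.
Local Notation C := R[i].
Implicit Types (s z w : C) (n m : nat) (x t : R).

(** The logarithm of |zeta(x)^3 zeta(x+it)^4 zeta(x+2it)|, with the arguments in the shape to which
    [rd_ln_cm] applies. *)
Let phi t x : R := 3 * ln (cm (zeta (0 +i* 0 + x%:C * 1))) +
  4 * ln (cm (zeta (0 +i* t + x%:C * 1))) + ln (cm (zeta (0 +i* (2 * t) + x%:C * 1))).

Let xit t x : 0 +i* t + x%:C * 1 = x +i* t.
Proof. by apply: complex_ext; rewrite /= ?mulr1 ?mulr0 ?mul0r ?subr0 ?addr0 ?add0r. Qed.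

(** The derivative in x is minus the real part that [mangoldt_341] shows to be nonnegative.
    Monotonicity takes the place of the usual lower bound from the logarithm of the Euler
    product. *)
Lemma phi_decr t x y : 1 < x -> x <= y -> phi t y <= phi t x.
Proof.
move=> x1 xy; rewrite -lerN2.
have d (t' u : R) : 1 < u -> is_derive u 1
    (fun y : R => ln (cm (zeta (0 +i* t' + y%:C * 1)))) (- re (mangoldt_series (u +i* t'))).
  move=> u1; have u1' : 1 < re (0 +i* t' + u%:C * 1) by rewrite xit.
  apply: rd_eq (rd_ln_cm (cd_zeta u1') (zeta_neq0 u1')) _.
  rewrite zeta1_mangoldt// mul1r mulNr mulrC mulKf ?zeta_neq0// reN xit//.
pose D (u : R) := 3 * re (mangoldt_series (u +i* 0)) + 4 * re (mangoldt_series (u +i* t)) +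
   re (mangoldt_series (u +i* (2 * t))).
apply: (@mvt_nondecr R (fun y => - phi t y) D) => // u /andP[xu _].
  have u1 := lt_le_trans x1 xu.
  have d0 := d 0 u u1; have d1 := d t u u1; have d2 := d (2 * t) u u1.
  by eapply rd_eq; [rewrite /phi; rder|cbv beta; rewrite /D; ring].
have := mangoldt_341 t (lt_le_trans x1 xu).
by rewrite !reD -!(rmorph_nat (real_complex R)) (reZ 3) (reZ 4).
Qed.

(** If 1 + it were a zero, then at abscissa 1 + d the triple pole contributes -3 ln d and the
    fourfold zero 4 ln d, so [phi t (1 + d)] is at most c + ln d. This tends to -oo as d tends to 0,
    against phi t (1 + d) >= phi t 3. *)
Lemma zetaZ_neq0_line t : t != 0 -> zetaZ 0 (1 +i* t) != 0.
Proof.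
move=> t0; apply/eqP => Z0.
have s10 : 0 < re (1 +i* t : C) by rewrite /= ltr01.
have [r r0 H] := cd_lip (cd_zetaZ 0 s10).
set K := 1 + cm _ in H; have K0 : 0 < K by rewrite ltr_pwDl ?cm_ge0.
have nt : 0 < `|t| by rewrite normr_gt0.
pose B : R := 1 + 2 * ((2 + 2 * `|t|) * (1 + 2 * `|t|)).
have B0 : 0 < B by rewrite ltr_pwDl// mulr_ge0// mulr_ge0// addr_ge0// mulr_ge0.
pose c := 3 * ln 5 + 4 * ln (K / `|t|) + ln (B / (2 * `|t|)).
(* [r / 2] keeps the Lipschitz bound at the supposed zero, 1 keeps 1 + d below 3 and gives the
   constant 5, and the last entry forces c + ln d < phi t 3. *)
pose d := Num.min (Num.min (r / 2) 1) (expR (phi t 3 - c - 1)).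
have d0 : 0 < d by rewrite !lt_min ltr01 divr_gt0// expR_gt0.
have dr : d < r.
  by apply: (@le_lt_trans _ _ (r / 2)); [rewrite !ge_min lexx|rewrite ltr_pdivrMr// ltr_pMr// ltr1n].
have d1 : d <= 1 by rewrite !ge_min lexx orbT.
have de : ln d <= phi t 3 - c - 1.
  by rewrite -[leRHS]expRK ler_ln ?posrE ?expR_gt0// !ge_min lexx orbT.
have x1 : 1 < 1 + d by rewrite ltrDl.
have x3 : 1 + d <= 3 by lra.
have := phi_decr t x1 x3; rewrite {2}/phi !xit.
have Zb s : re s = 1 + d -> `|im s| <= 2 * `|t| -> cm (zetaZ 0 s) <= B.
  move=> rs ims; apply: le_trans (@zetaZ_bound R 1 s ltr01 _) _; first by rewrite rs ltW.
  rewrite /B lerD2l invr1; apply: ler_pM; rewrite ?mulr_ge0 ?cm_ge0//.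
  have c1 : cm s <= 2 + 2 * `|t|.
    apply: le_trans (cm_reim _) _; rewrite rs ger0_norm; lra.
  have c2 : cm (1 - s) <= 1 + 2 * `|t|.
    apply: le_trans (cm_reim _) _; rewrite reB imB re1 im1 rs sub0r normrN.
    have -> : 1 - (1 + d) = - d by ring.
    by rewrite normrN ger0_norm; lra.
  by apply: ler_pM; rewrite ?cm_ge0.
have zE s : cm (zeta s) = cm (zetaZ 0 s) / cm (s - 1) by rewrite /zeta cmM cmV.
have A0 : ln (cm (zeta ((1 + d) +i* 0))) <= ln (5 / d).
  rewrite ler_ln ?posrE ?cm_gt0 ?zeta_neq0 ?divr_gt0// zE.
  have -> : ((1 + d) +i* 0 : C) - 1 = d%:C by apply: complex_ext; rewrite /=; ring.
  rewrite cm_real ger0_norm ?(ltW d0)// ler_wpM2r ?invr_ge0 ?(ltW d0)//.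
  apply: le_trans (@zetaZ_bound R 1 _ ltr01 _) _; first by rewrite /= ltW.
  rewrite invr1 [cm (1 - _)](_ : _ = d); last first.
    have -> : 1 - ((1 + d) +i* 0 : C) = - d%:C by apply: complex_ext; rewrite /=; ring.
    by rewrite cmN cm_real ger0_norm ?(ltW d0).
  rewrite [cm _](_ : _ = 1 + d); last by rewrite (cm_real (1 + d)) ger0_norm//; lra.
  have : (1 + d) * d <= 2 * 1 by apply: ler_pM; lra.
  lra.
have A1 : ln (cm (zeta ((1 + d) +i* t))) <= ln (K / `|t| * d).
  rewrite ler_ln ?posrE ?cm_gt0 ?zeta_neq0 ?mulr_gt0 ?invr_gt0// zE.
  have st : `|t| <= cm (((1 + d) +i* t : C) - 1).
    by apply: le_trans (cm_im _); rewrite imB im1 subr0.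
  have := H d%:C; rewrite cm_real (ger0_norm (ltW d0)) Z0 subr0 => /(_ dr).
  have -> : (1 +i* t : C) + d%:C = (1 + d) +i* t by apply: complex_ext; rewrite /= ?addr0.
  move=> HZ; rewrite mulrAC; apply: ler_pM; rewrite ?invr_ge0 ?cm_ge0//.
  by rewrite lef_pV2 ?posrE// (lt_le_trans nt).
have A2 : ln (cm (zeta ((1 + d) +i* (2 * t)))) <= ln (B / (2 * `|t|)).
  rewrite ler_ln ?posrE ?cm_gt0 ?zeta_neq0 ?divr_gt0 ?mulr_gt0// zE.
  have st : 2 * `|t| <= cm (((1 + d) +i* (2 * t) : C) - 1).
    by apply: le_trans (cm_im _); rewrite imB im1 subr0 /= normrM ger0_norm.
  apply: ler_pM; rewrite ?invr_ge0 ?cm_ge0//.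
    by apply: Zb; rewrite //= normrM ger0_norm.
  by rewrite lef_pV2 ?posrE ?mulr_gt0// (lt_le_trans _ st)// mulr_gt0.
rewrite ln_div ?posrE// in A0; rewrite lnM ?posrE ?divr_gt0// in A1.
move: de; rewrite /c; lra.
Qed.

Lemma zetaZ_1 : zetaZ 0 (1 : C) = 1.
Proof.
rewrite /zetaZ (@csumE _ _ 0) ?addr0// => e e0; exists 0%N => N _.
rewrite big1 ?subrr ?cm0 ?ltW// => i _.
by rewrite /zterm /zG /zG1 !expr0 subrr !mul0r cexp0 !subrr mul0r subr0.
Qed.

(** GRH inside the strip, the 3-4-1 argument on Re s = 1, the Moebius series to the right of it; at
    s = 1 the factor s - 1 has turned the pole into the value 1. *)
Lemma zetaZ_neq0 s : generalized_riemann_hypothesis R -> 2^-1 < re s ->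
  zetaZ 0 s != 0.
Proof.
move=> RH s2; have [s1|s1|s1] := ltgtP (re s) 1.
- by apply: zeta_rh => //; rewrite s2.
- have := zeta_neq0 s1; apply: contraNneq => Z0.
  by rewrite /zeta Z0 mul0r.
- case: s s1 {s2} => a t /= ->; have [->|t0] := eqVneq t 0.
    by rewrite zetaZ_1 oner_neq0.
  exact: zetaZ_neq0_line.
Qed.

End ZetaZeroFree.

(** * Growth of 1/zeta to the right of the critical line *)

Section PlaneExtrema.
Context {R : realType}.
Local Notation C := R[i].
Implicit Types (f : C -> C) (g u : C -> R) (z w c h : C).

Definition toC (p : R * R) : C := p.1 +i* p.2.
(** Continuity is read on [R * R], where closed boxes are products of compact segments and a
    continuous function on a closed annulus attains its maximum. *)
Definition ccont g z := {for (re z, im z), continuous (g \o toC)}.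

Lemma ccontP g z :
  (forall e : R, 0 < e -> exists2 r : R, 0 < r & forall h : C, cm h < r ->
     `|g (z + h) - g z| < e) -> ccont g z.
Proof.
move=> H; apply/cvgrPdist_lt => e e0; have [r r0 Hr] := H _ e0.
have r20 : 0 < r / 2 by rewrite divr_gt0.
near=> p => /=.
have -> : g (toC (re z, im z)) = g z by case: (z).
have -> : toC p = z + (toC p - z) by ring.
rewrite distrC; apply: Hr.
suff [h1 h2] : `|re z - p.1| < r / 2 /\ `|im z - p.2| < r / 2.
  apply: le_lt_trans (cm_reim _) _; rewrite reB imB /= distrC [`|p.2 - _|]distrC.
  by rewrite [ltRHS](splitr r) ltrD.
near: p; exists (ball (re z) (r / 2), ball (im z) (r / 2)).
  by split; exact: nbhsx_ballx.
by move=> [x y] [/= hx hy]; split.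
Unshelve. all: by end_near. Qed.

Lemma ccont_cm f z d : cderiv f z d -> ccont (fun w => cm (f w)) z.
Proof.
move=> fd; apply: ccontP => e /(cd_cont fd)[r r0 H]; exists r => // h /H.
exact: le_lt_trans (cm_dist _ _).
Qed.

Lemma ccont_c (x : R) z : ccont (fun=> x) z. Proof. exact: cst_continuous. Qed.
Lemma ccontM g u z : ccont g z -> ccont u z -> ccont (fun w => g w * u w) z.
Proof. by move=> gz uz; exact: continuousM. Qed.
Lemma ccontD g u z : ccont g z -> ccont u z -> ccont (fun w => g w + u w) z.
Proof. by move=> gz uz; exact: continuousD. Qed.
Lemma ccontB g u z : ccont g z -> ccont u z -> ccont (fun w => g w - u w) z.
Proof. by move=> gz uz; exact: continuousB. Qed.
Lemma ccont_comp g (k : R -> R) z : ccont g z -> {for g z, continuous k} ->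
  ccont (fun w => k (g w)) z.
Proof.
move=> gz kz; apply: (continuous_comp gz).
by have -> : (g \o toC) (re z, im z) = g z by case: (z).
Qed.

Lemma annulus_max g c (r1 r2 : R) : 0 <= r1 <= r2 ->
  (forall z, r1 <= cm (z - c) <= r2 -> ccont g z) ->
  exists2 z, r1 <= cm (z - c) <= r2 &
    forall w, r1 <= cm (w - c) <= r2 -> g w <= g z.
Proof.
move=> /andP[r10 r12] gc.
pose d (p : R * R) : R := cm (toC p - c).
pose K : set (R * R) := d @^-1` [set x | r1 <= x] `&` d @^-1` [set x | x <= r2].
have dcont : continuous d.
  move=> p; have : ccont (fun z => cm (z - c)) (toC p).
    by apply: (@ccont_cm _ _ (1 - 0)); apply: cdB; [exact: cdid|exact: cdc].
  by rewrite /ccont /toC; case: p.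
have Kc : compact K.
  apply: (@subclosed_compact _ _ (`[re c - r2, re c + r2] `*` `[im c - r2, im c + r2])).
  - apply: closedI; apply: preimage_closed => [p _|]; [exact: dcont|exact: closed_ge|exact: dcont|exact: closed_le].
  - by apply: compact_setX; exact: segment_compact.
  - move=> [x y] [_ /= le]; rewrite /d in le.
    have := le_trans (cm_re _) le; have := le_trans (cm_im _) le.
    rewrite reB imB /= !ler_norml => /andP[? ?] /andP[? ?].
    by split; rewrite /= in_itv /=; apply/andP; split; lra.
have K0 : K !=set0.
  exists (re c + r2, im c); rewrite /K /= /d.
  have -> : toC (re c + r2, im c) - c = r2%:C.
    by case: (c) => x y; apply: complex_ext; rewrite /=; ring.
  by rewrite cm_real ger0_norm ?(le_trans r10)//; split => /=.
have gcont : {within K, continuous (g \o toC)}.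
  apply: continuous_in_subspaceT => -[x y]; rewrite inE => -[/= k1 k2].
  by have := gc (x +i* y); apply; apply/andP.
have [p pK pmax] := compact_EVT_max K0 Kc gcont.
exists (toC p); first by move: pK; rewrite inE => -[/= ? ?]; apply/andP.
move=> w /andP[w1 w2]; have := pmax (re w, im w); rewrite inE /=.
have -> : toC (re w, im w) = w by case: (w).
by apply; rewrite /K /= /d (_ : toC (re w, im w) = w)//; case: (w).
Qed.

(** The first derivative vanishes at 0; were d2 positive, it would be positive just to the right of
    0 and f would exceed its maximum there. *)
Lemma second_derivative_max (f f1 : R -> R) (r d2 : R) : 0 < r ->
  (forall t : R, `|t| < r -> is_derive t 1 f (f1 t)) -> is_derive (0 : R) 1 f1 d2 ->
  (forall t : R, `|t| < r -> f t <= f 0) -> d2 <= 0.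
Proof.
move=> r0 fd f1d fmax.
have itvE (t : R) : (t \in `](- r), r[) = (`|t| < r) by rewrite in_itv/= ltr_norml.
have i0 : `|0 : R| < r by rewrite normr0.
have f10 : f1 0 = 0.
  have H : is_derive (0 : R) 1 f 0.
    apply: (@derive1_at_max _ f (- r) r 0); rewrite ?itvE//; first by lra.
      by move=> t; rewrite itvE => /fd[].
    by move=> t; rewrite itvE => /fmax.
  by have [_ <-] := fd _ i0; have [_] := H.
rewrite leNgt; apply/negP => d20.
have d22 : 0 < d2 / 2 by rewrite divr_gt0.
have [r' r'0 H] := is_derive1_ex f1d d22.
pose h := Num.min r r' / 2.
have m0 : 0 < Num.min r r' by rewrite lt_min r0.
have h0 : 0 < h by rewrite divr_gt0.
have hm : h < Num.min r r' by rewrite /h ltr_pdivrMr// ltr_pMr// ltr1n.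
have fpos t : 0 < t -> t <= h -> 0 < f1 t.
  move=> t0 th; have tm := le_lt_trans th hm.
  have := H t; rewrite add0r f10 subr0 (gtr0_norm t0).
  move=> /(_ (lt_le_trans tm _)); rewrite ge_min lexx orbT => /(_ isT).
  rewrite ler_norml => /andP[+ _].
  have : 0 < d2 / 2 * t by rewrite mulr_gt0.
  have -> : t * d2 = d2 / 2 * t + d2 / 2 * t by field.
  lra.
have hin t : 0 <= t -> t <= h -> `|t| < r.
  move=> t0 th; rewrite ger0_norm// (le_lt_trans th)// (lt_le_trans hm)//.
  by rewrite ge_min lexx.
have [||x] := @MVT R f f1 0 h h0.
- move=> x; rewrite in_itv/= => /andP[x0 xh]; apply: fd.
  by apply: hin; rewrite ltW.
- apply: continuous_in_subspaceT => x; rewrite inE/= in_itv/= => /andP[x0 xh].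
  by apply: rd_cont (fd _ _); exact: hin.
rewrite in_itv/= => /andP[x0 xh]; rewrite subr0 => E.
have := fmax h (hin h (ltW h0) (lexx _)).
rewrite -subr_le0 E leNgt => /negP; apply.
by rewrite mulr_gt0// fpos// ltW.
Qed.

(* [lap g z p q L]: g has gradient (p, q) and Laplacian L at z. *)
Definition lap g z (p q L : R) : Prop := exists (r a b : R) (gx gy : R -> R),
  [/\ 0 < r,
   forall t : R, `|t| < r -> is_derive t 1 (fun y : R => g (z + y%:C * 1)) (gx t),
   forall t : R, `|t| < r -> is_derive t 1 (fun y : R => g (z + y%:C * 'i%C)) (gy t) &
   [/\ is_derive (0 : R) 1 gx a, is_derive (0 : R) 1 gy b, gx 0 = p, gy 0 = q & a + b = L]].

Lemma lap_max g z p q L (r : R) : 0 < r -> lap g z p q L ->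
  (forall h, cm h < r -> g (z + h) <= g z) -> L <= 0.
Proof.
move=> r0 [r' [a [b [gx [gy [r'0 dx dy [da db _ _ <-]]]]]]] gmax.
have m0 : 0 < Num.min r r' by rewrite lt_min r0.
have E0 w : g (z + (0 : R)%:C * w) = g z by rewrite mul0r addr0.
have a0 : a <= 0.
  apply: (second_derivative_max m0 _ da) => t; rewrite lt_min => /andP[tr tr'].
    exact: dx.
  by cbv beta; rewrite E0; apply: gmax; rewrite mulr1 cm_real.
have b0 : b <= 0.
  apply: (second_derivative_max m0 _ db) => t; rewrite lt_min => /andP[tr tr'].
    exact: dy.
  cbv beta; rewrite E0; apply: gmax; rewrite cmM cm_real cmE /=.
  by rewrite expr0n add0r expr1n sqrtr1 mulr1.
lra.
Qed.

Lemma lap_eq g z p q L p' q' L' : lap g z p q L -> p = p' -> q = q' -> L = L' ->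
  lap g z p' q' L'.
Proof. by move=> H <- <- <-. Qed.

Lemma lapD g u z p q L p' q' L' : lap g z p q L -> lap u z p' q' L' ->
  lap (fun w => g w + u w) z (p + p') (q + q') (L + L').
Proof.
move=> [r [a [b [gx [gy [r0 dx dy [da db <- <- <-]]]]]]].
move=> [r' [a' [b' [ux [uy [r'0 dx' dy' [da' db' <- <- <-]]]]]]].
exists (Num.min r r'), (a + a'), (b + b'), (fun t => gx t + ux t), (fun t => gy t + uy t).
split; first by rewrite lt_min r0.
- by move=> t; rewrite lt_min => /andP[tr tr']; apply: rdD; [exact: dx|exact: dx'].
- by move=> t; rewrite lt_min => /andP[tr tr']; apply: rdD; [exact: dy|exact: dy'].
- split=> //; [exact: rdD|exact: rdD|ring].
Qed.

Lemma lapZ g z p q L (x : R) : lap g z p q L ->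
  lap (fun w => x * g w) z (x * p) (x * q) (x * L).
Proof.
move=> [r [a [b [gx [gy [r0 dx dy [da db <- <- <-]]]]]]].
exists r, (x * a), (x * b), (fun t => x * gx t), (fun t => x * gy t); split=> //.
- by move=> t /dx H; apply: (rd_eq (rdM (rdc _ _) H)); ring.
- by move=> t /dy H; apply: (rd_eq (rdM (rdc _ _) H)); ring.
- split=> //; [apply: (rd_eq (rdM (rdc _ _) da)); ring|apply: (rd_eq (rdM (rdc _ _) db)); ring|ring].
Qed.

Lemma lap_c (x : R) z : lap (fun=> x) z 0 0 0.
Proof.
exists 1, 0, 0, (fun=> 0), (fun=> 0); split=> //.
- by move=> t _; exact: rdc.
- by move=> t _; exact: rdc.
- by split=> //; [exact: rdc|exact: rdc|rewrite addr0].
Qed.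

Lemma lap_ext g u z p q L : g =1 u -> lap g z p q L -> lap u z p q L.
Proof. by move=> /funext ->. Qed.

Lemma lap_ln g z p q L : ccont g z -> 0 < g z -> lap g z p q L ->
  lap (fun w => ln (g w)) z (p / g z) (q / g z) (L / g z - (p ^+ 2 + q ^+ 2) / g z ^+ 2).
Proof.
move=> gc g0 [r [a [b [gx [gy [r0 dx dy [da db <- <- <-]]]]]]].
have i0 : `|0 : R| < r by rewrite normr0.
have [r' r'0 gpos] : exists2 r' : R, 0 < r' & forall w : C, (w = 1 \/ w = 'i%C) ->
    forall t : R, `|t| < r' -> 0 < g (z + t%:C * w).
  have [rx rx0 Hx] := is_derive1_ex (dx 0 i0) (@ltr01 R).
  have [ry ry0 Hy] := is_derive1_ex (dy 0 i0) (@ltr01 R).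
  have X0 : 0 < 1 + `|gx 0| by rewrite ltr_pwDl.
  have Y0 : 0 < 1 + `|gy 0| by rewrite ltr_pwDl.
  exists (Num.min (Num.min rx ry) (Num.min (g z / (1 + `|gx 0|)) (g z / (1 + `|gy 0|)))).
    by rewrite !lt_min rx0 ry0 !divr_gt0.
  move=> w wE t; rewrite !lt_min => /andP[/andP[tx ty] /andP[]].
  rewrite !ltr_pdivlMr// => hx hy.
  case: wE => ->.
    have := Hx t tx; rewrite add0r mul1r mul0r addr0.
    have : `|t * gx 0| = `|t| * `|gx 0| by rewrite normrM.
    move: (t * gx 0) => y Ey; rewrite ler_norml => /andP[+ _].
    have : - `|y| <= y by rewrite lerNl ler_normr lexx orbT.
    lra.
  have := Hy t ty; rewrite add0r mul1r mul0r addr0.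
  have : `|t * gy 0| = `|t| * `|gy 0| by rewrite normrM.
  move: (t * gy 0) => y Ey; rewrite ler_norml => /andP[+ _].
  have : - `|y| <= y by rewrite lerNl ler_normr lexx orbT.
  lra.
have E0 w : g (z + (0 : R)%:C * w) = g z by rewrite mul0r addr0.
exists (Num.min r r'), (a / g z - gx 0 ^+ 2 / g z ^+ 2), (b / g z - gy 0 ^+ 2 / g z ^+ 2),
  (fun t : R => (g (z + t%:C * 1))^-1 * gx t), (fun t : R => (g (z + t%:C * 'i%C))^-1 * gy t).
split; first by rewrite lt_min r0.
- move=> t; rewrite lt_min => /andP[/dx tr tr']; apply: (rdln _ tr).
  by apply: gpos => //; left.
- move=> t; rewrite lt_min => /andP[/dy tr tr']; apply: (rdln _ tr).
  by apply: gpos => //; right.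
have gz : g z != 0 by rewrite gt_eqF.
split; rewrite ?E0; [| |by rewrite mulrC|by rewrite mulrC|by field].
  eapply rd_eq; first by apply: rdM da; apply: rdV (dx 0 i0); rewrite E0.
  by cbv beta; rewrite E0; field.
eapply rd_eq; first by apply: rdM db; apply: rdV (dy 0 i0); rewrite E0.
by cbv beta; rewrite E0; field.
Qed.

(** Harmonicity of ln |f|: its derivatives along the axes are the real parts of f'/f and i f'/f,
    whose own derivatives along the same axes are the real parts of (f'/f)' and i^2 (f'/f)', which
    cancel. *)
Lemma lap_lncm f (f1 : C -> C) z d (r : R) : 0 < r ->
  (forall w, cm (w - z) < r -> cderiv f w (f1 w)) -> cderiv f1 z d -> f z != 0 ->
  lap (fun w => ln (cm (f w))) z (re (f1 z / f z)) (- im (f1 z / f z)) 0.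
Proof.
move=> r0 fd f1d fz.
have fdz : cderiv f z (f1 z) by apply: fd; rewrite subrr cm0.
have [r' r'0 fn0] := cd_neq0 fdz fz.
have dq : cderiv (fun w => f1 w / f w) z (d / f z + f1 z * (- f z ^- 2 * f1 z)).
  by apply: cdM => //; exact: cdV.
set dq' := (d / f z + _) in dq.
have at0 w : cderiv (fun w => f1 w / f w) (z + (0 : R)%:C * w) dq'.
  by rewrite mul0r addr0.
have at0i w : cderiv (fun w => 'i%C * (f1 w / f w)) (z + (0 : R)%:C * w) ('i%C * dq').
  by apply: cdZ.
have [q1 _] := cd_rd (at0 1); have [q2 _] := cd_rd (at0i 'i%C).
have i2 (x : C) : 'i%C * ('i%C * x) = - x by rewrite mulrA -expr2 sqr_i mulN1r.
have m0 : 0 < Num.min r r' by rewrite lt_min r0.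
have near (w : C) (t : R) : cm w = 1 -> `|t| < Num.min r r' ->
    is_derive t 1 (fun y : R => ln (cm (f (z + y%:C * w))))
     (re (w * f1 (z + t%:C * w) / f (z + t%:C * w))).
  move=> w1; rewrite lt_min => /andP[tr tr']; apply: rd_ln_cm.
    by apply: fd; rewrite [z + _]addrC addrK cmM cm_real w1 mulr1.
  by apply: fn0; rewrite cmM cm_real w1 mulr1.
exists (Num.min r r'), (re dq'), (- re dq').
exists (fun t : R => re (1 * f1 (z + t%:C * 1) / f (z + t%:C * 1))).
exists (fun t : R => re ('i%C * f1 (z + t%:C * 'i%C) / f (z + t%:C * 'i%C))).
split=> //.
- by move=> t; apply: near; rewrite cm1.
- by move=> t; apply: near; rewrite cmE /= expr0n add0r expr1n sqrtr1.
- split; last by rewrite subrr.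
  + by rewrite mul1r in q1; apply: rd_ext q1 => y; rewrite mul1r.
  + by rewrite i2 reN in q2; apply: rd_ext q2 => y; rewrite mulrA.
  + by rewrite mul0r addr0 mul1r.
  + by rewrite mul0r addr0 -mulrA reM /= mul0r mul1r sub0r.
Qed.

Lemma lap_dist2 c z : lap (fun w => cm (w - c) ^+ 2) z
  (2 * re (z - c)) (2 * im (z - c)) 4.
Proof.
have dd (w : C) (t : R) : is_derive t 1 (fun y : R => cm (z + y%:C * w - c) ^+ 2)
    (2 * (re (z - c) * re w + im (z - c) * im w) + t * (2 * cm w ^+ 2)).
  apply: (@rd_ext _ (fun y => cm (z - c) ^+ 2 +
      y * (2 * (re (z - c) * re w + im (z - c) * im w)) + y * y * cm w ^+ 2)).
    move=> y; have -> : z + y%:C * w - c = (z - c) + y%:C * w by ring.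
    by rewrite !cm_sqr (reD (z - c)) (imD (z - c)) (reZ y) (imZ y); ring.
  by eapply rd_eq; [rder|cbv beta; ring].
exists 1, (2 * cm (1 : C) ^+ 2), (2 * cm ('i%C : C) ^+ 2).
exists (fun t : R => 2 * (re (z - c) * re 1 + im (z - c) * im 1) + t * (2 * cm (1 : C) ^+ 2)).
exists (fun t : R => 2 * (re (z - c) * re 'i%C + im (z - c) * im 'i%C) + t * (2 * cm ('i%C : C) ^+ 2)).
split=> //.
- split.
  + by eapply rd_eq; [rder|cbv beta; ring].
  + by eapply rd_eq; [rder|cbv beta; ring].
  + by rewrite re1 im1; ring.
  + by rewrite /=; ring.
  + by rewrite !cm_sqr /=; ring.
Qed.

End PlaneExtrema.

(** * Ahlfors' bound for the logarithmic derivative *)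

Section LogarithmicDerivative.
Context {R : realType}.
Local Notation C := R[i].
Implicit Types (z w h : C).
Variables (F : nat -> C -> C) (U : C -> Prop).
Hypothesis Uopen : forall z, U z -> exists2 r : R, 0 < r & forall w, cm (w - z) < r -> U w.
Hypothesis FU : forall k z, U z -> cderiv (F k) z (F k.+1 z).
Hypothesis F0 : forall z, U z -> F 0 z != 0.

(** [F k] stands for the k-th derivative of [F 0] on the open set [U]. The whole sequence is a
    datum, so higher regularity never has to be deduced from holomorphy. *)
Definition ldv z := F 1 z / F 0 z.
Definition ldv1 z := F 2 z / F 0 z - ldv z ^+ 2.

Lemma cd_ldv z : U z -> cderiv ldv z (ldv1 z).
Proof.
move=> Uz; apply: cd_eq (cdM (FU 1 Uz) (cdV (F0 Uz) (FU 0 Uz))) _.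
by rewrite /ldv1 /ldv; field; exact: F0.
Qed.

Lemma cd_ldv1 z : U z -> exists d, cderiv ldv1 z d.
Proof.
move=> Uz; eexists; apply: cdB; last by apply: cdX; exact: cd_ldv.
by apply: cdM; [exact: FU|apply: cdV; [exact: F0|exact: FU]].
Qed.

Lemma lap_ldv z : U z -> ldv z != 0 -> exists p q, lap (fun w => ln (cm (ldv w))) z p q 0.
Proof.
move=> Uz v0; have [d dd] := cd_ldv1 Uz; have [r r0 Ur] := Uopen Uz.
exists (re (ldv1 z / ldv z)), (- im (ldv1 z / ldv z)).
by apply: (lap_lncm r0 _ dd v0) => w /Ur; exact: cd_ldv.
Qed.

Lemma lap_lnF z : U z ->
  lap (fun w => ln (cm (F 0 w))) z (re (ldv z)) (- im (ldv z)) 0.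
Proof.
move=> Uz; have [r r0 Ur] := Uopen Uz.
by apply: (lap_lncm r0 _ (FU 1 Uz) (F0 Uz)) => w /Ur; exact: FU.
Qed.

Lemma ccont_lnF z : U z -> ccont (fun w => ln (cm (F 0 w))) z.
Proof.
move=> Uz; apply: (@ccont_comp _ (fun w => cm (F 0 w))).
  exact: ccont_cm (FU 0 Uz).
by apply: continuous_ln; rewrite cm_gt0 F0.
Qed.

Lemma ccont_ldv z : U z -> ccont (fun w => cm (ldv w)) z.
Proof. by move=> Uz; exact: ccont_cm (cd_ldv Uz). Qed.

Lemma ccont_dist c z : ccont (fun w => cm (w - c)) z.
Proof.
by apply: (@ccont_cm _ _ _ (1 - 0)); apply: cdB; [exact: cdid|exact: cdc].
Qed.

(* Ahlfors' method: [ln (|F'/F| / (M - ln |F|))] has Laplacian equal to the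
   square of the argument of the outer logarithm, i.e. curvature -1. *)
Lemma ahlfors c (r M : R) z : 0 < r ->
  (forall w, cm (w - c) <= r -> U w) ->
  (forall w, cm (w - c) <= r -> ln (cm (F 0 w)) < M) -> cm (z - c) <= r ->
  cm (ldv z) * (r ^+ 2 - cm (z - c) ^+ 2) <= 2 * r * (M - ln (cm (F 0 z))).
Proof.
move=> r0 HU HM zr.
pose W w := M - ln (cm (F 0 w)).
pose Q w := r ^+ 2 - cm (w - c) ^+ 2.
have W0 w : cm (w - c) <= r -> 0 < W w by move=> /HM; rewrite subr_gt0.
have Wc w : cm (w - c) <= r -> ccont W w.
  by move=> wr; apply: ccontB; [exact: ccont_c|apply: ccont_lnF; exact: HU].
have Qc w : ccont Q w.
  by apply: ccontB; [exact: ccont_c|apply: ccontM; exact: ccont_dist].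
(* The claim compares |F'/F| / (M - ln |F|) with the hyperbolic density 2r/Q of the disc. As Q
   vanishes on the boundary circle, a positive maximum of G is attained inside. *)
pose G w := cm (ldv w) * Q w * (W w)^-1.
suff GM : G z <= 2 * r.
  have -> : cm (ldv z) * (r ^+ 2 - cm (z - c) ^+ 2) = G z * W z.
    by rewrite /G divfK// gt_eqF// W0.
  by rewrite ler_wpM2r// ltW// W0.
have [] := @annulus_max _ G c 0 r; first by rewrite lexx ltW.
  move=> w /andP[_ wr]; apply: ccontM.
    by apply: ccontM; [apply: ccont_ldv; exact: HU|exact: Qc].
  apply: (@ccont_comp _ W) => //; first exact: Wc.
  by apply: inv_continuous; rewrite gt_eqF// W0.
move=> z0 /andP[_ z0r] Gmax.
have {}Gmax w : cm (w - c) <= r -> G w <= G z0.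
  by move=> wr; apply: Gmax; rewrite cm_ge0.
apply: le_trans (Gmax z zr) _; rewrite leNgt; apply/negP => Gbig.
have G0 : 0 < G z0 by apply: lt_trans Gbig; rewrite mulr_gt0.
have w0 := W0 _ z0r; have wi0 : 0 < (W z0)^-1 by rewrite invr_gt0.
have Q0 : 0 <= Q z0.
  rewrite subr_ge0; apply: lerXn2r; rewrite ?nnegrE ?cm_ge0// ltW//.
have v0 : ldv z0 != 0.
  by apply: contraTneq G0 => E; rewrite /G E cm0 !mul0r ltxx.
have cv0 : 0 < cm (ldv z0) by rewrite cm_gt0.
have {}Q0 : 0 < Q z0.
  by rewrite lt0r Q0 andbT; apply: contraTneq G0 => E; rewrite /G E mulr0 mul0r ltxx.
have zr' : cm (z0 - c) < r.
  rewrite -(@ltr_pXn2r _ 2) ?nnegrE ?cm_ge0//; first by rewrite -subr_gt0.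
  exact: ltW.
have [p [q lv]] := lap_ldv (HU _ z0r) v0.
have lW : lap W z0 (- re (ldv z0)) (im (ldv z0)) 0.
  have := lapD (lap_c M z0) (lapZ (-1) (lap_lnF (HU _ z0r))).
  move=> H; have {}H := lap_ext (u := W) (fun w => congr1 (+%R M) (mulN1r _)) H.
  by apply: lap_eq H _ _ _; rewrite ?mulN1r ?opprK ?add0r ?oppr0.
have lQ : lap Q z0 (- (2 * re (z0 - c))) (- (2 * im (z0 - c))) (- 4).
  have := lapD (lap_c (r ^+ 2) z0) (lapZ (-1) (lap_dist2 c z0)).
  move=> H; have {}H := lap_ext (u := Q) (fun w => congr1 (+%R (r ^+ 2)) (mulN1r _)) H.
  by apply: lap_eq H _ _ _; rewrite ?mulN1r ?add0r.
have lS := lapD lv (lapD (lap_ln (Qc z0) Q0 lQ) (lapZ (-1) (lap_ln (Wc _ z0r) w0 lW))).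
have [r1 r10 v1] := cd_neq0 (cd_ldv (HU _ z0r)) v0.
have rd0 : 0 < r - cm (z0 - c) by rewrite subr_gt0.
have m0 : 0 < Num.min r1 (r - cm (z0 - c)) by rewrite lt_min r10.
have H h : cm h < Num.min r1 (r - cm (z0 - c)) ->
    ln (cm (ldv (z0 + h))) + (ln (Q (z0 + h)) + -1 * ln (W (z0 + h))) <=
    ln (cm (ldv z0)) + (ln (Q z0) + -1 * ln (W z0)).
  rewrite lt_min => /andP[/v1 vh hr].
  have zhr : cm (z0 + h - c) < r.
    have -> : z0 + h - c = (z0 - c) + h by ring.
    by apply: le_lt_trans (cmD _ _) _; lra.
  have Qh : 0 < Q (z0 + h) by rewrite subr_gt0 ltrXn2r ?nnegrE ?cm_ge0// ltW.
  have Wh := W0 _ (ltW zhr).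
  have lnG x : 0 < cm (ldv x) -> 0 < Q x -> 0 < W x ->
      ln (cm (ldv x)) + (ln (Q x) + -1 * ln (W x)) = ln (G x).
    move=> a0 b0 c0; rewrite /G lnM ?posrE ?invr_gt0 ?mulr_gt0// lnM ?posrE//.
    by rewrite lnV ?posrE//; ring.
  rewrite !lnG ?cm_gt0// ler_ln ?posrE ?Gmax ?(ltW zhr)//.
  by rewrite /G !mulr_gt0 ?invr_gt0 ?cm_gt0.
(* At the maximum, ln Q contributes -4 r^2/Q^2 to the Laplacian of ln G and -ln W contributes
   |F'/F|^2/W^2 = G^2/Q^2. The total is positive once G > 2r. *)
have := lap_max m0 lS H; apply/negP; rewrite -ltNge.
rewrite [X in X / W z0 ^+ 2](_ : _ = cm (ldv z0) ^+ 2); last first.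
  by rewrite cm_sqr sqrrN.
have -> : (- (2 * re (z0 - c))) ^+ 2 + (- (2 * im (z0 - c))) ^+ 2 = 4 * cm (z0 - c) ^+ 2.
  by rewrite cm_sqr; ring.
have Qn : Q z0 != 0 by rewrite gt_eqF.
have Wn : W z0 != 0 by rewrite gt_eqF.
have -> : 0 + (-4 / Q z0 - 4 * cm (z0 - c) ^+ 2 / Q z0 ^+ 2 +
    -1 * (0 / W z0 - cm (ldv z0) ^+ 2 / W z0 ^+ 2)) =
    (G z0 ^+ 2 - 4 * (Q z0 + cm (z0 - c) ^+ 2)) / Q z0 ^+ 2.
  by rewrite /G; field; rewrite Qn.
have -> : Q z0 + cm (z0 - c) ^+ 2 = r ^+ 2 by rewrite /Q subrK.
rewrite divr_gt0 ?exprn_gt0// subr_gt0.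
have -> : 4 * r ^+ 2 = (2 * r) ^+ 2 by ring.
by rewrite ltrXn2r ?nnegrE ?(ltW G0)// mulr_ge0// ltW.
Qed.

End LogarithmicDerivative.

(** * Harnack's inequality and the three circles theorem *)

Section HarnackThreeCircles.
Context {R : realType}.
Local Notation C := R[i].
Implicit Types (z w h c : C) (t : R).
Variables (F : nat -> C -> C) (U : C -> Prop).
Hypothesis Uopen : forall z, U z -> exists2 r : R, 0 < r & forall w, cm (w - z) < r -> U w.
Hypothesis FU : forall k z, U z -> cderiv (F k) z (F k.+1 z).
Hypothesis F0 : forall z, U z -> F 0 z != 0.

(** Harnack for the positive harmonic function W = M - ln |F|, by integrating [ahlfors] along the
    radius: at distance y from the centre, ln W has slope at most 2r/(r^2 - y^2), the derivative of
    ln((r+y)/(r-y)). *)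
Lemma harnack c (r M : R) z : 0 < r ->
  (forall w, cm (w - c) <= r -> U w) ->
  (forall w, cm (w - c) <= r -> ln (cm (F 0 w)) < M) -> cm (z - c) < r ->
  M - ln (cm (F 0 z)) <= (M - ln (cm (F 0 c))) * (r + cm (z - c)) / (r - cm (z - c)).
Proof.
move=> r0 HU HM; set h := z - c; set rho := cm h => zr.
have rho0 : 0 <= rho by exact: cm_ge0.
have hc (t : R) : 0 <= t <= 1 -> cm (c + t%:C * h - c) = t * rho.
  by move=> /andP[t0 _]; rewrite [c + _]addrC addrK cmM cm_real ger0_norm.
have tr (t : R) : 0 <= t <= 1 -> 0 <= t * rho < r.
  move=> /andP[t0 t1]; rewrite mulr_ge0//=; apply: le_lt_trans zr.
  by rewrite ler_piMl.
have hin (t : R) : 0 <= t <= 1 -> cm (c + t%:C * h - c) <= r.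
  by move=> t01; rewrite hc//; case/andP: (tr t t01) => _ /ltW.
pose W (t : R) := M + - ln (cm (F 0 (c + t%:C * h))).
have W0 t : 0 <= t <= 1 -> 0 < W t by move=> /hin /HM; rewrite subr_gt0.
pose phi (t : R) := - ln (W t) + ln (r + t * rho) + - ln (r + - (t * rho)).
pose v t := ldv F (c + t%:C * h).
pose D t := - ((W t)^-1 * - re (h * v t)) + (r + t * rho)^-1 * rho
   + - ((r + - (t * rho))^-1 * - rho).
have dphi t : 0 <= t <= 1 -> is_derive t 1 phi (D t).
  move=> t01; have Ut := HU _ (hin t t01); have /andP[t1 t2] := tr t t01.
  have d1 := rd_ln_cm (FU 0 Ut) (F0 Ut).
  have dl : is_derive t 1 (fun y : R => y * rho) rho.
    by apply: (rd_eq (rdM (rdid _) (rdc _ _))); ring.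
  apply: rdD; [apply: rdD|].
  - apply: rdN; apply: rdln; first exact: W0.
    by apply: (rd_eq (rdD (rdc _ _) (rdN d1))); rewrite add0r /v /ldv mulrA.
  - apply: rdln; first by lra.
    by apply: (rd_eq (rdD (rdc _ _) dl)); rewrite add0r.
  - apply: rdN; apply: rdln; first by lra.
    by apply: (rd_eq (rdD (rdc _ _) (rdN dl))); rewrite add0r.
have D0 t : 0 <= t <= 1 -> 0 <= D t.
  move=> t01; have /andP[t1 t2] := tr t t01.
  have wt := W0 t t01.
  have A := ahlfors Uopen FU F0 r0 HU HM (hin t t01).
  rewrite hc// in A.
  have p1 : 0 < r + t * rho by lra.
  have p2 : 0 < r - t * rho by lra.
  have -> : D t = ((re (h * v t)) * (r ^+ 2 - (t * rho) ^+ 2) + 2 * r * rho * W t) /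
      (W t * (r + t * rho) * (r - t * rho)).
    by rewrite /D; field; rewrite !gt_eqF.
  rewrite divr_ge0 ?(ltW (mulr_gt0 (mulr_gt0 wt p1) p2))//.
  have B : - (cm (v t) * rho) <= re (h * v t).
    have := cm_re (h * v t); rewrite cmM [_ * cm _]mulrC ler_norml => /andP[H _].
    exact: H.
  have q0 : 0 <= r ^+ 2 - (t * rho) ^+ 2 by rewrite subr_sqr mulr_ge0// ltW.
  have := ler_wpM2r q0 B; have := ler_wpM2l rho0 A.
  rewrite -/(v t) -/(W t); lra.
have i0 : 0 <= (0 : R) <= 1 by rewrite lexx ler01.
have i1 : 0 <= (1 : R) <= 1 by rewrite lexx ler01.
have := mvt_nondecr ler01 dphi D0; rewrite /phi !mul0r !mul1r oppr0 !addr0.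
have W1E : W 1 = M - ln (cm (F 0 z)) by rewrite /W mul1r (_ : c + h = z)// /h addrC subrK.
have W0E : W 0 = M - ln (cm (F 0 c)) by rewrite /W mul0r addr0.
have w1 := W0 1 i1; have w0 := W0 0 i0.
rewrite -W1E -W0E => H.
have p1 : 0 < r + rho by rewrite ltr_wpDr.
have p2 : 0 < r - rho by rewrite subr_gt0.
rewrite -ler_ln ?posrE ?divr_gt0 ?mulr_gt0// ln_div ?posrE ?mulr_gt0// lnM ?posrE//.
lra.
Qed.

(** Does the work of Borel-Caratheodory for F'/F: in [ahlfors] the value of M - ln |F| at z is
    replaced by its Harnack bound from the centre, and the factor r + |z - c| cancels. *)
Lemma ldv_bound c (r M : R) z : 0 < r ->
  (forall w, cm (w - c) <= r -> U w) ->
  (forall w, cm (w - c) <= r -> ln (cm (F 0 w)) < M) -> cm (z - c) < r ->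
  cm (ldv F z) <= 2 * r * (M - ln (cm (F 0 c))) / (r - cm (z - c)) ^+ 2.
Proof.
move=> r0 HU HM zr.
have A := ahlfors Uopen FU F0 r0 HU HM (ltW zr).
have H := harnack r0 HU HM zr.
have rho0 := cm_ge0 (z - c).
set rho := cm (z - c) in zr A H rho0 *.
have p1 : 0 < r + rho by rewrite ltr_wpDr.
have p2 : 0 < r - rho by rewrite subr_gt0.
have -> : 2 * r * (M - ln (cm (F 0 c))) / (r - rho) ^+ 2 =
   2 * r * ((M - ln (cm (F 0 c))) * (r + rho) / (r - rho)) / (r ^+ 2 - rho ^+ 2).
  by rewrite subr_sqr; field; rewrite !gt_eqF.
rewrite ler_pdivlMr; last by rewrite subr_sqr mulr_gt0.
apply: le_trans A _; rewrite ler_wpM2l// mulr_ge0// ltW//.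
Qed.

(** ln |F'/F| - b ln |w - c| is harmonic off the zeros of F'/F. Adding k |w - c|^2 with k > 0 gives
    it the Laplacian 4k, which excludes an interior maximum, so the two circles decide; finally k
    tends to 0. *)
Lemma three_circles c (r1 r2 A b : R) z : 0 < r1 < r2 -> 0 < A -> 0 <= b ->
  (forall w, r1 <= cm (w - c) <= r2 -> U w) ->
  (forall w, cm (w - c) = r1 -> cm (ldv F w) <= A) ->
  (forall w, cm (w - c) = r2 -> cm (ldv F w) <= A * expR (b * ln (r2 / r1))) ->
  r1 <= cm (z - c) <= r2 -> cm (ldv F z) <= A * expR (b * ln (cm (z - c) / r1)).
Proof.
move=> /andP[r10 r12] A0 b0 HU H1 H2 /andP[z1 z2].
have r20 : 0 < r2 by apply: lt_trans r12.
have pos w : r1 <= cm (w - c) -> 0 < cm (w - c) by exact: lt_le_trans.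
pose E w := - b * ln (cm (w - c)).
suff key (k : R) : 0 < k -> cm (ldv F z) <= A * expR (b * ln (cm (z - c) / r1)) * expR (k * r2 ^+ 2).
  have cz := pos z z1.
  apply/ler_addgt0Pl => e e0.
  set X := A * _ in key *.
  have X0 : 0 < X by rewrite mulr_gt0// expR_gt0.
  (* Chosen so that the factor [expR (k * r2 ^+ 2)] is 1 + e/X and the bound becomes X + e. *)
  pose k := ln (1 + e / X) / r2 ^+ 2.
  have eX : 0 < e / X by rewrite divr_gt0.
  have k0 : 0 < k by rewrite divr_gt0 ?exprn_gt0// ln_gt0// ltrDl.
  apply: le_trans (key k k0) _; rewrite /k divfK ?gt_eqF ?exprn_gt0//.
  rewrite lnK ?posrE ?addr_gt0// mulrDr mulr1 mulrC divfK ?gt_eqF// addrC//.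
move=> k0; pose G w := cm (ldv F w) * expR (E w + k * (cm (w - c) * cm (w - c))).
have [] := @annulus_max _ G c r1 r2; first by rewrite !ltW.
  move=> w /andP[w1 w2]; apply: ccontM; first by apply: (ccont_ldv FU F0); apply: HU; rewrite w1.
  apply: (@ccont_comp _ (fun w => E w + k * (cm (w - c) * cm (w - c)))); last exact: continuous_expR.
  apply: ccontD; apply: ccontM; try exact: ccont_c.
    apply: (@ccont_comp _ (fun w => cm (w - c))); first exact: ccont_dist.
    by apply: continuous_ln; exact: pos.
  by apply: ccontM; exact: ccont_dist.
move=> z0 /andP[z01 z02] Gmax.
have Uz0 : U z0 by apply: HU; rewrite z01.
suff G0 : G z0 <= A * expR (- b * ln r1) * expR (k * r2 ^+ 2).
  have := Gmax z; rewrite z1 z2 => /(_ isT) Gz.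
  have := le_trans Gz G0; rewrite /G expRD mulrA => H.
  have k1 : 1 <= expR (k * (cm (z - c) * cm (z - c))).
    by rewrite -expR0 ler_expR !mulr_ge0 ?cm_ge0// ltW.
  have {}H : cm (ldv F z) * expR (E z) <= A * expR (- b * ln r1) * expR (k * r2 ^+ 2).
    by apply: le_trans H; rewrite ler_peMr ?mulr_ge0 ?cm_ge0 ?expR_ge0.
  have -> : cm (ldv F z) = cm (ldv F z) * expR (E z) * expR (- E z).
    by rewrite -mulrA -expRD subrr expR0 mulr1.
  apply: le_trans (ler_wpM2r (expR_ge0 _) H) _.
  have -> : b * ln (cm (z - c) / r1) = - b * ln r1 + - E z.
    by rewrite ln_div ?posrE ?pos// /E; ring.
  by rewrite expRD le_eqVlt; apply/orP; left; apply/eqP; ring.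
have bd w : r1 <= cm (w - c) <= r2 -> expR (k * (cm (w - c) * cm (w - c))) <= expR (k * r2 ^+ 2).
  move=> /andP[w1 w2]; rewrite ler_expR ler_wpM2l ?(ltW k0)// expr2.
  by rewrite ler_pM ?cm_ge0.
have [E1|/eqP n1] := eqVneq (cm (z0 - c)) r1.
  rewrite /G expRD mulrA /E E1; apply: ler_pM; rewrite ?mulr_ge0 ?cm_ge0 ?expR_ge0//.
    by rewrite ler_wpM2r ?expR_ge0// H1.
  by rewrite -E1; apply: bd; rewrite z01.
have [E2|/eqP n2] := eqVneq (cm (z0 - c)) r2.
  rewrite /G expRD mulrA /E E2; apply: ler_pM; rewrite ?mulr_ge0 ?cm_ge0 ?expR_ge0//.
  apply: le_trans (ler_wpM2r (expR_ge0 _) (H2 _ E2)) _.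
  rewrite -mulrA -expRD ln_div ?posrE//.
  by have -> : b * (ln r2 - ln r1) + - b * ln r2 = - b * ln r1 by ring.
have z0c := pos _ z01.
have [v0|v0] := eqVneq (ldv F z0) 0.
  by rewrite /G v0 cm0 mul0r !mulr_ge0 ?expR_ge0// ltW.
exfalso.
have z01' : r1 < cm (z0 - c) by rewrite lt_neqAle z01 andbT eq_sym; apply/eqP.
have z02' : cm (z0 - c) < r2 by rewrite lt_neqAle z02 andbT; apply/eqP.
have [p [q lv]] := lap_ldv Uopen FU F0 Uz0 v0.
have zc0 : z0 - c != 0 by rewrite -cm_gt0.
have cdd w : cderiv (fun w => w - c) w 1.
  by apply: cd_eq (cdB (cdid w) (cdc c w)) _; rewrite subr0.
have ld := lap_lncm (f := fun w => w - c) (f1 := fun=> 1) (z := z0) ltr01 (fun w _ => cdd w) (cdc 1 z0) zc0.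
have lS := lapD lv (lapD (lapZ (- b) ld) (lapZ k (lap_dist2 c z0))).
have [rr rr0 vr] := cd_neq0 (cd_ldv FU F0 Uz0) v0.
have m0 : 0 < Num.min rr (Num.min (cm (z0 - c) - r1) (r2 - cm (z0 - c))).
  by rewrite !lt_min rr0 !subr_gt0 z01'.
have H h : cm h < Num.min rr (Num.min (cm (z0 - c) - r1) (r2 - cm (z0 - c))) ->
  ln (cm (ldv F (z0 + h))) + (- b * ln (cm (z0 + h - c)) + k * cm (z0 + h - c) ^+ 2) <=
  ln (cm (ldv F z0)) + (- b * ln (cm (z0 - c)) + k * cm (z0 - c) ^+ 2).
  rewrite !lt_min => /and3P[/vr vh h1 h2].
  have := cm_dist (z0 + h - c) (z0 - c).
  have -> : z0 + h - c - (z0 - c) = h by ring.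
  rewrite ler_norml => /andP[l1 l2].
  have := Gmax (z0 + h) _; rewrite (_ : r1 <= cm (z0 + h - c) <= r2); last first.
    by apply/andP; split; lra.
  move=> /(_ isT); rewrite /G -ler_ln ?posrE ?mulr_gt0 ?expR_gt0 ?cm_gt0//.
  by rewrite !lnM ?posrE ?expR_gt0 ?cm_gt0// !expRK /E !expr2.
have := lap_max m0 lS H; lra.
Qed.

End HarnackThreeCircles.

(** * The bound 1/zeta(s) << |t|^e under RH *)

Section InverseZetaGrowth.
Context {R : realType}.
Local Notation C := R[i].
Implicit Types (z w h s c : C) (t : R).

Lemma cd_unique (f : C -> C) z a b : cderiv f z a -> cderiv f z b -> a = b.
Proof.
move=> fa fb; apply/eqP; rewrite -subr_eq0 -cm_eq0; apply: contraT => /negPf.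
move=> /negbT; rewrite cm_eq0 -cm_gt0 => d0.
have e0 : 0 < cm (a - b) / 4 by rewrite divr_gt0.
have [r1 r10 H1] := fa _ e0; have [r2 r20 H2] := fb _ e0.
pose h : R := Num.min r1 r2 / 2.
have m0 : 0 < Num.min r1 r2 by rewrite lt_min r10.
have h0 : 0 < h by rewrite divr_gt0.
have hm : h < Num.min r1 r2 by rewrite /h ltr_pdivrMr// ltr_pMr// ltr1n.
have chE : cm h%:C = h by rewrite cm_real gtr0_norm.
have := H1 h%:C; have := H2 h%:C; rewrite chE.
move: hm; rewrite lt_min => /andP[-> ->] /(_ isT) h2 /(_ isT) h1.
have E : h%:C * (a - b) = (f (z + h%:C) - f z - h%:C * b) - (f (z + h%:C) - f z - h%:C * a) by ring.
have : h * cm (a - b) <= cm (a - b) / 4 * h + cm (a - b) / 4 * h.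
  by rewrite -{1}chE -cmM E; apply: le_trans (cmB _ _) _; rewrite lerD.
rewrite -mulrDl mulrC ler_pM2r//; lra.
Qed.

Lemma subr1_neq0 s : 1 < re s -> s - 1 != 0.
Proof. by move=> s1; rewrite cm_ge_re// reB re1 gt_eqF// subr_gt0. Qed.

Lemma zetaZ_neq0_right s : 1 < re s -> zetaZ 0 s != 0.
Proof.
by move=> /zeta_neq0; apply: contraNneq => Z0; rewrite /zeta Z0 mul0r.
Qed.

(** 1/zeta(s) in a form that is regular at s = 1, with the value 0 there. *)
Definition invzeta s : C := (s - 1) / zetaZ 0 s.

Lemma invzeta_moebius s : 1 < re s -> invzeta s = moebius_series s.
Proof.
move=> s1; have z0 := zeta_neq0 s1.
apply: (mulfI z0); rewrite zeta_moebius// /invzeta /zeta; field.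
by rewrite subr1_neq0// zetaZ_neq0_right.
Qed.

Lemma invzeta_right s : 2 <= re s -> cm (invzeta s) <= 2.
Proof.
move=> s2; have s1 : 1 < re s by lra.
rewrite invzeta_moebius//; apply: le_trans (moebius_series_bound s1) _.
have : (re s - 1)^-1 <= 1 by rewrite invf_le1; lra.
lra.
Qed.

Lemma zetaZ1_zeta s : 1 < re s ->
  zetaZ 1 s / zetaZ 0 s = (s - 1)^-1 - mangoldt_series s.
Proof.
move=> s1; have z0 := zeta_neq0 s1; have s0 : 0 < re s by lra.
have sn := subr1_neq0 s1; have Z0 := zetaZ_neq0_right s1.
have d1 : cderiv (fun w => zeta w * (w - 1)) s (zeta1 s * (s - 1) + zeta s * 1).
  apply: cdM; first exact: cd_zeta.
  by apply: cd_eq (cdB (cdid _) (cdc _ _)) _; rewrite subr0.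
have d2 : cderiv (fun w => zeta w * (w - 1)) s (zetaZ 1 s).
  apply: (@cd_near _ (zetaZ 0) _ _ _ (re s - 1)); first by rewrite subr_gt0.
    move=> w ws; rewrite /zeta divfK// cm_ge_re// reB re1 gt_eqF// subr_gt0.
    by have := le_lt_trans (cm_re _) ws; rewrite reB ltr_norml => /andP[+ _]; lra.
  exact: cd_zetaZ.
rewrite -(cd_unique d1 d2) zeta1_mangoldt// /zeta; field.
by rewrite sn Z0.
Qed.

Lemma mangoldt_series_bound (a : R) : 0 < a -> exists B : R, forall s, 1 + a <= re s ->
  cm (mangoldt_series s) <= B.
Proof.
move=> a0; have a20 : 0 < a / 2 by rewrite divr_gt0.
pose K := (1`!%:R / (a / 2) ^+ 1 * expR (a / 2)).
have K0 : 0 <= K by rewrite !mulr_ge0 ?expR_ge0// invr_ge0 exprn_ge0// ltW.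
exists (K * (1 + (a / 2)^-1)) => s sa; have s1 : 1 < re s by lra.
apply: (csums_bound (mangoldt_csums s1)
   (M := fun i => K * expR (- ((1 + a / 2) * ln i.+1%:R)))).
  move=> i; have := @log_power_bound _ i a a0 1 s sa; rewrite expr1.
  apply: le_trans.
  rewrite (cmM (mangoldt _)%:C) (cmM (ln _)%:C) ler_wpM2r ?cm_ge0// !cm_real.
  have l0 : 0 <= ln (i.+1%:R : R) by rewrite ln_ge0// ler1n.
  rewrite (ger0_norm l0) ger0_norm ?mangoldt_ge0//.
  exact: mangoldt_le.
by move=> N; rewrite -mulr_sumr; apply: ler_wpM2l K0 _ _ _; exact: sum_powers.
Qed.

(** Turns a bound l^th with th < 1, l being of size ln t, into e l + K, that is into t^e after
    exponentiation. Beyond L0, where l^(1-th) = B/e, the linear term wins; before it the left side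
    is at most K. *)
Lemma sublinear_power (B th e : R) : 0 < B -> 0 <= th < 1 -> 0 < e ->
  exists2 K : R, 0 <= K & forall l : R, 1 <= l -> B * expR (th * ln l) <= e * l + K.
Proof.
move=> B0 /andP[th0 th1] e0; have th' : 0 < 1 - th by rewrite subr_gt0.
pose L0 := expR (ln (B / e) / (1 - th)).
have L00 : 0 < L0 := expR_gt0 _.
exists (B * expR (th * ln L0)); first by rewrite mulr_ge0 ?expR_ge0// ltW.
move=> l l1; have l0 : 0 < l by lra.
have [lL|Ll] := leP l L0.
  apply: (@le_trans _ _ (B * expR (th * ln L0))).
    by rewrite ler_wpM2l ?(ltW B0)// ler_expR ler_wpM2l// ler_ln ?posrE.
  by rewrite lerDr mulr_ge0// ltW.
apply: (@le_trans _ _ (e * l)); last by rewrite lerDl mulr_ge0 ?expR_ge0// ltW.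
have : ln (B / e) < (1 - th) * ln l.
  have : ln L0 < ln l by rewrite ltr_ln ?posrE.
  by rewrite /L0 expRK ltr_pdivrMr// [ln l * _]mulrC.
have Be : 0 < B / e by rewrite divr_gt0.
move=> H; have : B / e <= expR ((1 - th) * ln l).
  by rewrite -[leLHS]lnK ?posrE// ler_expR ltW.
rewrite ler_pdivrMr// => {}H.
apply: le_trans (ler_wpM2r (expR_ge0 _) H) _.
rewrite mulrAC -expRD.
have -> : (1 - th) * ln l + th * ln l = ln l by ring.
by rewrite lnK ?posrE// mulrC.
Qed.

(** The offset 4 exceeds Euler's number, so [ht] is at least 1 everywhere and all bounds hold
    uniformly down to t = 0. *)
Definition ht t : R := ln (4 + `|t|).

Lemma ht_pos t : 0 < 4 + `|t|. Proof. by rewrite ltr_pwDl. Qed.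
Lemma expR_ht t : expR (ht t) = 4 + `|t|.
Proof. by rewrite lnK// posrE ht_pos. Qed.

Lemma ht_ge1 t : 1 <= ht t.
Proof.
rewrite -ler_expR expR_ht; have := normr_ge0 t.
have : expR (- 2^-1) ^+ 2 = (expR 1)^-1 :> R.
  by rewrite expr2 -expRD -expRN; congr expR; field.
have := expR_ge1Dx (- 2^-1 : R); have := expR_gt0 (1 : R).
move=> e1 h E; have : 4^-1 <= (expR 1)^-1 :> R by rewrite -E; nra.
rewrite lef_pV2 ?posrE//; lra.
Qed.

Hypothesis RH : generalized_riemann_hypothesis R.
Let U s := 2^-1 < re s.

Lemma half_plane_open s : U s -> exists2 r : R, 0 < r & forall w, cm (w - s) < r -> U w.
Proof.
move=> Us; exists (re s - 2^-1); first by rewrite subr_gt0.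
move=> w /(le_lt_trans (cm_re _)); rewrite reB ltr_norml => /andP[+ _]; rewrite /U; lra.
Qed.

Lemma half_plane_cd k s : U s -> cderiv (zetaZ k) s (zetaZ k.+1 s).
Proof. by move=> Us; apply: cd_zetaZ; apply: lt_trans Us; rewrite invr_gt0. Qed.

Lemma half_plane_neq0 s : U s -> zetaZ 0 s != 0.
Proof. exact: zetaZ_neq0. Qed.

(** Centres of the discs: at abscissa 2 zeta is bounded away from 0, and the disc of radius 3/2 -
    eta extends to abscissa 1/2 + eta. *)
Let c t : C := 2 +i* t.

Lemma disc_re t w (r : R) : cm (w - c t) <= r -> 2 - r <= re w.
Proof. by move=> /(le_trans (cm_re _)); rewrite reB ler_norml => /andP[+ _]; rewrite /c /=; lra. Qed.

Lemma zetaZ_disc_bound (eta : R) t w : 0 < eta -> cm (w - c t) <= 3 / 2 - eta ->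
  ln (cm (zetaZ 0 w)) < 5 * ht t.
Proof.
move=> eta_gt0 wr; have rw := disc_re wr.
have w2 : 2^-1 <= re w by lra.
have Z0 : 0 < cm (zetaZ 0 w) by rewrite cm_gt0; apply: half_plane_neq0; rewrite /U; lra.
have h2 : 0 < 2^-1 :> R by rewrite invr_gt0.
rewrite -ltr_expR lnK ?posrE//.
have -> : expR (5 * ht t) = (4 + `|t|) ^+ 5 by rewrite (expRM_natl 5) expR_ht.
apply: le_lt_trans (zetaZ_bound h2 w2) _.
have ct : cm (c t) <= 2 + `|t|.
  by apply: le_trans (cm_reim _) _; rewrite /= ger0_norm.
have cw : cm w <= 4 + `|t|.
  have -> : w = (w - c t) + c t by ring.
  by apply: le_trans (cmD _ _) _; lra.
have cw1 : cm (1 - w) <= 5 + `|t|.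
  by apply: le_trans (cmB _ _) _; rewrite cm1; lra.
have : cm w * cm (1 - w) <= (4 + `|t|) * (5 + `|t|).
  by apply: ler_pM; rewrite ?cm_ge0.
have t0 := normr_ge0 t; rewrite invrK.
set x := 4 + `|t| => H.
have x3 : 3 <= x by rewrite /x; lra.
have H2 : x * (5 + `|t|) <= 4 * x ^+ 2 by rewrite /x; nra.
have H3 : 27 * x ^+ 2 <= x ^+ 5.
  have -> : x ^+ 5 = x ^+ 3 * x ^+ 2 by ring.
  rewrite ler_wpM2r ?sqr_ge0//.
  have -> : 27 = 3 ^+ 3 :> R by ring.
  by apply: lerXn2r; rewrite ?nnegrE//; lra.
have x2 : 9 <= x ^+ 2 by nra.
lra.
Qed.

(** |zeta| >= 1/2 at the centre because the Moebius series there is at most 2, and |c t - 1| is at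
    least 1 and at least |t|; together |zetaZ| >= (4+|t|)/10. The growth in t is kept since it must
    cancel the factor s - 1 of [invzeta]. *)
Lemma zetaZ_center t : ht t - ln 10 <= ln (cm (zetaZ 0 (c t))).
Proof.
have c1 : 1 < re (c t) by rewrite /= ltr1n.
have cn : c t - 1 != 0 by rewrite cm_ge_re// reB re1 /= gt_eqF//; lra.
have z0 := zeta_neq0 c1.
have E := zeta_moebius c1.
have zl : 2^-1 <= cm (zeta (c t)).
  have := moebius_series_bound c1; have := congr1 (@Normc.normc R) E.
  rewrite cmM cm1 => E1.
  have -> : re (c t) - 1 = 1 by rewrite /c /=; ring.
  rewrite invr1 => H; have {}H : cm (moebius_series (c t)) <= 2 by lra.
  have := ler_wpM2l (cm_ge0 (zeta (c t))) H; rewrite E1; lra.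
have ZE : cm (zetaZ 0 (c t)) = cm (zeta (c t)) * cm (c t - 1).
  by rewrite -cmM /zeta divfK.
have d1 : 1 <= cm (c t - 1).
  apply: le_trans (cm_re _); rewrite reB re1 /=.
  by rewrite ger0_norm; lra.
have d2 : `|t| <= cm (c t - 1).
  by apply: le_trans (cm_im _); rewrite imB im1 /= subr0.
have -> : ht t - ln 10 = ln ((4 + `|t|) / 10) by rewrite ln_div ?posrE// ht_pos.
have t3 := ht_pos t.
have : (4 + `|t|) / 10 <= cm (zetaZ 0 (c t)) by rewrite ZE; nra.
move=> H; rewrite ler_ln ?posrE ?divr_gt0//; apply: lt_le_trans H.
by rewrite divr_gt0.
Qed.

Lemma ln10_le t : ln 10 <= 4 * ht t.
Proof.
rewrite -ler_expR (expRM_natl 4) expR_ht lnK ?posrE//.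
have : 4 ^+ 4 <= (4 + `|t|) ^+ 4 by rewrite lerXn2r ?nnegrE ?(ltW (ht_pos _))// lerDl.
have -> : 4 ^+ 4 = 256 :> R by ring.
lra.
Qed.

(** [ldv_bound] with 2r <= 3, distance to the circle at least eta, and M - ln |zetaZ| at the centre
    at most 4 ht + ln 10 <= 8 ht; hence 24. *)
Lemma ldv_outer (eta : R) t z : 0 < eta -> eta <= 8^-1 -> cm (z - c t) <= 3 / 2 - 2 * eta ->
  cm (ldv zetaZ z) <= 24 / eta ^+ 2 * ht t.
Proof.
move=> eta_gt0 eta_small zr; have r0 : 0 < 3 / 2 - eta by lra.
have := @ldv_bound R zetaZ U half_plane_open half_plane_cd half_plane_neq0 (c t)
  (3 / 2 - eta) (5 * ht t) z r0.
have HU w : cm (w - c t) <= 3 / 2 - eta -> U w by move=> /disc_re; rewrite /U; lra.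
have zr' : cm (z - c t) < 3 / 2 - eta by lra.
move=> /(_ HU (fun w => @zetaZ_disc_bound eta t w eta_gt0) zr') H; apply: le_trans H _.
have Zc := zetaZ_center t; have l8 := ln10_le t; have h1 := ht_ge1 t.
have Zu : ln (cm (zetaZ 0 (c t))) < 5 * ht t.
  by apply: (zetaZ_disc_bound eta_gt0); rewrite subrr cm0; lra.
have -> : 24 / eta ^+ 2 * ht t = 3 * (8 * ht t) / eta ^+ 2 by ring.
apply: ler_pM.
- by apply: mulr_ge0; lra.
- by rewrite invr_ge0 exprn_ge0//; lra.
- by apply: ler_pM; lra.
- rewrite lef_pV2 ?posrE ?exprn_gt0//; last by lra.
  by rewrite lerXn2r ?nnegrE; lra.
Qed.

(** The disc of radius 3/4 lies in Re z >= 5/4, where the von Mangoldt series is bounded and |z - 1|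
    >= 1/4. *)
Lemma ldv_inner : exists2 A : R, 0 < A & forall t z, cm (z - c t) <= 3 / 4 ->
  cm (ldv zetaZ z) <= A.
Proof.
have q0 : 0 < 4^-1 :> R by rewrite invr_gt0.
have [B HB] := mangoldt_series_bound q0.
have B0 : 0 <= B.
  by apply: le_trans (HB 2%:C _); [exact: cm_ge0|rewrite /=; lra].
exists (4 + B); first by rewrite ltr_pwDl.
move=> t z /disc_re zr; have z1 : 1 < re z by lra.
rewrite /ldv zetaZ1_zeta//; apply: le_trans (cmB _ _) _; apply: lerD; last by apply: HB; lra.
rewrite cmV -[leRHS]invrK lef_pV2 ?posrE//.
  apply: le_trans (re_cm _); rewrite reB re1; lra.
by rewrite cm_gt0 cm_ge_re// reB re1 gt_eqF// subr_gt0.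
Qed.

(** Three circles with radii 3/4 (bounded), 3/2 - 2 eta (bound ht) and in between 3/2 - 3 eta: the
    bound becomes ht^th, where th < 1 is the ratio of the logarithms of the radii over 3/4. *)
Lemma ldv_sublinear (eta : R) : 0 < eta -> eta <= 8^-1 -> exists (A th : R), [/\ 0 < A, 0 <= th < 1 &
  forall t z, cm (z - c t) <= 3 / 2 - 3 * eta -> cm (ldv zetaZ z) <= A * expR (th * ln (ht t))].
Proof.
move=> eta_gt0 eta_small; have [A1 A10 HA1] := ldv_inner.
pose A := A1 + 24 / eta ^+ 2.
have e2 : 0 < 24 / eta ^+ 2 by rewrite divr_gt0// exprn_gt0.
have A0 : 0 < A by rewrite addr_gt0.
pose r3 : R := 3 / 2 - 2 * eta; pose rho : R := 3 / 2 - 3 * eta.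
have r1r : 3 / 4 < r3 by rewrite /r3; lra.
have rrho : 3 / 4 <= rho by rewrite /rho; lra.
have rhor : rho < r3 by rewrite /rho /r3; lra.
have p1 : 0 < 3 / 4 :> R by lra.
have p2 : 0 < r3 by lra.
have p3 : 0 < rho by lra.
have l3 : 0 < ln (r3 / (3 / 4)) by rewrite ln_gt0// ltr_pdivlMr// mul1r.
have lr : 0 <= ln (rho / (3 / 4)) by rewrite ln_ge0// ler_pdivlMr// mul1r.
pose th := ln (rho / (3 / 4)) / ln (r3 / (3 / 4)).
have th0 : 0 <= th by rewrite divr_ge0// ltW.
have th1 : th < 1.
  by rewrite ltr_pdivrMr// mul1r ltr_ln ?posrE ?divr_gt0// ltr_pM2r// invr_gt0.
exists A, th; split=> //; first by rewrite th0.
move=> t z zr; have h1 := ht_ge1 t; have lh := ln_ge0 h1.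
have AA : A1 <= A * expR (th * ln (ht t)).
  have : 1 <= expR (th * ln (ht t)) by rewrite -expR0 ler_expR mulr_ge0.
  move=> /(ler_wpM2l (ltW A0)); rewrite mulr1; apply: le_trans.
  by rewrite lerDl ltW.
have [z34|z34] := leP (cm (z - c t)) (3 / 4); first by apply: le_trans (HA1 t z z34) _.
(* Solves (r3/r1)^b = ht t, which fits the hypothesis on the outer circle. *)
pose b := ln (ht t) / ln (r3 / (3 / 4)).
have b0 : 0 <= b by rewrite divr_ge0// ltW.
have p13 : 0 < (3 / 4 : R) < r3 by apply/andP; split; [exact: p1|exact: r1r].
have := @three_circles R zetaZ U half_plane_open half_plane_cd half_plane_neq0 (c t)
  (3 / 4) r3 A b z p13 A0 b0.
have HU w : 3 / 4 <= cm (w - c t) <= r3 -> U w.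
  by move=> /andP[_ /disc_re]; rewrite /U /r3; lra.
have H1 w : cm (w - c t) = 3 / 4 -> cm (ldv zetaZ w) <= A.
  by move=> E; apply: le_trans (HA1 t w _) _; rewrite ?E// lerDl ltW.
have H2 w : cm (w - c t) = r3 -> cm (ldv zetaZ w) <= A * expR (b * ln (r3 / (3 / 4))).
  move=> E; rewrite /b divfK ?gt_eqF// lnK ?posrE; last by lra.
  apply: le_trans (ldv_outer (t := t) eta_gt0 eta_small _) _; first by rewrite E.
  by rewrite ler_wpM2r ?lerDr ?(ltW A10)//; lra.
have Hz : 3 / 4 <= cm (z - c t) <= r3 by rewrite (ltW z34) (le_trans zr)// ltW.
move=> /(_ HU H1 H2 Hz) H; apply: le_trans H _.
rewrite ler_wpM2l ?(ltW A0)// ler_expR.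
have -> : th * ln (ht t) = b * ln (rho / (3 / 4)) by rewrite /th /b; ring.
rewrite ler_wpM2l// ler_ln ?posrE ?divr_gt0//; last by lra.
by rewrite ler_wpM2r// invr_ge0 ltW.
Qed.

(** The derivative of ln |zetaZ| along the horizontal segment from 2 + it to s is at most |h|
    |F'/F|, so ln |zetaZ| drops by O(ht^th), at most e ht + K. Right of abscissa 2 the Moebius
    series is bounded. *)
Lemma invzeta_growth (eta e : R) : 0 < eta -> eta <= 8^-1 -> 0 < e -> exists2 K : R, 0 < K &
  forall s, 2^-1 + 3 * eta <= re s -> cm (invzeta s) <= K * expR (e * ht (im s)).
Proof.
move=> eta_gt0 eta_small e0; have [A [th [A0 th01 HA]]] := ldv_sublinear eta_gt0 eta_small.
have A2 : 0 < 2 * A by lra.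
have [K K0 HK] := sublinear_power A2 th01 e0.
have P : 2 <= 10 * expR K by have := expR_ge1Dx K; lra.
exists (10 * expR K); first by lra.
move=> s sr; set t := im s; have h1 := ht_ge1 t.
have [s2|s2] := leP 2 (re s).
  apply: le_trans (invzeta_right s2) _; apply: le_trans P _.
  have E1 : 1 <= expR (e * ht t) by rewrite -expR0 ler_expR mulr_ge0; lra.
  by rewrite ler_peMr// mulr_ge0// expR_ge0.
have Us : U s by rewrite /U; lra.
pose h : C := (re s - 2)%:C.
have pt (y : R) : c t + y%:C * h = (2 + y * (re s - 2)) +i* t.
  by apply: complex_ext; rewrite /=; ring.
have Uy (y : R) : 0 <= y <= 1 -> U (c t + y%:C * h).
  move=> /andP[y0 y1]; rewrite pt /U /=.
  have : y * (2 - re s) <= 1 * (2 - re s) by rewrite ler_wpM2r//; lra.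
  lra.
have dd (y : R) : 0 <= y <= 1 -> is_derive y 1 (fun y : R => ln (cm (zetaZ 0 (c t + y%:C * h))))
   (re (h * ldv zetaZ (c t + y%:C * h))).
  move=> y01; apply: rd_eq (rd_ln_cm (half_plane_cd 0 (Uy y y01)) (half_plane_neq0 (Uy y y01))) _.
  by rewrite /ldv mulrA.
have db (y : R) : 0 <= y <= 1 -> `|re (h * ldv zetaZ (c t + y%:C * h))| <= 2 * A * expR (th * ln (ht t)).
  move=> /andP[y0 y1]; apply: le_trans (cm_re _) _; rewrite cmM -mulrA.
  have hE : cm h = 2 - re s by rewrite cm_real ler0_norm; lra.
  apply: ler_pM; rewrite ?cm_ge0//; first by rewrite hE; lra.
  apply: HA; rewrite [c t + _]addrC addrK cmM cm_real ger0_norm// hE.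
  have : y * (2 - re s) <= 1 * (2 - re s) by rewrite ler_wpM2r//; lra.
  lra.
have := mvt_bound (@ler01 R) dd db.
rewrite subr0 mulr1 mul0r addr0 => H.
have E1 : c t + (1 : R)%:C * h = s.
  by rewrite pt mul1r addrC subrK /t; case: (s).
rewrite E1 ler_norml in H; case/andP: H => H _.
have Zc := zetaZ_center t; have := HK _ h1 => H2.
have Z0 : 0 < cm (zetaZ 0 s) by rewrite cm_gt0 half_plane_neq0.
(* The leading [ht t] comes from [zetaZ_center] and cancels |s - 1| <= 4 + |t| below, so that only e
   ht remains. *)
have H3 : (1 - e) * ht t - ln 10 - K <= ln (cm (zetaZ 0 s)) by lra.
have H4 : expR ((1 - e) * ht t - ln 10 - K) <= cm (zetaZ 0 s).
  by rewrite -[leRHS]lnK ?posrE// ler_expR.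
rewrite /invzeta cmM cmV ler_pdivrMr//.
have H5 : 10 * expR K * expR (e * ht t) * expR ((1 - e) * ht t - ln 10 - K) = 4 + `|t|.
  rewrite -expR_ht -[X in X * _ * _ * _](@lnK _ 10) ?posrE// -!expRD; congr expR.
  by ring.
apply: (@le_trans _ _ (4 + `|t|)); last first.
  by rewrite -H5 ler_wpM2l// !mulr_ge0 ?expR_ge0.
apply: le_trans (cm_reim _) _; rewrite reB imB re1 im1 subr0 lerD2r.
by rewrite ler_norml; apply/andP; split; lra.
Qed.

End InverseZetaGrowth.

(** * Integrals over vertical half lines *)

Section HalfLineIntegral.
Context {R : realType}.
Implicit Types (f g : R -> R) (T x t a : R).

Let F f x : R := \int[lebesgue_measure]_(t in `[(-1)%R, x]) f t.

(* A total difference of two integrals from -1, so that the derivative at T = 0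
   is two-sided; it is the integral over [0, T] for continuous f and T >= 0. *)
Definition iint f T : R := F f T - F f 0.

Lemma iint0 f : iint f 0 = 0. Proof. exact: subrr. Qed.

Lemma iint_deriv f T : continuous f -> 0 <= T -> is_derive T 1 (iint f) (f T).
Proof.
move=> fc T0.
have [||||dF FE] := @continuous_FTC1_closed R f (-1) T (T + 1).
- by rewrite ltrDl.
- apply: continuous_compact_integrable; first exact: segment_compact.
  exact: continuous_subspaceT.
- by apply: lt_le_trans T0; rewrite ltrN10.
- exact: fc.
have dF1 : is_derive T 1 (F f) (f T).
  by split => //; rewrite -FE derive1E.
by apply: (rd_eq (rdD dF1 (rdc (- F f 0) T))); rewrite addr0.
Qed.

Lemma continuous_cM (c : R) f : continuous f -> continuous (fun x => c * f x).
Proof. by move=> fc x; apply: continuousM; [exact: cst_continuous|exact: fc]. Qed.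

Lemma continuous_add f g : continuous f -> continuous g ->
  continuous (fun x => f x + g x).
Proof. by move=> fc gc x; apply: continuousD; [exact: fc|exact: gc]. Qed.

(** The integration rules that follow are obtained from derivatives in the upper limit by the mean
    value theorem. *)
Lemma iintE f (G : R -> R) T : continuous f -> 0 <= T ->
  (forall x, 0 <= x <= T -> is_derive x 1 G (f x)) -> iint f T = G T - G 0.
Proof.
move=> fc T0 dG.
have := @mvt_const R (fun x => iint f x + - G x) 0 T T0.
rewrite iint0 => H; suff : iint f T - G T = 0 - G 0 by lra.
apply: H => x /andP[x0 xT].
by apply: (rd_eq (rdD (iint_deriv fc x0) (rdN (dG x _)))); rewrite ?x0// subrr.
Qed.

Lemma iint_le f g T : continuous f -> continuous g -> 0 <= T ->
  (forall x, 0 <= x <= T -> f x <= g x) -> iint f T <= iint g T.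
Proof.
move=> fc gc T0 fg.
have := @mvt_nondecr R (fun x => iint g x + - iint f x) (fun x => g x + - f x) 0 T T0.
rewrite !iint0 subrr => H; rewrite -subr_ge0; apply: H => x x0T.
  by case/andP: (x0T) => x0 _; apply: rdD; [|apply: rdN]; exact: iint_deriv.
by rewrite subr_ge0 fg.
Qed.

Lemma iintD f g T : continuous f -> continuous g -> 0 <= T ->
  iint (fun x => f x + g x) T = iint f T + iint g T.
Proof.
move=> fc gc T0.
have c := continuous_add fc gc.
have d x : 0 <= x <= T -> is_derive x 1 (fun x => iint f x + iint g x) (f x + g x).
  by move=> /andP[x0 _]; apply: rdD; exact: iint_deriv.
by rewrite (iintE c T0 d) !iint0 addr0 subr0.
Qed.

Lemma iintZ (c : R) f T : continuous f -> 0 <= T ->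
  iint (fun x => c * f x) T = c * iint f T.
Proof.
move=> fc T0.
have cc : continuous (fun x => c * f x) by exact: continuous_cM.
have d x : 0 <= x <= T -> is_derive x 1 (fun x => c * iint f x) (c * f x).
  move=> /andP[x0 _]; apply: (rd_eq (rdM (rdc c _) (iint_deriv fc x0))).
  by rewrite mul0r add0r.
by rewrite (iintE cc T0 d) iint0 mulr0 subr0.
Qed.

Lemma iint_c (c : R) T : 0 <= T -> iint (fun=> c) T = c * T.
Proof.
move=> T0; have cc : continuous (fun _ : R => c) by move=> x; exact: cst_continuous.
have d x : 0 <= x <= T -> is_derive x 1 (fun x => c * x) c.
  by move=> _; apply: (rd_eq (rdM (rdc c _) (rdid _))); rewrite mul0r mulr1 add0r.
by rewrite (iintE cc T0 d) mulr0 subr0.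
Qed.

Lemma iint_sum (I : Type) (r : seq I) (P : pred I) (f : I -> R -> R) T :
  (forall i, continuous (f i)) -> 0 <= T ->
  iint (fun x => \sum_(i <- r | P i) f i x) T = \sum_(i <- r | P i) iint (f i) T.
Proof.
move=> fc T0; elim: r => [|i r IH].
  rewrite big_nil -[RHS](mul0r T) -iint_c//; congr iint.
  by apply/funext => x; rewrite big_nil.
have sc : continuous (fun x => \sum_(j <- r | P j) f j x).
  elim: r {IH} => [|j s IH].
    have -> : (fun x => \sum_(j <- [::] | P j) f j x) = fun=> 0 by apply/funext => x; rewrite big_nil.
    by move=> x; exact: cst_continuous.
  have -> : (fun x => \sum_(k <- j :: s | P k) f k x) =
     if P j then (fun x => f j x + \sum_(k <- s | P k) f k x) else (fun x => \sum_(k <- s | P k) f k x).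
    by apply/funext => x; rewrite big_cons; case: ifP.
  by case: ifP => // _ x; apply: continuousD; [exact: fc|exact: IH].
rewrite big_cons; case: ifP => Pi.
  rewrite -IH -iintD//; congr iint.
  by apply/funext => x; rewrite big_cons Pi.
rewrite -IH; congr iint.
by apply/funext => x; rewrite big_cons Pi.
Qed.

Lemma iint_abs f g T : continuous f -> continuous g -> 0 <= T ->
  (forall x, 0 <= x <= T -> `|f x| <= g x) -> `|iint f T| <= iint g T.
Proof.
move=> fc gc T0 fg; rewrite ler_norml; apply/andP; split.
  rewrite -mulN1r -iintZ//; apply: iint_le => //; first exact: continuous_cM.
  by move=> x /fg; rewrite ler_norml mulN1r => /andP[].
by apply: iint_le => // x /fg; rewrite ler_norml => /andP[].
Qed.

Lemma iint_bound f M T : continuous f -> 0 <= T ->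
  (forall x, 0 <= x <= T -> `|f x| <= M) -> `|iint f T| <= M * T.
Proof.
move=> fc T0 fM; rewrite -iint_c//; apply: iint_abs => //.
by move=> x; exact: cst_continuous.
Qed.

End HalfLineIntegral.

Section VerticalIntegrals.
Context {R : realType}.
Local Notation C := R[i].
Implicit Types (f : C -> C) (z w : C) (x v T : R).

Lemma vertical_deriv f x v d : cderiv f (x +i* v) d ->
  is_derive v 1 (fun y : R => re (f (x +i* y))) (- im d) /\
  is_derive v 1 (fun y : R => im (f (x +i* y))) (re d).
Proof.
move=> fd; have E (y : R) : (x +i* 0) + y%:C * 'i%C = x +i* y.
  by apply: complex_ext; rewrite /=; ring.
have [d1 d2] : is_derive v 1 (fun y : R => re (f ((x +i* 0) + y%:C * 'i%C))) (re ('i%C * d)) /\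
  is_derive v 1 (fun y : R => im (f ((x +i* 0) + y%:C * 'i%C))) (im ('i%C * d)).
  by apply: cd_rd; rewrite E.
split.
  apply: (rd_eq (rd_ext _ d1)); first by move=> y; rewrite E.
  by rewrite reM /= mul0r mul1r sub0r.
apply: (rd_eq (rd_ext _ d2)); first by move=> y; rewrite E.
by rewrite imM /= mul0r mul1r add0r.
Qed.

Lemma vertical_cont f f1 x : (forall v, cderiv f (x +i* v) (f1 (x +i* v))) ->
  continuous (fun v => re (f (x +i* v))).
Proof. by move=> fd v; have [d1 _] := vertical_deriv (fd v); exact: rd_cont d1. Qed.

Lemma vertical_cont_cm f f1 x : (forall v, cderiv f (x +i* v) (f1 (x +i* v))) ->
  continuous (fun v => cm (f (x +i* v))).
Proof.
move=> fd v; have [d1 d2] := vertical_deriv (fd v).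
apply/cvgrPdist_lt => e e0; have [r r0 H] := cd_cont (fd v) e0.
near=> y; rewrite distrC.
have -> : x +i* y = x +i* v + ((0 : R) +i* (y - v)).
  by apply: complex_ext; rewrite /=; ring.
apply: le_lt_trans (cm_dist _ _) _; apply: H.
rewrite cmE /= expr0n add0r sqrtr_sqr distrC.
near: y; apply/nbhs_ballP; exists r => //=.
Unshelve. all: by end_near. Qed.

Lemma im_vertical_int f f1 f2 x T : 0 <= T ->
  (forall v, cderiv f (x +i* v) (f1 (x +i* v))) ->
  (forall v, cderiv f1 (x +i* v) (f2 (x +i* v))) ->
  iint (fun v => re (f1 (x +i* v))) T = im (f (x +i* T)) - im (f (x +i* 0)).
Proof.
move=> T0 fd f1d.
have d v : 0 <= v <= T -> is_derive v 1 (fun y : R => im (f (x +i* y))) (re (f1 (x +i* v))).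
  by move=> _; have [] := vertical_deriv (fd v).
by rewrite (iintE (vertical_cont f1d) T0 d).
Qed.

(** The substitute for Cauchy's theorem. Differentiation under the integral gives the integral of re
    f', and re f' is the vertical derivative of im f, so that only the two end points remain. *)
Lemma vertical_int_deriv f f1 f2 (lo : R) x T : 0 <= T -> lo < x ->
  (forall z, lo < re z -> cderiv f z (f1 z)) ->
  (forall z, lo < re z -> cderiv f1 z (f2 z)) ->
  is_derive x 1 (fun y => iint (fun v => re (f (y +i* v))) T)
    (im (f (x +i* T)) - im (f (x +i* 0))).
Proof.
move=> T0 lox fd f1d.
have fdx y : lo < y -> forall v, cderiv f (y +i* v) (f1 (y +i* v)) by move=> ? v; exact: fd.
have f1dx y : lo < y -> forall v, cderiv f1 (y +i* v) (f2 (y +i* v)) by move=> ? v; exact: f1d.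
rewrite -(im_vertical_int T0 (fdx x lox) (f1dx x lox)).
apply: is_derive1P => e e0.
have T1 : 0 < T + 1 by rewrite ltr_wpDl.
pose d := e / (T + 1); have d0 : 0 < d by rewrite divr_gt0.
pose P (h v : R) := cm (f ((x + h) +i* v) - f (x +i* v) - h%:C * f1 (x +i* v)) <= d * `|h|.
(* Compactness of [0, T] makes the estimate for the increment uniform in v; locally it follows from
   the continuity of f1 near x + iv. *)
have nc := (compact_near_coveringP _).1 (@segment_compact R 0 T).
have key : \forall h \near nbhs (0 : R), `[(0 : R), T] `<=` P h.
  apply: (nc R (nbhs (0 : R)) P _) => v _.
  have d20 : 0 < d / 2 by rewrite divr_gt0.
  have [r r0 Hr] := cd_cont (f1dx x lox v) d20.
  have r40 : 0 < r / 4 by rewrite divr_gt0.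
  pose rho := Num.min (r / 4) (x - lo).
  have rho0 : 0 < rho by rewrite lt_min r40 subr_gt0.
  exists (ball v (r / 4), ball 0 rho); first by split; exact: nbhsx_ballx.
  move=> [v' h] /= []; rewrite /ball /= sub0r normrN => vv.
  rewrite lt_min => /andP[hr hx].
  have near (s : R) : 0 <= s <= 1 ->
      cm (f1 ((x + s * h) +i* v') - f1 (x +i* v)) < d / 2 /\ lo < x + s * h.
    move=> /andP[s0 s1].
    have sh : `|s * h| <= `|h| by rewrite normrM ger0_norm// ler_piMl.
    split.
      have -> : (x + s * h) +i* v' = x +i* v + ((s * h) +i* (v' - v)).
        by apply: complex_ext; rewrite /=; ring.
      apply: Hr; apply: le_lt_trans (cm_reim _) _; rewrite /= [`|v' - v|]distrC; lra.
    have := le_lt_trans sh hx; rewrite ltr_norml => /andP[]; lra.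
  rewrite /P.
  have -> : f ((x + h) +i* v') - f (x +i* v') - h%:C * f1 (x +i* v') =
    (fun w => f w - w * f1 (x +i* v')) (x +i* v' + h%:C) -
    (fun w => f w - w * f1 (x +i* v')) (x +i* v').
    have -> : (x + h) +i* v' = x +i* v' + h%:C by apply: complex_ext; rewrite /= ?addr0.
    by cbv beta; ring.
  rewrite -(cm_real h).
  have pt (s : R) : x +i* v' + s%:C * h%:C = (x + s * h) +i* v'.
    by apply: complex_ext; rewrite /=; ring.
  apply: (@mvt_cderiv _ (fun w => f w - w * f1 (x +i* v')) (fun w => f1 w - f1 (x +i* v'))) => s s01.
    have [_ lo1] := near s s01.
    apply: cd_eq (cdB (fd _ _) (cdM (cdid _) (cdc _ _))) _; first by rewrite pt.
    by rewrite mul1r mulr0 addr0.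
  rewrite pt; have [n1 _] := near s s01.
  have i0 : 0 <= (0 : R) <= 1 by rewrite lexx ler01.
  have [n2 _] := near 0 i0; rewrite mul0r addr0 in n2.
  have -> : f1 ((x + s * h) +i* v') - f1 (x +i* v') =
    (f1 ((x + s * h) +i* v') - f1 (x +i* v)) - (f1 (x +i* v') - f1 (x +i* v)) by ring.
  by apply: le_trans (cmB _ _) _; lra.
have [r r0 Hr] : exists2 r : R, 0 < r & forall h : R, `|h| < r -> `[(0 : R), T] `<=` P h.
  move: key => /nbhs_ballP[r /= r0 Hr]; exists r => // h hr.
  by apply: Hr; rewrite /ball /= sub0r normrN.
exists (Num.min r (x - lo)); first by rewrite lt_min r0 subr_gt0.
move=> h; rewrite lt_min => /andP[/Hr hr hx].
have lox' : lo < x + h by move: hx; rewrite ltr_norml => /andP[]; lra.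
have c1 := vertical_cont (fdx _ lox'); have c2 := vertical_cont (fdx _ lox).
have c3 := vertical_cont (f1dx _ lox).
have cB := continuous_cM (c := -1) c2; have cD := continuous_cM (c := - h) c3.
have cAB : continuous (fun v => re (f ((x + h) +i* v)) + -1 * re (f (x +i* v))).
  exact: continuous_add c1 cB.
have cABD : continuous (fun v => re (f ((x + h) +i* v)) + -1 * re (f (x +i* v)) +
    - h * re (f1 (x +i* v))).
  exact: continuous_add cAB cD.
have -> : iint (fun v => re (f ((x + h) +i* v))) T - iint (fun v => re (f (x +i* v))) T -
   h * iint (fun v => re (f1 (x +i* v))) T =
   iint (fun v => re (f ((x + h) +i* v)) + -1 * re (f (x +i* v)) + - h * re (f1 (x +i* v))) T.
  by rewrite (iintD cAB cD T0) (iintD c1 cB T0) (iintZ _ c2 T0) (iintZ _ c3 T0); ring.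
apply: (@le_trans _ _ (d * `|h| * T)).
  apply: (iint_bound cABD T0).
  move=> v v0T; have := hr v; rewrite /= in_itv /= => /(_ v0T); rewrite /P.
  apply: le_trans; apply: le_trans (cm_re _).
  by rewrite !reB (reZ h) mulN1r mulNr.
rewrite /d -!mulrA [`|h| * T]mulrC mulrA mulrA ler_wpM2r//.
by rewrite -mulrA ler_piMr ?(ltW e0)// mulrC ler_pdivrMr// mul1r lerDl.
Qed.

(* Only one vertical side and the top edge contribute to the difference:
   the functions of interest are real on the real axis. *)
Lemma vertical_shift f f1 f2 (lo a b B T : R) : 0 <= T -> lo < a -> a <= b ->
  (forall z, lo < re z -> cderiv f z (f1 z)) ->
  (forall z, lo < re z -> cderiv f1 z (f2 z)) ->
  (forall x, a <= x <= b -> im (f (x +i* 0)) = 0) ->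
  (forall x, a <= x <= b -> cm (f (x +i* T)) <= B) ->
  `|iint (fun v => re (f (b +i* v))) T - iint (fun v => re (f (a +i* v))) T| <= B * (b - a).
Proof.
move=> T0 loa ab fd f1d f0 fB.
apply: (@mvt_bound R (fun y => iint (fun v => re (f (y +i* v))) T)
  (fun x => im (f (x +i* T)) - im (f (x +i* 0)))) => // x xab.
  by apply: vertical_int_deriv fd f1d => //; case/andP: xab => ax _; exact: lt_le_trans ax.
by rewrite f0// subr0; apply: le_trans (cm_im _) _; exact: fB.
Qed.

End VerticalIntegrals.

Section TwiceHolomorphic.
Context {R : realType}.
Local Notation C := R[i].
Implicit Types (f g : C -> C) (z w : C) (lo x v T : R).

(** Two derivatives, because moving a vertical line uses continuity of the first one, and the second
    supplies it. *)
Definition hol2 lo f := exists (f1 f2 : C -> C), forall z, lo < re z ->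
  cderiv f z (f1 z) /\ cderiv f1 z (f2 z).

Lemma hol2M lo f g : hol2 lo f -> hol2 lo g -> hol2 lo (fun z => f z * g z).
Proof.
move=> [f1 [f2 Hf]] [g1 [g2 Hg]].
exists (fun z => f1 z * g z + f z * g1 z).
exists (fun z => (f2 z * g z + f1 z * g1 z) + (f1 z * g1 z + f z * g2 z)) => z zl.
have [a b] := Hf z zl; have [c d] := Hg z zl.
by split; [exact: cdM|apply: cdD; exact: cdM].
Qed.

Lemma hol2D lo f g : hol2 lo f -> hol2 lo g -> hol2 lo (fun z => f z + g z).
Proof.
move=> [f1 [f2 Hf]] [g1 [g2 Hg]].
exists (fun z => f1 z + g1 z), (fun z => f2 z + g2 z) => z zl.
have [a b] := Hf z zl; have [c d] := Hg z zl.
by split; exact: cdD.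
Qed.

Lemma hol2c lo (a : C) : hol2 lo (fun=> a).
Proof. by exists (fun=> 0), (fun=> 0) => z _; split; exact: cdc. Qed.

Lemma hol2id lo : hol2 lo (fun z => z).
Proof. by exists (fun=> 1), (fun=> 0) => z _; split; [exact: cdid|exact: cdc]. Qed.

Lemma hol2_sum (I : Type) (r : seq I) lo (f : I -> C -> C) :
  (forall i, hol2 lo (f i)) -> hol2 lo (fun z => \sum_(i <- r) f i z).
Proof.
move=> H; elim: r => [|i r IH].
  have -> : (fun z => \sum_(i <- [::]) f i z) = fun=> 0 by apply/funext => z; rewrite big_nil.
  exact: hol2c.
have -> : (fun z => \sum_(k <- i :: r) f k z) = fun z => f i z + \sum_(k <- r) f k z.
  by apply/funext => z; rewrite big_cons.
exact: hol2D.
Qed.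

Lemma hol2V lo f : hol2 lo f -> (forall z, lo < re z -> f z != 0) ->
  hol2 lo (fun z => (f z)^-1).
Proof.
move=> [f1 [f2 Hf]] f0.
exists (fun z => - (f z ^- 2) * f1 z).
exists (fun z => - (- ((f z ^+ 2) ^- 2) * (2%:R * f z ^+ 1 * f1 z)) * f1 z +
  - (f z ^- 2) * f2 z) => z zl.
have [a b] := Hf z zl; have zn := f0 z zl.
split; first exact: cdV.
apply: (cdM _ b); apply: cdN.
by apply: (@cdV _ (fun z => f z ^+ 2)); [rewrite expf_neq0|exact: (cdX 2 a)].
Qed.

Lemma hol2_exp lo (a : C) : hol2 lo (fun z => cexp (a * z)).
Proof.
exists (fun z => cexp (a * z) * a), (fun z => cexp (a * z) * a * a) => z _.
have d : cderiv (fun z => cexp (a * z)) z (cexp (a * z) * a).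
  by apply: cdexp; apply: cd_eq (cdZ a (cdid z)) _; rewrite mulr1.
split=> //.
by apply: cd_eq (cdM d (cdc _ _)) _; rewrite mulr0 addr0.
Qed.

Lemma hol2_shift lo f (a b B T : R) : hol2 lo f -> 0 <= T -> lo < a -> a <= b ->
  (forall x, a <= x <= b -> im (f (x +i* 0)) = 0) ->
  (forall x, a <= x <= b -> cm (f (x +i* T)) <= B) ->
  `|iint (fun v => re (f (b +i* v))) T - iint (fun v => re (f (a +i* v))) T| <= B * (b - a).
Proof.
move=> [f1 [f2 H]] T0 la ab f0 fB.
by apply: (vertical_shift T0 la ab (fun z zl => (H z zl).1) (fun z zl => (H z zl).2)).
Qed.

Lemma hol2_cont lo f x : hol2 lo f -> lo < x ->
  continuous (fun v => re (f (x +i* v))).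
Proof.
move=> [f1 [f2 H]] lx; apply: (@vertical_cont _ f f1) => v.
exact: (H (x +i* v) lx).1.
Qed.

Lemma hol2_cont_cm lo f x : hol2 lo f -> lo < x ->
  continuous (fun v => cm (f (x +i* v))).
Proof.
move=> [f1 [f2 H]] lx; apply: (@vertical_cont_cm _ f f1) => v.
exact: (H (x +i* v) lx).1.
Qed.

Lemma im0_M z w : im z = 0 -> im w = 0 -> im (z * w) = 0.
Proof. by rewrite imM => -> ->; rewrite mulr0 mul0r addr0. Qed.
Lemma im0_D z w : im z = 0 -> im w = 0 -> im (z + w) = 0.
Proof. by rewrite imD => -> ->; rewrite addr0. Qed.
Lemma im0_V z : im z = 0 -> im z^-1 = 0.
Proof. by case: z => a b /= ->; rewrite mul0r oppr0. Qed.
Lemma im0_exp z : im z = 0 -> im (cexp z) = 0.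
Proof. by rewrite im_cexp => ->; rewrite sin0 mulr0. Qed.

End TwiceHolomorphic.

(** * The Perron kernel of order two *)

Section PerronKernel.
Context {R : realType}.
Local Notation C := R[i].
Implicit Types (z w : C) (L s x v T : R).

(** With L = ln y this is y^w/w^2; the real part of its half-line integral, divided by pi, tends to
    max(0, L). *)
Definition pker L w : C := cexp (L%:C * w) * w ^- 2.

Lemma hol2_inv2 : @hol2 R 0 (fun w => w ^- 2).
Proof.
apply: hol2V; first exact: (hol2M (hol2id 0) (hol2id 0)).
by move=> z z0; rewrite expf_neq0// cm_ge_re// gt_eqF.
Qed.

Lemma hol2_pker L : hol2 0 (pker L).
Proof. exact: hol2M (hol2_exp _ _) hol2_inv2. Qed.

Lemma pker_real L x : im (pker L (x +i* 0)) = 0.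
Proof.
apply: im0_M; last by apply: im0_V; apply: im0_M.
by apply: im0_exp; apply: im0_M.
Qed.

Lemma cm_pker L w : cm (pker L w) = expR (L * re w) / cm w ^+ 2.
Proof.
rewrite /pker cmM cmV cmX cm_cexp.
by rewrite reM /= mul0r subr0.
Qed.

Lemma cm_ge_im (x v : R) : 0 <= v -> v <= cm (x +i* v : C).
Proof. by move=> v0; apply: le_trans (cm_im _); rewrite /= ger0_norm. Qed.

Lemma cm_ge_rec (x v : R) : 0 <= x -> x <= cm (x +i* v : C).
Proof. by move=> v0; apply: le_trans (cm_re _); rewrite /= ger0_norm. Qed.

(** The line is moved right to abscissa T. There |w| >= T and the exponential is at most 1, so the
    new line and the top edge contribute at most 1/T each. *)
Lemma pker_neg L s T : 0 <= L -> 0 < s -> s <= T ->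
  `|iint (fun v => re (pker (- L) (s +i* v))) T| <= 2 / T.
Proof.
move=> L0 s0 sT; have T0 : 0 < T by exact: lt_le_trans sT.
have b1 x : 0 < x -> expR (- L * x) <= 1.
  by move=> x0; rewrite -expR0 ler_expR mulNr oppr_le0 mulr_ge0// ltW.
have inv2 (a c : R) : 0 < a -> a <= c -> (c ^+ 2)^-1 <= (a ^+ 2)^-1.
  move=> a0 ac; have c0 := lt_le_trans a0 ac.
  by rewrite lef_pV2 ?posrE ?exprn_gt0// lerXn2r ?nnegrE// ltW.
have bT x : s <= x <= T -> cm (pker (- L) (x +i* T)) <= (T ^+ 2)^-1.
  move=> /andP[sx _]; have x0 := lt_le_trans s0 sx; rewrite cm_pker.
  rewrite -[leRHS]mul1r; apply: ler_pM; rewrite ?expR_ge0 ?invr_ge0 ?sqr_ge0//.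
    exact: b1.
  by apply: inv2 => //; apply: cm_ge_im; exact: ltW.
have H := hol2_shift (hol2_pker (- L)) (ltW T0) s0 sT (fun x _ => pker_real _ x) bT.
have H2 : `|iint (fun v => re (pker (- L) (T +i* v))) T| <= (T ^+ 2)^-1 * T.
  apply: iint_bound; [exact: hol2_cont (hol2_pker _) T0|exact: ltW|].
  move=> v _; apply: le_trans (cm_re _) _; rewrite cm_pker.
  rewrite -[leRHS]mul1r; apply: ler_pM; rewrite ?expR_ge0 ?invr_ge0 ?sqr_ge0//.
    exact: b1.
  by apply: inv2 => //; apply: cm_ge_rec; exact: ltW.
have H3 : (T ^+ 2)^-1 * (T - s) <= (T ^+ 2)^-1 * T.
  by rewrite ler_wpM2l ?invr_ge0 ?sqr_ge0// gerBl ltW.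
have E : (T ^+ 2)^-1 * T = T^-1 by field; rewrite gt_eqF.
rewrite E in H2 H3.
have {}H := le_trans H H3.
move: H H2; set a := iint _ _; set b := iint _ _.
rewrite !ler_norml => /andP[? ?] /andP[? ?].
have -> : 2 / T = T^-1 + T^-1 by ring.
by apply/andP; split; lra.
Qed.

(** N is 2 (sinh z - z) with z = L w and N1 is its derivative. N vanishes to third order at 0, which
    tames the pole of S = N/w^2, and re S vanishes on the imaginary axis, where N is imaginary and
    w^2 real. *)
Let N L w : C := cexp (L%:C * w) - cexp (- (L%:C * w)) - 2 * (L%:C * w).
Let N1 L w : C := L%:C * (cexp (L%:C * w) + cexp (- (L%:C * w)) - 2).
Let S L w : C := N L w * w ^- 2.

Lemma N_bound L w : 0 <= L -> cm (N L w) <= 2 * (L * cm w) ^+ 3 * expR (L * cm w).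
Proof.
move=> L0; set z := L%:C * w.
have zE : L * cm w = cm z by rewrite cmM cm_real ger0_norm.
have -> : N L w = (cexp z - 1 - z - z ^+ 2 / 2) - (cexp (- z) - 1 - (- z) - (- z) ^+ 2 / 2).
  by rewrite /N -/z sqrrN; ring.
apply: le_trans (cmB _ _) _.
have := cexp3_bound z; have := cexp3_bound (- z); rewrite cmN -zE; lra.
Qed.

Lemma N1_bound L w : 0 <= L -> cm (N1 L w) <= 2 * L * (L * cm w) ^+ 2 * expR (L * cm w).
Proof.
move=> L0; set z := L%:C * w.
have zE : L * cm w = cm z by rewrite cmM cm_real ger0_norm.
rewrite /N1 -/z cmM cm_real ger0_norm//.
have -> : cexp z + cexp (- z) - 2 = (cexp z - 1 - z) + (cexp (- z) - 1 - (- z)) by ring.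
have -> : 2 * L * (L * cm w) ^+ 2 * expR (L * cm w) =
  L * (2 * (L * cm w) ^+ 2 * expR (L * cm w)) by ring.
apply: ler_wpM2l => //; apply: le_trans (cmD _ _) _.
have := cexp2_bound z; have := cexp2_bound (- z); rewrite cmN -zE; lra.
Qed.

Lemma S_axis L v : 0 < v -> re (S L (0 +i* v)) = 0.
Proof.
move=> v0; have E : (0 +i* v : C) ^- 2 = (- (v ^- 2))%:C.
  rewrite rmorphN/= -[(v ^- 2)%:C]/((v ^+ 2)^-1)%:C.
  have -> : (0 +i* v : C) ^+ 2 = (- v ^+ 2)%:C by apply: complex_ext; rewrite /=; ring.
  by rewrite -rmorphV ?unitfE ?oppr_eq0 ?expf_neq0 ?gt_eqF//= invrN rmorphN.
rewrite /S E mulrC (reZ (- v ^- 2)) /N; set z := L%:C * _.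
have z0 : re z = 0 by rewrite /z reM /=; ring.
rewrite !reB !re_cexp reN imN cosN z0 oppr0 subrr sub0r.
by rewrite -(rmorph_nat (real_complex R)) (reZ 2) z0 mulr0 oppr0 mulr0.
Qed.

(** For v > 0 the real part vanishes at the foot i v of the horizontal segment, so it is at most s
    times a bound for S'; the two terms of S' give 2 + 4 = 6. *)
Lemma S_bound L (s v T : R) : 0 <= L -> 0 < s -> s <= 1 -> 0 <= v <= T ->
  `|re (S L (s +i* v))| <= 6 * L ^+ 3 * expR (L * (1 + T)) * s.
Proof.
move=> L0 s0 s1 /andP[v0 vT].
have L3 : 0 <= L ^+ 3 by rewrite exprn_ge0.
have E3 (w : C) : cm w <= 1 + T -> expR (L * cm w) <= expR (L * (1 + T)).
  by move=> wT; rewrite ler_expR ler_wpM2l.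
set E := expR (L * (1 + T)) in E3 *; have E0 : 0 <= E := expR_ge0 _.
(* At v = 0 the segment would start at the point 0, where S is not given by its regular
   continuation; there the cubic bound on N is used directly. *)
have [v00|vn0] := eqVneq v 0.
  rewrite v00; have -> : (s +i* 0 : C) = s%:C by [].
  apply: le_trans (cm_re _) _; rewrite /S cmM cmV cmX cm_real (gtr0_norm s0).
  apply: (@le_trans _ _ (2 * (L * s) ^+ 3 * E / s ^+ 2)).
    rewrite ler_wpM2r ?invr_ge0 ?sqr_ge0//; apply: le_trans (N_bound _ L0) _.
    rewrite cm_real (gtr0_norm s0) ler_wpM2l ?mulr_ge0 ?exprn_ge0 ?mulr_ge0 ?(ltW s0)//.
    by have := E3 s%:C; rewrite cm_real (gtr0_norm s0); apply; lra.
  have -> : 2 * (L * s) ^+ 3 * E / s ^+ 2 = 2 * (L ^+ 3 * E * s) by field; rewrite gt_eqF.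
  have -> : 6 * L ^+ 3 * E * s = 6 * (L ^+ 3 * E * s) by ring.
  by rewrite ler_wpM2r ?mulr_ge0 ?(ltW s0)// ler_nat.
have {vn0}v0 : 0 < v by rewrite lt0r vn0.
pose S1 w : C := N1 L w * w ^- 2 + N L w * (- (w ^+ 2) ^- 2 * (2%:R * w ^+ 1 * 1)).
have dS w : w != 0 -> cderiv (S L) w (S1 w).
  move=> w0; apply: cdM; last first.
    by apply: cdV; [rewrite expf_neq0|apply: cdX; exact: cdid].
  have dz : cderiv (fun w => L%:C * w) w (L%:C * 1) by apply: cdZ; exact: cdid.
  have dz2 : cderiv (fun w => 2 * (L%:C * w)) w (2 * (L%:C * 1)) by exact: cdZ.
  apply: cd_eq (cdB (cdB (cdexp dz) (cdexp (cdN dz))) dz2) _.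
  by rewrite /N1; ring.
have -> : re (S L (s +i* v)) = re (S L ((0 +i* v) + s%:C) - S L (0 +i* v)).
  rewrite reB S_axis// subr0; congr (re (S L _)).
  by apply: complex_ext; rewrite /= ?add0r ?addr0.
apply: le_trans (cm_re _) _; rewrite -{2}(gtr0_norm s0) -(cm_real s).
have pt (t : R) : (0 +i* v) + t%:C * s%:C = (t * s) +i* v :> C.
  by apply: complex_ext; rewrite /=; ring.
have nz (t : R) : ((t * s) +i* v : C) != 0.
  by rewrite -cm_gt0; apply: lt_le_trans v0 (cm_ge_im _ (ltW v0)).
apply: (@mvt_cderiv _ (S L) S1) => t /andP[t0 t1]; rewrite pt; first exact: dS.
set w : C := _ +i* _.
have w0 : 0 < cm w by rewrite cm_gt0; exact: nz.
have wT : cm w <= 1 + T.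
  apply: le_trans (cm_reim _) _; rewrite /= !ger0_norm ?mulr_ge0 ?(ltW s0) ?(ltW v0)//.
  by rewrite lerD// mulr_ile1// ltW.
rewrite /S1; apply: le_trans (cmD _ _) _.
have -> : w ^+ 1 = w by [].
have A1 : cm (N1 L w * w ^- 2) <= 2 * L ^+ 3 * E.
  rewrite cmM cmV cmX.
  have -> : 2 * L ^+ 3 * E = 2 * L * (L * cm w) ^+ 2 * E / cm w ^+ 2.
    by field; rewrite gt_eqF.
  rewrite ler_wpM2r ?invr_ge0 ?sqr_ge0//; apply: le_trans (N1_bound _ L0) _.
  by apply: ler_wpM2l (E3 _ wT); rewrite !mulr_ge0 ?sqr_ge0 ?(ltW w0).
have A2 : cm (N L w * (- (w ^+ 2) ^- 2 * (2%:R * w * 1))) <= 4 * L ^+ 3 * E.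
  rewrite cmM (cmM (- (w ^+ 2) ^- 2)) cmN cmV cmX cmX mulr1 cmM cm_nat.
  have -> : 4 * L ^+ 3 * E = 2 * (L * cm w) ^+ 3 * E * ((cm w ^+ 2) ^- 2 * (2 * cm w)).
    by field; rewrite gt_eqF.
  rewrite ler_wpM2r ?mulr_ge0 ?invr_ge0 ?exprn_ge0 ?(ltW w0)//; apply: le_trans (N_bound _ L0) _.
  by apply: ler_wpM2l (E3 _ wT); rewrite mulr_ge0 ?exprn_ge0 ?mulr_ge0 ?(ltW w0).
lra.
Qed.

Lemma inv_vertical s T : 0 < s -> 0 <= T ->
  iint (fun v => re ((s +i* v : C)^-1)) T = atan (T / s).
Proof.
move=> s0 T0.
have H : hol2 0 (fun w : C => w^-1).
  by apply: hol2V (hol2id 0) _ => z z0; rewrite cm_ge_re// gt_eqF.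
have d v : 0 <= v <= T -> is_derive v 1 (fun v : R => atan (v / s)) (re ((s +i* v : C)^-1)).
  move=> _; have dv : is_derive v 1 (fun v : R => v / s) s^-1.
    by apply: (rd_eq (rdM (rdid _) (rdc _ _))); ring.
  apply: (rd_eq (rd_comp dv (is_derive1_atan _))) => /=.
  field.
  have := sqr_ge0 v; have : 0 < s ^+ 2 by rewrite exprn_gt0.
  by move=> *; apply/andP; split; apply/eqP; lra.
by rewrite (iintE (hol2_cont H s0) T0 d) mul0r atan0 subr0.
Qed.

(** The residue at 0 by hand. Up to [pker_neg] the kernel may be replaced by [pker L - pker (-L)],
    which is S + 2L/w. Moved to a small abscissa s', S contributes O(s') and 2L/w contributes 2L
    atan(T/s'), close to pi L. *)
Lemma pker_main L s T : 0 <= L -> 0 < s -> s <= T -> 1 <= T ->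
  `|iint (fun v => re (pker L (s +i* v))) T - pi * L| <=
    (2 + s * (expR (L * s) + 1)) / T.
Proof.
move=> L0 s0 sT T1; have T0 : 0 < T by lra.
have Hn := pker_neg L0 s0 sT.
have HD := hol2D (hol2_pker L) (hol2M (hol2c 0 (-1)) (hol2_pker (- L))).
pose D w := pker L w + -1 * pker (- L) w.
have Dc x : 0 < x -> continuous (fun v => re (D (x +i* v))) by exact: hol2_cont HD.
have DE x : 0 < x -> iint (fun v => re (D (x +i* v))) T =
    iint (fun v => re (pker L (x +i* v))) T - iint (fun v => re (pker (- L) (x +i* v))) T.
  move=> x0; have c1 := hol2_cont (hol2_pker L) x0; have c2 := hol2_cont (hol2_pker (- L)) x0.
  have -> : iint (fun v => re (pker L (x +i* v))) T - iint (fun v => re (pker (- L) (x +i* v))) T =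
      iint (fun v => re (pker L (x +i* v)) + -1 * re (pker (- L) (x +i* v))) T.
    by rewrite (iintD c1 (continuous_cM c2) (ltW T0)) (iintZ _ c2 (ltW T0)) mulN1r.
  by congr iint; apply/funext => v; rewrite /D reD mulN1r reN mulN1r.
have T2 : (T ^+ 2)^-1 <= T^-1.
  by rewrite lef_pV2 ?posrE ?exprn_gt0// expr2 ler_peMl// ltW.
suff main (e : R) : 0 < e ->
    `|iint (fun v => re (D (s +i* v))) T - pi * L| <= e + s * (expR (L * s) + 1) / T.
  have {}main : `|iint (fun v => re (D (s +i* v))) T - pi * L| <= s * (expR (L * s) + 1) / T.
    by apply/ler_addgt0Pl.
  rewrite DE// in main; move: main Hn.
  have -> : (2 + s * (expR (L * s) + 1)) / T = 2 / T + s * (expR (L * s) + 1) / T by ring.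
  set a := iint _ _; set b := iint _ _; set q := 2 / T; set r := s * _ / T.
  by rewrite !ler_norml => /andP[? ?] /andP[? ?]; apply/andP; split; lra.
move=> e0.
pose K : R := 6 * L ^+ 3 * expR (L * (1 + T)).
have K0 : 0 <= K by rewrite !mulr_ge0 ?exprn_ge0 ?expR_ge0.
have [M [_ HM]] : \forall y \near +oo, `|pi / 2 - atan y| <= e / (4 * L + 1) :> R.
  by move/cvgrPdist_le : (@cvgy_atan R); apply; rewrite divr_gt0// ltr_wpDl// mulr_ge0.
pose M1 := `|M| + 1; have M10 : 0 < M1 by rewrite ltr_wpDl.
(* The entries allow the shift from s, the use of [S_bound], an argument T/s' beyond the threshold
   of atan, and a contribution of S below e/2. *)
pose s' := Num.min (Num.min s 1) (Num.min (T / M1) (e / (2 * (K * T + 1)))).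
have KT : 0 < 2 * (K * T + 1) by rewrite mulr_gt0// ltr_wpDl// mulr_ge0// ltW.
have s'0 : 0 < s' by rewrite !lt_min s0 ltr01 !divr_gt0.
have s's : s' <= s by rewrite !ge_min lexx.
have s'1 : s' <= 1 by rewrite !ge_min lexx !orbT.
have s'T : s' <= T / M1 by rewrite !ge_min lexx !orbT.
have s'e : s' <= e / (2 * (K * T + 1)) by rewrite !ge_min lexx !orbT.
have B1 : `|iint (fun v => re (D (s +i* v))) T - iint (fun v => re (D (s' +i* v))) T| <=
    (expR (L * s) + 1) / T * s.
  apply: (@le_trans _ _ ((expR (L * s) + 1) / T * (s - s'))); last first.
    by rewrite ler_wpM2l ?gerBl ?(ltW s'0)// divr_ge0 ?addr_ge0 ?expR_ge0// ltW.
  apply: (hol2_shift HD (ltW T0) s'0 s's).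
    move=> x _; apply: im0_D; first exact: pker_real.
    by apply: im0_M; [rewrite imN im1 oppr0|exact: pker_real].
  move=> x /andP[sx xs]; have x0 : 0 < x := lt_le_trans s'0 sx.
  rewrite mulN1r; apply: le_trans (cmB _ _) _; rewrite !cm_pker -mulrDl.
  apply: ler_pM; rewrite ?addr_ge0 ?expR_ge0 ?invr_ge0 ?sqr_ge0//.
    apply: lerD; rewrite ?ler_expR ?ler_wpM2l//.
    by rewrite -expR0 ler_expR mulNr oppr_le0 mulr_ge0// ltW.
  apply: le_trans T2; rewrite lef_pV2 ?posrE ?exprn_gt0//; last first.
    by apply: lt_le_trans x0 (cm_ge_rec _ (ltW x0)).
  by rewrite lerXn2r ?nnegrE ?cm_ge0 ?cm_ge_im ?(ltW T0).
have cS : continuous (fun v => re (S L (s' +i* v))).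
  apply: (hol2_cont (lo := 0)) => //; apply: hol2M hol2_inv2.
  have -> : N L = fun w => cexp (L%:C * w) + -1 * cexp ((- L%:C) * w) + - 2 * L%:C * w.
    by apply/funext => w; rewrite /N (mulNr L%:C w); ring.
  apply: hol2D; last exact: hol2M (hol2c _ _) (hol2id _).
  by apply: hol2D; [exact: hol2_exp|apply: hol2M; [exact: hol2c|exact: hol2_exp]].
have cI : continuous (fun v => re ((s' +i* v : C)^-1)).
  apply: (hol2_cont (lo := 0)) => //.
  by apply: hol2V (hol2id 0) _ => z z0; rewrite cm_ge_re// gt_eqF.
have E : iint (fun v => re (D (s' +i* v))) T =
    iint (fun v => re (S L (s' +i* v))) T + 2 * L * atan (T / s').
  rewrite -(inv_vertical s'0 (ltW T0)) -(iintZ _ cI (ltW T0)) -(iintD cS (continuous_cM cI) (ltW T0)).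
  congr iint; apply/funext => v; rewrite /D mulN1r.
  have w0 : (s' +i* v : C) != 0 by rewrite cm_ge_re// gt_eqF.
  rewrite -(reZ (2 * L)) -reD; congr re; set w : C := _ +i* _ in w0 *.
  rewrite /pker /S /N rmorphM/= rmorph_nat rmorphN mulNr; field.
  exact: w0.
have B2 : `|iint (fun v => re (S L (s' +i* v))) T| <= e / 2.
  apply: (@le_trans _ _ (K * s' * T)).
    apply: iint_bound cS (ltW T0) _ => v v0T.
    exact: S_bound.
  apply: (@le_trans _ _ ((K * T + 1) * s')).
    have -> : K * s' * T = K * T * s' by ring.
    by rewrite ler_wpM2r ?(ltW s'0)// lerDl.
  have := ler_wpM2l (ltW KT) s'e; rewrite mulrC [_ * (e / _)]mulrC divfK ?gt_eqF//; lra.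
have B3 : `|2 * L * atan (T / s') - pi * L| <= e / 2.
  have yM : M < T / s'.
    apply: (@lt_le_trans _ _ M1); first by rewrite /M1 ltr_pwDr// ler_norm.
    by rewrite ler_pdivlMr// mulrC -ler_pdivlMr.
  have := HM _ yM; set y := atan _ => Hy.
  have -> : 2 * L * y - pi * L = - (2 * L * (pi / 2 - y)) by field.
  rewrite normrN normrM ger0_norm ?mulr_ge0//.
  apply: le_trans (ler_wpM2l _ Hy) _; first by rewrite mulr_ge0.
  have -> : 2 * L * (e / (4 * L + 1)) = e / 2 * (4 * L / (4 * L + 1)).
    by field; rewrite gt_eqF// ltr_wpDl// mulr_ge0.
  rewrite ler_piMr ?divr_ge0 ?(ltW e0)//.
  by rewrite ler_pdivrMr ?mul1r ?lerDl// ltr_wpDl// mulr_ge0.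
rewrite E in B1; move: B1 B2 B3.
have -> : (expR (L * s) + 1) / T * s = s * (expR (L * s) + 1) / T by ring.
set a := iint _ _; set b := iint _ _; set q := s * _ / T; set r := 2 * L * _.
by rewrite !ler_norml => /andP[? ?] /andP[? ?] /andP[? ?]; apply/andP; split; lra.
Qed.

End PerronKernel.

(** * Perron's formula for 1/zeta on a line right of 1/2 *)

Section MoebiusLogMean.
Context {R : realType}.
Local Notation C := R[i].
Implicit Types (z w : C) (L s x v T : R).

Lemma hol2_le (lo lo' : R) (f : C -> C) : lo <= lo' -> hol2 lo f -> hol2 lo' f.
Proof. by move=> l [f1 [f2 H]]; exists f1, f2 => z /(le_lt_trans l); exact: H. Qed.

Lemma hol2_natcpow (lo : R) n : hol2 lo (fun w : C => natcpow n (- w)).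
Proof.
have -> : (fun w : C => natcpow n (- w)) = (fun w => cexp ((- (ln n%:R)%:C) * w)).
  by apply/funext => w; rewrite natcpowE; congr cexp; ring.
exact: hol2_exp.
Qed.

Lemma hol2_zetaZ : hol2 0 (zetaZ 0 : C -> C).
Proof. by exists (zetaZ 1), (zetaZ 2) => z z0; split; exact: cd_zetaZ. Qed.

Lemma im_natcpow_real n x : im (natcpow n (- (x +i* 0)) : C) = 0.
Proof. by apply: im0_exp; apply: im0_M; rewrite //= oppr0. Qed.

Lemma im_climit (u : nat -> C) l : climit u l -> (forall n, im (u n) = 0) -> im l = 0.
Proof.
move=> H u0; apply/eqP; rewrite -normr_eq0 eq_le normr_ge0 andbT.
apply/ler_addgt0Pl => e e0; have [N /(_ N (leqnn _))] := H e e0.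
by move=> /(le_trans (cm_im _)); rewrite imB u0 sub0r normrN addr0.
Qed.

Lemma im_sum0 (I : Type) (r : seq I) (F : I -> C) : (forall i, im (F i) = 0) ->
  im (\sum_(i <- r) F i) = 0.
Proof. by move=> F0; rewrite im_sum big1. Qed.

Lemma zetaZ_real x : 0 < x -> im (zetaZ 0 (x +i* 0 : C)) = 0.
Proof.
move=> x0; rewrite /zetaZ imD im1 add0r; have H := @zterm_csums R 0 (x +i* 0) x0; apply: (im_climit H) => n.
have i1 : im (1 - (x +i* 0) : C) = 0 by rewrite imB im1 subr0.
have g (y : R) : im (zG 0 (x +i* 0) y%:C) = 0.
  by rewrite /zG expr0 mul1r; apply: im0_exp; apply: im0_M.
apply: im_sum0 => i; rewrite /zterm !imB !g subr0 sub0r /zG1 expr0 mul0r subr0 mulr1.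
rewrite im0_M ?oppr0//; apply: im0_exp; apply: im0_M => //.
by rewrite imN /= oppr0.
Qed.

Lemma invzeta_real x : 0 < x -> im (invzeta (x +i* 0 : C)) = 0.
Proof.
move=> x0; apply: im0_M; first by rewrite imB im1 subr0.
by apply: im0_V; exact: zetaZ_real.
Qed.

Hypothesis RH : generalized_riemann_hypothesis R.

Lemma hol2_invzeta : hol2 (2^-1 : R) (@invzeta R).
Proof.
apply: hol2M; first by apply: hol2D; [exact: hol2id|exact: hol2c].
apply: hol2V; last by move=> z; exact: zetaZ_neq0.
by apply: hol2_le hol2_zetaZ; rewrite invr_ge0.
Qed.

Lemma pker_natcpow L (m : nat) w :
  pker L w * natcpow m (- w) = pker (L - ln m%:R) w.
Proof.
rewrite /pker natcpowE mulrAC -cexpD; congr (cexp _ * _).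
by rewrite rmorphB/=; ring.
Qed.

Definition psum (M : nat) w : C := \sum_(1 <= m < M.+1) (moebius m)%:~R * natcpow m (- w).

(** In the tail ln m >= L, so e^(LB) m^(-B) <= e^(2L) m^(-2) for every B >= 2: the bound does not
    grow as the line moves right. *)
Lemma tail_bound L (M : nat) (B v : R) : 2 <= B ->
  (forall m, (M < m)%N -> L <= ln m%:R) ->
  expR (L * B) * cm (invzeta (B +i* v) - psum M (B +i* v)) <= 2 * expR (2 * L).
Proof.
move=> B2 HM; set w : C := B +i* v.
have w1 : 1 < re w by rewrite /=; lra.
pose u i : C := (moebius i.+1)%:~R * natcpow i.+1 (- w).
have H : climit (fun N => \sum_(0 <= i < N) u i + - psum M w) (invzeta w - psum M w).
  by rewrite invzeta_moebius//; apply: climitD (moebius_series_csums w1) (climit_const _).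
have H2 : climit (fun n => (expR (L * B))%:C * (\sum_(0 <= i < M + n) u i - psum M w))
    ((expR (L * B))%:C * (invzeta w - psum M w)).
  apply: climit_cM => e e0; have [N HN] := H e e0; exists N => n Nn.
  by apply: HN; apply: leq_trans Nn _; rewrite leq_addl.
have := climit_bound H2 (B := 2 * expR (2 * L)).
rewrite cmM cm_real ger0_norm ?expR_ge0//; apply => n.
have -> : \sum_(0 <= i < M + n) u i - psum M w = \sum_(M <= i < M + n) u i.
  rewrite (big_cat_nat (leq0n M) (leq_addr n M))/= /psum big_add1 /=.
  by rewrite [X in X + _ - _](_ : _ = \sum_(0 <= i < M) u i)// addrAC subrr add0r.
rewrite cmM cm_real ger0_norm ?expR_ge0//.
apply: (@le_trans _ _ (\sum_(M <= i < M + n) (expR (2 * L) * expR (- ((1 + 1) * ln i.+1%:R))))); last first.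
  rewrite -mulr_sumr mulrC ler_wpM2r ?expR_ge0//.
  have := sum_powers (M + n) (@ltr01 R); rewrite invr1.
  rewrite (big_cat_nat (leq0n M) (leq_addr n M))/=.
  have : 0 <= \sum_(0 <= i < M) expR (- ((1 + 1) * ln i.+1%:R)) :> R by apply: sumr_ge0 => i _; exact: expR_ge0.
  lra.
apply: le_trans (ler_wpM2l (expR_ge0 _) (cm_sum _ _ _)) _.
rewrite mulr_sumr; apply: ler_sum_nat => i /andP[Mi _].
rewrite /u cmM mulrA; apply: (@le_trans _ _ (expR (L * B) * 1 * cm (natcpow i.+1 (- w)))).
  by rewrite ler_wpM2r ?cm_ge0// ler_wpM2l ?expR_ge0 ?cm_moebius.
rewrite mulr1 cm_natcpow -!expRD ler_expR reN /=.
have Li := HM i.+1 Mi.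
have : (B - 2) * L <= (B - 2) * ln i.+1%:R by rewrite ler_wpM2l// subr_ge0.
lra.
Qed.

Lemma psum_bound (M : nat) w : 0 <= re w -> cm (psum M w) <= M%:R.
Proof.
move=> w0; apply: le_trans (cm_sum _ _ _) _.
apply: (@le_trans _ _ (\sum_(1 <= m < M.+1) 1)); last first.
  by rewrite big_const_nat subn1 /= iter_addr addr0.
apply: ler_sum_nat => m /andP[m0 _]; rewrite cmM mulr_ile1 ?cm_ge0 ?cm_moebius//.
rewrite cm_natcpow reN mulNr -[leRHS]expR0 ler_expR oppr_le0; apply: mulr_ge0 => //.
by apply: ln_ge0; rewrite ler1n.
Qed.

(** Split 1/zeta into its terms m <= M and the rest. The finite part is evaluated by [pker_main].
    For the rest the line moves from s to a large abscissa B, where [tail_bound] and the integral of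
    1/|w|^2 give O(1/B). *)
Lemma moebius_log_limit s L (M : nat) : 2^-1 < s <= 2 -> 0 <= L ->
  (forall m, (0 < m <= M)%N -> ln m%:R <= L) ->
  (forall m, (M < m)%N -> L <= ln m%:R) ->
  forall e : R, 0 < e -> exists T0 : R, forall T, T0 <= T ->
  `|iint (fun v => re (pker L (s +i* v) * invzeta (s +i* v))) T -
    pi * \sum_(1 <= m < M.+1) (moebius m)%:~R * (L - ln m%:R)| <= e.
Proof.
move=> /andP[s12 s2] L0 HM1 HM2 e e0.
have h2 : 0 < 2^-1 :> R by rewrite invr_gt0.
have s0 : 0 < s by exact: lt_trans s12.
pose f w := pker L w * (invzeta w + -1 * psum M w).
have Hp : hol2 (2^-1 : R) (psum M).
  by apply: hol2_sum => i; apply: hol2M; [exact: hol2c|exact: hol2_natcpow].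
have Hk : hol2 2^-1 (pker L) by apply: hol2_le (hol2_pker L); rewrite ltW.
have Hf : hol2 2^-1 f.
  by apply: hol2M => //; apply: hol2D; [exact: hol2_invzeta|apply: hol2M => //; exact: hol2c].
pose eta := Num.min ((s - 2^-1) / 3) 8^-1.
have eta0 : 0 < eta by rewrite lt_min divr_gt0 ?subr_gt0//= invr_gt0.
have eta8 : eta <= 8^-1 by rewrite ge_min lexx orbT.
have etas : 2^-1 + 3 * eta <= s.
  have : eta <= (s - 2^-1) / 3 by rewrite ge_min lexx.
  lra.
(* Linear growth of 1/zeta is enough here: against |w|^(-2) it leaves O(1/T) on the top edge. *)
have [K K0 HK] := invzeta_growth RH eta0 eta8 (@ltr01 R).
pose B := Num.max 2 (2 * (pi * expR (2 * L)) / e).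
have B2 : 2 <= B by rewrite le_max lexx.
have B0 : 0 < B by lra.
have Be : pi * expR (2 * L) / B <= e / 2.
  have : 2 * (pi * expR (2 * L)) / e <= B by rewrite le_max lexx orbT.
  rewrite ler_pdivrMr// => H; rewrite ler_pdivrMr//; lra.
pose c1 := expR (L * B) * (5 * K + M%:R) * B.
pose Cm m : R := 2 + s * (expR ((L - ln m%:R) * s) + 1).
have Cm0 m : 0 <= Cm m by rewrite addr_ge0// mulr_ge0 ?(ltW s0)// addr_ge0// expR_ge0.
pose c2 := \sum_(1 <= m < M.+1) Cm m.
have c10 : 0 <= c1.
  by rewrite !mulr_ge0 ?expR_ge0 ?(ltW B0)// addr_ge0// mulr_ge0// ltW.
have c20 : 0 <= c2 by apply: sumr_ge0 => m _; exact: Cm0.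
exists (Num.max 2 (2 * (c1 + c2) / e)) => T; rewrite ge_max => /andP[T2 Te].
have T0 : 0 < T by lra.
have ce : (c1 + c2) / T <= e / 2.
  by move: Te; rewrite ler_pdivrMr// => H; rewrite ler_pdivrMr//; lra.
have F1 : `|iint (fun v => re (f (B +i* v))) T - iint (fun v => re (f (s +i* v))) T| <=
    c1 / T.
  have sB : s <= B by lra.
  apply: (@le_trans _ _ (expR (L * B) * (5 * K + M%:R) / T * (B - s))); last first.
    have -> : c1 / T = expR (L * B) * (5 * K + M%:R) / T * B by rewrite /c1; ring.
    rewrite ler_wpM2l ?gerBl ?(ltW s0)// !mulr_ge0 ?expR_ge0 ?invr_ge0 ?(ltW T0)//.
    by rewrite addr_ge0// mulr_ge0// ltW.
  apply: (hol2_shift Hf (ltW T0) s12 sB).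
    move=> x /andP[sx _]; have x0 := lt_le_trans s0 sx; apply: im0_M; first exact: pker_real.
    apply: im0_D; first exact: invzeta_real.
    apply: im0_M; first by rewrite imN im1 oppr0.
    apply: im_sum0 => m; apply: im0_M; last exact: im_natcpow_real.
    by rewrite -(rmorph_int (real_complex R)).
  move=> x /andP[sx xB]; have x0 := lt_le_trans s0 sx.
  rewrite /f mulN1r cmM cm_pker.
  have A1 : cm (invzeta (x +i* T) - psum M (x +i* T)) <= K * (4 + T) + M%:R.
    apply: le_trans (cmB _ _) _; apply: lerD; last by apply: psum_bound; rewrite /= ltW.
    have := HK (x +i* T) (le_trans etas sx); rewrite mul1r expR_ht /= ger0_norm ?(ltW T0)//.
  have A2 : K * (4 + T) + M%:R <= (5 * K + M%:R) * T.
    have : K * 4 <= K * (4 * T) by rewrite ler_wpM2l ?(ltW K0)//; lra.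
    have : M%:R * 1 <= M%:R * T by rewrite ler_wpM2l//; lra.
    lra.
  have A3 : expR (L * x) <= expR (L * B) by rewrite ler_expR ler_wpM2l.
  have A4 : (cm (x +i* T : C) ^+ 2)^-1 <= (T ^+ 2)^-1.
    rewrite lef_pV2 ?posrE ?exprn_gt0//; last by apply: lt_le_trans x0 (cm_ge_rec _ (ltW x0)).
    by rewrite lerXn2r ?nnegrE ?cm_ge0 ?cm_ge_im ?(ltW T0).
  have -> : expR (L * B) * (5 * K + M%:R) / T =
    expR (L * B) / T ^+ 2 * ((5 * K + M%:R) * T) by field; rewrite gt_eqF.
  apply: ler_pM; rewrite ?cm_ge0 ?mulr_ge0 ?expR_ge0 ?invr_ge0 ?sqr_ge0//.
    by apply: ler_pM; rewrite ?expR_ge0 ?invr_ge0 ?sqr_ge0.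
  exact: le_trans A1 A2.
have F2 : `|iint (fun v => re (f (B +i* v))) T| <= e / 2.
  have hI : hol2 0 (fun w : C => w^-1).
    by apply: hol2V (hol2id 0) _ => z z0; rewrite cm_ge_re// gt_eqF.
  have cI := hol2_cont hI B0.
  apply: le_trans Be.
  apply: (@le_trans _ _ (2 * expR (2 * L) / B * atan (T / B))); last first.
    have -> : pi * expR (2 * L) / B = 2 * expR (2 * L) / B * (pi / 2) by field; rewrite gt_eqF.
    rewrite ler_wpM2l ?(ltW (atan_ltpi2 _))// !mulr_ge0 ?expR_ge0 ?invr_ge0// ltW//.
  rewrite -(inv_vertical B0 (ltW T0)) -(iintZ _ cI (ltW T0)).
  apply: iint_abs; [|exact: continuous_cM|exact: ltW|].
    by apply: hol2_cont Hf _; lra.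
  move=> v _; apply: le_trans (cm_re _) _.
  rewrite /f mulN1r cmM cm_pker /=.
  have tb := tail_bound v B2 HM2.
  have -> : expR (L * B) / cm (B +i* v : C) ^+ 2 * cm (invzeta (B +i* v) - psum M (B +i* v)) =
    expR (L * B) * cm (invzeta (B +i* v) - psum M (B +i* v)) / cm (B +i* v : C) ^+ 2 by ring.
  have -> : 2 * expR (2 * L) / B * (B / (B ^+ 2 + v ^+ 2)) =
     2 * expR (2 * L) / cm (B +i* v : C) ^+ 2.
    have n1 : B ^+ 2 + v ^+ 2 != 0 by rewrite gt_eqF// ltr_pwDl ?exprn_gt0 ?sqr_ge0.
    have n2 : B != 0 by rewrite gt_eqF.
    by rewrite cm_sqr /=; field; rewrite ?n1 ?n2.
  by rewrite ler_wpM2r// invr_ge0 sqr_ge0.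
have F3 : iint (fun v => re (pker L (s +i* v) * invzeta (s +i* v))) T =
    iint (fun v => re (f (s +i* v))) T +
    \sum_(1 <= m < M.+1) (moebius m)%:~R * iint (fun v => re (pker (L - ln m%:R) (s +i* v))) T.
  have cf := hol2_cont Hf s12.
  have ck m := hol2_cont (hol2_pker (L - ln (m%:R : R))) s0.
  rewrite (eq_bigr (fun m => iint (fun v => (moebius m)%:~R * re (pker (L - ln m%:R) (s +i* v))) T)); last first.
    by move=> m _; rewrite (iintZ _ (ck m) (ltW T0)).
  have cs m := continuous_cM (c := (moebius m)%:~R) (ck m).
  rewrite -(iint_sum _ _ cs (ltW T0)) -iintD ?(ltW T0)//; last first.
    have -> : (fun v => \sum_(1 <= m < M.+1) (moebius m)%:~R * re (pker (L - ln m%:R) (s +i* v))) =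
       (fun v => re (pker L (s +i* v) * psum M (s +i* v))).
      apply/funext => v; rewrite /psum mulr_sumr re_sum; apply: eq_bigr => m _.
      by rewrite mulrCA pker_natcpow -(rmorph_int (real_complex R)) (reZ (moebius m)%:~R).
    exact: (hol2_cont (hol2M Hk Hp) s12).
  congr iint; apply/funext => v.
  have -> : \sum_(1 <= m < M.+1) (moebius m)%:~R * re (pker (L - ln m%:R) (s +i* v)) =
     re (pker L (s +i* v) * psum M (s +i* v)).
    rewrite /psum mulr_sumr re_sum; apply: eq_bigr => m _.
    by rewrite mulrCA pker_natcpow -(rmorph_int (real_complex R)) (reZ (moebius m)%:~R).
  by rewrite -reD /f; congr re; ring.
have F4 : `|\sum_(1 <= m < M.+1) (moebius m)%:~R * iint (fun v => re (pker (L - ln m%:R) (s +i* v))) T -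
   pi * \sum_(1 <= m < M.+1) (moebius m)%:~R * (L - ln m%:R)| <= c2 / T.
  rewrite mulr_sumr -sumrB; apply: le_trans (ler_norm_sum _ _ _) _.
  rewrite /c2 mulr_suml; apply: ler_sum_nat => m mM.
  have -> : (moebius m)%:~R * iint (fun v => re (pker (L - ln m%:R) (s +i* v))) T -
     pi * ((moebius m)%:~R * (L - ln m%:R)) = (moebius m)%:~R *
     (iint (fun v => re (pker (L - ln m%:R) (s +i* v))) T - pi * (L - ln m%:R)) by ring.
  rewrite normrM -[leRHS]mul1r; apply: ler_pM; rewrite ?normr_ge0//.
    by rewrite -intr_norm -[leRHS](mulr1z (1 : R)) ler_int moebius_norm.
  by apply: pker_main => //; [rewrite subr_ge0 HM1//; move: mM; rewrite ltnS|lra|lra].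
have tri (a1 a2 b1 b2 x y z : R) : `|a1 - a2| <= x -> `|a1| <= y -> `|b1 - b2| <= z ->
    x + z <= e - y -> `|a2 + b1 - b2| <= e.
  by rewrite !ler_norml => /andP[? ?] /andP[? ?] /andP[? ?] ?; apply/andP; split; lra.
rewrite F3; apply: tri F1 F2 F4 _; rewrite -mulrDl; lra.
Qed.

End MoebiusLogMean.

(** * Mean squares of Dirichlet polynomials *)

Section OscillatingMean.
Context {R : realType}.
Implicit Types (m v x y : R).

(** Integration by parts: the amplitudes vary by O(m) over [0, T], so the remainder has the order of
    the boundary terms. The constant is 2 + 2 for the two ends and 4 for the remainder. *)
Lemma osc_pair (a b da db : R -> R) (l T m : R) : 0 < T -> l != 0 ->
  (forall v, is_derive v 1 a (da v)) -> (forall v, is_derive v 1 b (db v)) ->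
  (forall v, 0 <= v <= T -> [/\ `|a v| <= m, `|b v| <= m, T * `|da v| <= 2 * m &
     T * `|db v| <= 2 * m]) ->
  `|iint (fun v => a v * cos (l * v) + b v * sin (l * v)) T| <= 8 * m / `|l|.
Proof.
move=> T0 l0 ad bd H.
have la0 : 0 < `|l| by rewrite normr_gt0.
pose g v := (a v * sin (l * v) + - (b v * cos (l * v))) * l^-1.
pose r v := (da v * sin (l * v) - db v * cos (l * v)) * l^-1.
have gd v : is_derive v 1 g (a v * cos (l * v) + b v * sin (l * v) + r v).
  have av := ad v; have bv := bd v; rewrite /g; eapply rd_eq; [rder|cbv beta].
  by rewrite /r; field.
have fc : continuous (fun v => a v * cos (l * v) + b v * sin (l * v)).
  move=> v; have av := ad v; have bv := bd v.
  eapply (@rd_cont R _ v); rder.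
have cs v : `|cos (l * v)| <= 1 by exact: cos_max.
have sn v : `|sin (l * v)| <= 1 by exact: sin_max.
have lin (c1 c2 n x y : R) : `|c1| <= n -> `|c2| <= n -> `|x| <= 1 -> `|y| <= 1 ->
    `|c1 * x - c2 * y| <= 2 * n.
  move=> h1 h2 hx hy; apply: le_trans (ler_normB _ _) _; rewrite !normrM.
  have n0 : 0 <= n := le_trans (normr_ge0 _) h1.
  have k1 : `|c1| * `|x| <= n * 1 by apply: ler_pM.
  have k2 : `|c2| * `|y| <= n * 1 by apply: ler_pM.
  lra.
have gb v : 0 <= v <= T -> `|g v| <= 2 * m / `|l|.
  move=> vT; have [h1 h2 _ _] := H v vT.
  rewrite /g normrM normfV ler_wpM2r ?invr_ge0//; exact: lin.
have rb v : 0 <= v <= T -> `|- r v| <= 4 * m / `|l| / T.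
  move=> vT; have [_ _ h1 h2] := H v vT; rewrite normrN.
  rewrite /r normrM normfV mulrAC ler_wpM2r ?invr_ge0//.
  have -> : 4 * m / T = 2 * (2 * m / T) by ring.
  by apply: lin => //; rewrite ler_pdivlMr// mulrC.
have := @mvt_bound R (fun v => iint (fun v => a v * cos (l * v) + b v * sin (l * v)) v + - g v)
  (fun v => - r v) 0 T (4 * m / `|l| / T) (ltW T0).
move=> /(_ _ rb) main.
have {}main := main _; rewrite iint0 sub0r subr0 divfK ?gt_eqF// in main.
have {main}: `|iint (fun v => a v * cos (l * v) + b v * sin (l * v)) T + - g T - - g 0| <=
    4 * m / `|l|.
  apply: main => v /andP[v0 _].
  by apply: (rd_eq (rdD (iint_deriv fc v0) (rdN (gd v)))); cbv beta; ring.
have i0 : 0 <= (0 : R) <= T by rewrite lexx ltW.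
have iT : 0 <= T <= T by rewrite lexx ltW.
move: (gb 0 i0) (gb T iT); set I := iint _ _.
have -> : 8 * m / `|l| = 2 * m / `|l| + 2 * m / `|l| + 4 * m / `|l| by ring.
set u := 2 * m / _; set w := 4 * m / _.
by rewrite !ler_norml => /andP[? ?] /andP[? ?] /andP[? ?]; apply/andP; split; lra.
Qed.

Section Family.
Variables (I : eqType) (r : seq I) (p q dp dq : I -> R -> R) (l M : I -> R) (T : R).
Hypotheses (T0 : 0 < T) (ur : uniq r)
  (pd : forall i v, is_derive v 1 (p i) (dp i v))
  (qd : forall i v, is_derive v 1 (q i) (dq i v))
  (li : forall i j, i \in r -> j \in r -> i != j -> l i != l j)
  (H : forall i v, i \in r -> 0 <= v <= T -> [/\ `|p i v| <= M i, `|q i v| <= M i,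
    T * `|dp i v| <= M i & T * `|dq i v| <= M i]).

(** The integrand is the squared modulus of the sum of (p_i + i q_i) e^(-i l_i v), expanded into
    pairs of frequency l_i - l_j. The amplitudes may depend on v, because Abel summation will
    produce such ones. *)
Lemma osc_mean :
  iint (fun v => (\sum_(i <- r) (p i v * cos (l i * v) + q i v * sin (l i * v))) ^+ 2 +
    (\sum_(i <- r) (q i v * cos (l i * v) - p i v * sin (l i * v))) ^+ 2) T <=
  2 * T * \sum_(i <- r) M i ^+ 2 +
  16 * \sum_(i <- r) \sum_(j <- r | j != i) M i * M j / `|l i - l j|.
Proof.
pose a i j v := p i v * p j v + q i v * q j v.
pose b i j v := q i v * p j v + - (p i v * q j v).
pose f i j v := a i j v * cos ((l i - l j) * v) + b i j v * sin ((l i - l j) * v).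
have -> : (fun v => (\sum_(i <- r) (p i v * cos (l i * v) + q i v * sin (l i * v))) ^+ 2 +
    (\sum_(i <- r) (q i v * cos (l i * v) - p i v * sin (l i * v))) ^+ 2) =
    (fun v => \sum_(i <- r) \sum_(j <- r) f i j v).
  apply/funext => v; rewrite !expr2 !mulr_suml -big_split/=; apply: eq_bigr => i _.
  rewrite !mulr_sumr -big_split/=; apply: eq_bigr => j _.
  have -> : f i j v = a i j v * cos (l i * v - l j * v) + b i j v * sin (l i * v - l j * v).
    by rewrite /f mulrBl.
  by rewrite /a /b cosB sinB; ring.
pose da i j v := (dp i v * p j v + p i v * dp j v) + (dq i v * q j v + q i v * dq j v).
pose db i j v := (dq i v * p j v + q i v * dp j v) + - (dp i v * q j v + p i v * dq j v).
have ad i j v : is_derive v 1 (a i j) (da i j v).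
  by apply: rdD; apply: rdM.
have bd i j v : is_derive v 1 (b i j) (db i j v).
  by apply: rdD; [|apply: rdN]; apply: rdM.
have fc i j : continuous (f i j).
  move=> v; have av := ad i j v; have bv := bd i j v.
  rewrite /f; eapply (@rd_cont R _ v); rder.
have sc i : continuous (fun v => \sum_(j <- r) f i j v).
  elim: (r) => [|j s IH].
    have -> : (fun v => \sum_(j <- [::]) f i j v) = fun=> 0 by apply/funext => x; rewrite big_nil.
    by move=> x; exact: cst_continuous.
  have -> : (fun v => \sum_(k <- j :: s) f i k v) = (fun v => f i j v + \sum_(k <- s) f i k v).
    by apply/funext => x; rewrite big_cons.
  exact: continuous_add.
rewrite (iint_sum r xpredT sc (ltW T0)) !mulr_sumr -big_split/=.
rewrite big_seq [leRHS]big_seq; apply: ler_sum => i ir.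
rewrite (iint_sum r xpredT (fc i) (ltW T0)) (bigD1_seq i)//=; apply: lerD.
  rewrite -mulrA mulrCA [leRHS]mulrC; apply: le_trans (ler_norm _) _.
  apply: iint_bound (fc i i) (ltW T0) _ => v vT.
  rewrite /f subrr mul0r cos0 sin0 mulr0 addr0 mulr1 /a -!expr2.
  have [h1 h2 _ _] := H ir vT.
  rewrite ger0_norm ?addr_ge0 ?sqr_ge0//.
  have k (x : R) : `|x| <= M i -> x ^+ 2 <= M i ^+ 2.
    move=> xM; rewrite -(real_normK (num_real x)) lerXn2r ?nnegrE//.
    exact: le_trans xM.
  by have := k _ h1; have := k _ h2; lra.
rewrite mulr_sumr big_seq_cond [leRHS]big_seq_cond; apply: ler_sum => j /andP[jr ji].
apply: le_trans (ler_norm _) _.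
have -> : 16 * (M i * M j / `|l i - l j|) = 8 * (2 * (M i * M j)) / `|l i - l j| by ring.
apply: osc_pair (ad i j) (bd i j) _ => //.
  by rewrite subr_eq0 li// eq_sym.
move=> v vT; have [h1 h2 h3 h4] := H ir vT; have [k1 k2 k3 k4] := H jr vT.
have lin (s x1 y1 x2 y2 : R) : s = 1 \/ s = -1 -> `|x1| <= M i -> `|y1| <= M j -> `|x2| <= M i ->
    `|y2| <= M j -> `|x1 * y1 + s * (x2 * y2)| <= 2 * (M i * M j).
  move=> s1 ? ? ? ?; apply: le_trans (ler_normD _ _) _.
  have e1 : `|s * (x2 * y2)| = `|x2 * y2| by case: s1 => ->; rewrite ?mul1r ?mulN1r ?normrN.
  rewrite e1 !normrM.
  have : `|x1| * `|y1| <= M i * M j by apply: ler_pM.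
  have : `|x2| * `|y2| <= M i * M j by apply: ler_pM.
  lra.
have Tn (x : R) : T * `|x| = `|T * x| by rewrite normrM (gtr0_norm T0).
rewrite !Tn in h3 h4 k3 k4 *.
have o1 : (1 : R) = 1 \/ (1 : R) = -1 by left.
have o2 : (-1 : R) = 1 \/ (-1 : R) = -1 by right.
rewrite /a /b /da /db; split.
- by rewrite -[q i v * q j v]mul1r; exact: lin.
- by rewrite -mulN1r; exact: lin.
- have := lin _ _ _ _ _ o1 h3 k1 h1 k3; have := lin _ _ _ _ _ o1 h4 k2 h2 k4.
  rewrite !mul1r => e1 e2.
  have -> : T * (dp i v * p j v + p i v * dp j v + (dq i v * q j v + q i v * dq j v)) =
   (T * dp i v * p j v + p i v * (T * dp j v)) + (T * dq i v * q j v + q i v * (T * dq j v)) by ring.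
  by apply: le_trans (ler_normD _ _) _; lra.
- have := lin _ _ _ _ _ o1 h4 k1 h2 k3; have := lin _ _ _ _ _ o1 h3 k2 h1 k4.
  rewrite !mul1r => e1 e2.
  have -> : T * (dq i v * p j v + q i v * dp j v + - (dp i v * q j v + p i v * dq j v)) =
   (T * dq i v * p j v + q i v * (T * dp j v)) - (T * dp i v * q j v + p i v * (T * dq j v)) by ring.
  by apply: le_trans (ler_normB _ _) _; lra.
Qed.

End Family.

(** Truncated subtraction sends every e <= d to 0, where f vanishes. *)
Lemma shifted_sum_le (f : nat -> R) (a b d : nat) : (forall n, 0 <= f n) -> f 0%N = 0 ->
  \sum_(a <= e < b) f (e - d)%N <= \sum_(1 <= j < b) f j.
Proof.
move=> f0 fz.
apply: (@le_trans _ _ (\sum_(0 <= e < b) f (e - d)%N)).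
  have [ab|ba] := leqP a b; last by rewrite big_geq ?(ltnW ba)// sumr_ge0.
  by rewrite (big_cat_nat (leq0n a) ab)/= lerDr sumr_ge0.
have -> : \sum_(1 <= j < b) f j = \sum_(0 <= j < b) f j.
  by case: b => [|b]; [rewrite !big_geq|rewrite [RHS]big_ltn// fz add0r].
elim: d b => [|d IH] b.
  by under eq_bigr do rewrite subn0.
case: b => [|b]; first by rewrite !big_geq.
rewrite big_nat_recl// sub0n fz add0r big_nat_recr//=.
apply: le_trans (le_trans (IH b) _); last by rewrite lerDl.
by under eq_bigr do rewrite subSS.
Qed.

Lemma ln_ratio_ge (d e : nat) : (0 < d < e)%N ->
  (e - d)%N%:R / e%:R <= ln e%:R - ln d%:R :> R.
Proof.
move=> /andP[d0 de]; have e0 := ltn_trans d0 de.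
have d0' : 0 < d%:R :> R by rewrite ltr0n.
have e0' : 0 < e%:R :> R by rewrite ltr0n.
have dn : 0 < d%:R / e%:R :> R by rewrite divr_gt0.
have h1 : -1 < d%:R / e%:R - 1 :> R by lra.
have := le_ln1Dx h1; rewrite [1 + _]addrC subrK ln_div ?posrE// => h2.
rewrite natrB 1?ltnW// mulrBl divff ?gt_eqF//; lra.
Qed.

Lemma ln_gap (d e : nat) : (0 < d)%N -> (0 < e)%N -> d != e ->
  ((maxn d e - minn d e)%N)%:R / (maxn d e)%:R <= `|ln d%:R - ln e%:R| :> R.
Proof.
wlog de : d e / (d <= e)%N.
  move=> W d0 e0 n; case/orP: (leq_total d e) => de; first exact: W.
  by rewrite maxnC minnC distrC; apply: W; rewrite // eq_sym.
move=> d0 e0 n; rewrite (maxn_idPr de) (minn_idPl de) distrC.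
apply: le_trans (ler_norm _); apply: ln_ratio_ge.
by rewrite d0 ltn_neqAle n de.
Qed.

(** Since |ln d - ln e| >= |e - d| / max(d, e), it is enough to control each pair by a function of
    the smaller index and the gap j; the two orders of d and e give the factor 2. *)
Lemma off_sum (a b : nat) (M : nat -> R) (f : nat -> nat -> R) : (0 < a)%N ->
  (forall d, 0 <= M d) -> (forall d j, 0 <= f d j) -> (forall d, f d 0%N = 0) ->
  (forall d e, (a <= d < e)%N -> M d * M e * (e%:R / (e - d)%N%:R) <= f d (e - d)%N) ->
  \sum_(d <- index_iota a b) \sum_(e <- index_iota a b | e != d)
    M d * M e / `|ln d%:R - ln e%:R| <= 2 * \sum_(a <= d < b) \sum_(1 <= j < b) f d j.
Proof.
move=> a0 M0 f0 fz H.
apply: (@le_trans _ _ (\sum_(a <= d < b) \sum_(a <= e < b) (f d (e - d)%N + f e (d - e)%N))).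
  apply: ler_sum_nat => d /andP[ad _].
  rewrite big_mkcond/=; apply: ler_sum_nat => e /andP[ae _].
  have [_|ed] := eqVneq e d; first by rewrite addr_ge0.
  have d0 := leq_trans a0 ad; have e0 := leq_trans a0 ae.
  have K (x y : nat) : (a <= x < y)%N -> M x * M y / `|ln x%:R - ln y%:R| <= f x (y - x)%N.
    move=> /[dup] axy /andP[ax xy]; apply: le_trans (H _ _ axy).
    have x0 := leq_trans a0 ax.
    have y0 := ltn_trans x0 xy.
    have := ln_gap x0 y0; rewrite ltn_eqF// => /(_ isT).
    rewrite (maxn_idPr (ltnW xy)) (minn_idPl (ltnW xy)) => g.
    have yx0 : 0 < (y - x)%N%:R / y%:R :> R by rewrite divr_gt0 ?ltr0n// subn_gt0.
    apply: ler_wpM2l; first by rewrite mulr_ge0.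
    by rewrite -[leRHS]invf_div lef_pV2 ?posrE// (lt_le_trans yx0).
  case: (ltngtP d e) ed => // de _.
    apply: le_trans (K d e _) _; first by rewrite ad.
    by rewrite lerDl.
  rewrite [M d * M e]mulrC distrC; apply: le_trans (K e d _) _; first by rewrite ae.
  by rewrite lerDr.
have S : \sum_(a <= d < b) \sum_(a <= e < b) f d (e - d)%N <=
    \sum_(a <= d < b) \sum_(1 <= j < b) f d j.
  by apply: ler_sum => d _; apply: shifted_sum_le.
under eq_bigr do rewrite big_split/=.
by rewrite big_split/= [X in _ + X <= _]exchange_big_nat/=; lra.
Qed.

Lemma harmonic_le (n : nat) : \sum_(1 <= d < n.+2) (d%:R)^-1 <= 1 + ln n.+1%:R :> R.
Proof.
elim: n => [|n IH]; first by rewrite big_nat1 invr1 ln1 addr0.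
rewrite big_nat_recr//=.
have := @ln_ratio_ge n.+1 n.+2; rewrite !ltnS leqnn subSnn => /(_ isT).
rewrite div1r => h; apply: le_trans (lerD IH h) _.
by rewrite addrA [1 + ln _ + _]addrAC addrK.
Qed.

End OscillatingMean.

(** * Mean square of a Dirichlet polynomial with bounded partial sums *)

Section MeanSquare.
Context {R : realType}.
Local Notation C := R[i].
Implicit Types (d e Y K : nat) (w : C).

Let rt d : R := (Num.sqrt d%:R)^-1.

Lemma rt_sqr d : rt d ^+ 2 = (d%:R)^-1.
Proof. by rewrite /rt exprVn sqr_sqrtr. Qed.

Lemma rt_ge0 d : 0 <= rt d. Proof. by rewrite invr_ge0 sqrtr_ge0. Qed.

Lemma expR_le_rt (s : R) d : 2^-1 <= s -> (0 < d)%N -> expR (- (s * ln d%:R)) <= rt d.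
Proof.
move=> s2 d0; rewrite -(@ler_pXn2r _ 2) ?nnegrE ?expR_ge0 ?rt_ge0// rt_sqr expr2 -expRD.
have d0' : 0 < d%:R :> R by rewrite ltr0n.
have l0 : 0 <= ln d%:R :> R by rewrite ln_ge0// ler1n.
rewrite -[in leRHS](lnK d0') -expRN ler_expR.
have : 2^-1 * ln d%:R <= s * ln d%:R by rewrite ler_wpM2r.
lra.
Qed.

Lemma sum_rt_le Y : \sum_(1 <= d < Y.+1) rt d <= 2 * Num.sqrt Y%:R.
Proof.
elim: Y => [|Y IH]; first by rewrite big_geq// mulr_ge0// sqrtr_ge0.
rewrite big_nat_recr//=; apply: le_trans (lerD IH (lexx _)) _.
have y0 : 0 < Num.sqrt Y.+1%:R :> R by rewrite sqrtr_gt0 ltr0n.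
have h0 : 0 <= Num.sqrt Y%:R :> R by rewrite sqrtr_ge0.
have hy : Num.sqrt Y%:R ^+ 2 = Y%:R :> R by rewrite sqr_sqrtr.
have hy1 : Num.sqrt Y.+1%:R ^+ 2 = Y%:R + 1 :> R by rewrite sqr_sqrtr// -natr1.
rewrite /rt; move: y0 h0 hy hy1; set x := Num.sqrt Y%:R; set y := Num.sqrt _ => y0 h0 hy hy1.
rewrite -(ler_pM2r y0) mulrDl mulVf ?gt_eqF//.
have : 0 <= (x - y) ^+ 2 by exact: sqr_ge0.
have -> : (x - y) ^+ 2 = x ^+ 2 + y ^+ 2 - 2 * (x * y) by ring.
have yy : y * y = Y%:R + 1 by rewrite -expr2.
have e1 : 2 * x * y = 2 * (x * y) by ring.
have e2 : 2 * y * y = 2 * (y * y) by ring.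
rewrite hy hy1 e1 e2 yy; move: (x * y) (Y%:R : R) => a b; lra.
Qed.

Lemma sum_inv_sqr_le Y K : (0 < Y)%N ->
  \sum_(Y.+1 <= d < K.+1) (d%:R ^+ 2)^-1 <= (Y%:R)^-1 :> R.
Proof.
move=> Y0; have [KY|YK] := leqP K Y; first by rewrite big_geq.
apply: (@le_trans _ _ (Y%:R^-1 - K%:R^-1)); last by rewrite gerBl.
elim: K YK => // K IH; rewrite ltnS leq_eqVlt => /predU1P[<-|YK].
  rewrite big_nat1; have y0 : 0 < Y%:R :> R by rewrite ltr0n.
  have -> : Y%:R^-1 - Y.+1%:R^-1 = (Y%:R * Y.+1%:R)^-1 :> R.
    by rewrite -natr1; field; rewrite !gt_eqF// ltr_wpDl.
  by rewrite lef_pV2 ?posrE ?exprn_gt0 ?mulr_gt0// expr2 ler_wpM2r// ler_nat.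
rewrite big_nat_recr/= ?ltnS 1?ltnW//; apply: le_trans (lerD (IH YK) (lexx _)) _.
have y0 : 0 < K%:R :> R by rewrite ltr0n (ltn_trans Y0).
have : (K.+1%:R ^+ 2)^-1 <= K%:R^-1 - K.+1%:R^-1 :> R.
  have -> : K%:R^-1 - K.+1%:R^-1 = (K%:R * K.+1%:R)^-1 :> R.
    by rewrite -natr1; field; rewrite !gt_eqF// ltr_wpDl.
  by rewrite lef_pV2 ?posrE ?exprn_gt0 ?mulr_gt0// expr2 ler_wpM2r// ler_nat.
by move=> h; apply: le_trans (lerD (lexx _) h) _; rewrite addrA subrK.
Qed.

Lemma natcpow_vertical d (s v : R) :
  re (natcpow d (- (s +i* v)) : C) = expR (- (s * ln d%:R)) * cos (ln d%:R * v) /\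
  im (natcpow d (- (s +i* v)) : C) = - (expR (- (s * ln d%:R)) * sin (ln d%:R * v)).
Proof.
have E : - (s +i* v) * (ln d%:R)%:C = (- (s * ln d%:R)) +i* (- (ln d%:R * v)).
  by apply: complex_ext; rewrite /=; ring.
by rewrite /natcpow E re_cexp im_cexp /= cosN sinN mulrN.
Qed.

Lemma hol2_cont_cm2 (lo : R) (f : C -> C) (x : R) : hol2 lo f -> lo < x ->
  continuous (fun v => cm (f (x +i* v)) ^+ 2).
Proof.
move=> H lx; have c := hol2_cont_cm H lx.
have -> : (fun v => cm (f (x +i* v)) ^+ 2) = (fun v => cm (f (x +i* v)) * cm (f (x +i* v))).
  by apply/funext => v; rewrite expr2.
by move=> v; apply: continuousM; exact: c.
Qed.

Lemma ln_natr_inj d e : (0 < d)%N -> (0 < e)%N -> d != e -> ln d%:R != ln e%:R :> R.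
Proof.
move=> d0 e0; apply: contra_neq => /ln_inj H; apply/eqP.
by rewrite -(eqr_nat R); apply/eqP; apply: H; rewrite posrE ltr0n.
Qed.

Variables (g : nat -> R) (A P s : R).
Hypotheses (gA : forall n, `|g n| <= A) (AP : A <= P) (s2 : 2^-1 <= s) (s1 : s <= 1).
Let S n := \sum_(1 <= d < n.+1) g d.
Hypothesis SP : forall n, `|S n| <= P.

Let A0 : 0 <= A := le_trans (normr_ge0 _) (gA 0).
Let P0 : 0 <= P := le_trans A0 AP.

(** For d <= 2T the off-diagonal terms, of order A^2 Y ln Y, do not exceed the diagonal A^2 T ln Y.
    The constant is 2 + 32 * 10. *)
Lemma head_mean Y (T : R) : 0 < T -> Y%:R <= 2 * T -> (0 < Y)%N ->
  iint (fun v => cm (\sum_(1 <= d < Y.+1) (g d)%:C * natcpow d (- (s +i* v))) ^+ 2) T <=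
  322 * A ^+ 2 * (1 + ln Y%:R) * T.
Proof.
move=> T0 YT Y0; pose M d := A * rt d.
pose p d (v : R) := g d * expR (- (s * ln d%:R)); pose q d (v : R) : R := 0.
have pd d (v : R) : is_derive v 1 (p d) 0 by exact: rdc.
have qd d (v : R) : is_derive v 1 (q d) 0 by exact: rdc.
have M0 d : 0 <= M d by rewrite mulr_ge0// rt_ge0.
have li d e : d \in index_iota 1 Y.+1 -> e \in index_iota 1 Y.+1 -> d != e ->
    ln d%:R != ln e%:R :> R.
  by rewrite !mem_index_iota => /andP[d0 _] /andP[e0 _]; exact: ln_natr_inj.
have HM d (v : R) : d \in index_iota 1 Y.+1 -> 0 <= v <= T -> [/\ `|p d v| <= M d, `|q d v| <= M d,
    T * `|(0 : R)| <= M d & T * `|(0 : R)| <= M d].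
  rewrite mem_index_iota => /andP[d0 _] _; rewrite /q normr0 mulr0; split => //.
  rewrite /p normrM (ger0_norm (expR_ge0 _)); apply: ler_pM => //.
  exact: expR_le_rt.
have := osc_mean T0 (iota_uniq _ _) pd qd li HM.
have -> : (fun v => (\sum_(i <- index_iota 1 Y.+1) (p i v * cos (ln i%:R * v) + q i v * sin (ln i%:R * v))) ^+ 2 +
    (\sum_(i <- index_iota 1 Y.+1) (q i v * cos (ln i%:R * v) - p i v * sin (ln i%:R * v))) ^+ 2) =
   (fun v => cm (\sum_(1 <= d < Y.+1) (g d)%:C * natcpow d (- (s +i* v))) ^+ 2).
  apply/funext => v; rewrite cm_sqr re_sum im_sum; congr (_ ^+ 2 + _ ^+ 2); apply: eq_bigr => d _.
    by rewrite (reZ (g d)) (natcpow_vertical d s v).1 /q /p mul0r addr0 mulrA.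
  by rewrite (imZ (g d)) (natcpow_vertical d s v).2 /q /p mul0r sub0r mulrN mulrA.
move=> /le_trans; apply.
have l0 : 0 <= ln Y%:R :> R by rewrite ln_ge0// ler1n.
have har : \sum_(1 <= d < Y.+1) (d%:R)^-1 <= 1 + ln Y%:R :> R.
  by case: (Y) Y0 => // n _; exact: harmonic_le.
have D : \sum_(d <- index_iota 1 Y.+1) M d ^+ 2 <= A ^+ 2 * (1 + ln Y%:R).
  apply: le_trans (ler_wpM2l (sqr_ge0 A) har); rewrite mulr_sumr.
  by apply: ler_sum => d _; rewrite exprMn rt_sqr.
(* With j = e - d the pair costs sqrt(e/d)/j, and sqrt e <= sqrt d + sqrt j splits this into 1/j +
   1/sqrt(d j). *)
pose f d j := A ^+ 2 * (j%:R^-1 + rt d * rt j).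
have f0 d j : 0 <= f d j.
  by rewrite mulr_ge0 ?sqr_ge0// addr_ge0// mulr_ge0 ?rt_ge0.
have fz d : f d 0%N = 0 by rewrite /f /rt sqrtr0 invr0 mulr0 addr0 mulr0.
have fM d e : (1 <= d < e)%N -> M d * M e * (e%:R / (e - d)%N%:R) <= f d (e - d)%N.
  move=> /andP[d0 de]; rewrite /M /f.
  have -> : A * rt d * (A * rt e) * (e%:R / (e - d)%N%:R) =
    A ^+ 2 * (rt d * (rt e * e%:R / (e - d)%N%:R)) by ring.
  apply: ler_wpM2l; first exact: sqr_ge0.
  have e0 : 0 < e%:R :> R by rewrite ltr0n (ltn_trans d0).
  have d0' : 0 < d%:R :> R by rewrite ltr0n.
  have j0 : 0 < (e - d)%N%:R :> R by rewrite ltr0n subn_gt0.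
  have re' : rt e * e%:R = Num.sqrt e%:R.
    rewrite /rt -{2}(sqr_sqrtr (ltW e0)) expr2 mulrA mulVf ?mul1r//.
    by rewrite gt_eqF// sqrtr_gt0.
  have sq : Num.sqrt e%:R <= Num.sqrt d%:R + Num.sqrt (e - d)%N%:R :> R.
    rewrite -(@ler_pXn2r _ 2) ?nnegrE ?addr_ge0 ?sqrtr_ge0//.
    rewrite sqrrD !sqr_sqrtr ?(ltW e0) ?(ltW d0') ?(ltW j0)// natrB 1?ltnW//.
    have : 0 <= Num.sqrt d%:R * Num.sqrt (e%:R - d%:R) :> R by rewrite mulr_ge0 ?sqrtr_ge0.
    by move=> h; rewrite -[X in _ <= X + _ + _]addr0; lra.
  rewrite re'; apply: (@le_trans _ _ (rt d * ((Num.sqrt d%:R + Num.sqrt (e - d)%N%:R) / (e - d)%N%:R))).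
    by apply: ler_wpM2l; [exact: rt_ge0|rewrite ler_wpM2r ?invr_ge0 ?(ltW j0)].
  rewrite mulrDl mulrDr; apply: lerD.
    by rewrite mulrA /rt mulVf ?mul1r// gt_eqF// sqrtr_gt0.
  apply: ler_wpM2l; first exact: rt_ge0.
  rewrite -[in leLHS](sqr_sqrtr (ltW j0)) /rt.
  have sj : 0 < Num.sqrt (e - d)%N%:R :> R by rewrite sqrtr_gt0.
  by rewrite sqr_sqrtr ?(ltW j0)// -{2}(sqr_sqrtr (ltW j0)) expr2 invfM mulrA mulfV ?mul1r// gt_eqF.
have O := off_sum Y.+1 (isT : (0 < 1)%N) M0 f0 fz fM.
have F : \sum_(1 <= d < Y.+1) \sum_(1 <= j < Y.+1) f d j <=
   A ^+ 2 * (Y%:R * (1 + ln Y%:R) + 4 * Y%:R).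
  have -> : \sum_(1 <= d < Y.+1) \sum_(1 <= j < Y.+1) f d j =
     A ^+ 2 * (Y%:R * (\sum_(1 <= j < Y.+1) j%:R^-1) +
       (\sum_(1 <= j < Y.+1) rt j) * (\sum_(1 <= j < Y.+1) rt j)).
    under eq_bigr do rewrite /f -mulr_sumr big_split/= -mulr_sumr.
    rewrite -mulr_sumr big_split/= -mulr_suml; congr (_ * (_ + _)).
    by rewrite big_const_nat subn1 /= iter_addr addr0 mulr_natl.
  apply: ler_wpM2l; first exact: sqr_ge0.
  apply: lerD; first by apply: ler_wpM2l.
  have -> : 4 * Y%:R = (2 * Num.sqrt Y%:R) * (2 * Num.sqrt Y%:R) :> R.
    by rewrite mulrACA -expr2 -[in RHS]expr2 sqr_sqrtr//; ring.
  by apply: ler_pM (sum_rt_le Y) (sum_rt_le Y); rewrite sumr_ge0// => i _; exact: rt_ge0.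
have a2 : 0 <= A ^+ 2 by exact: sqr_ge0.
have k1 : A ^+ 2 * (Y%:R * (1 + ln Y%:R) + 4 * Y%:R) <= A ^+ 2 * (10 * (T * (1 + ln Y%:R))).
  apply: ler_wpM2l => //.
  have : Y%:R * (1 + ln Y%:R) <= 2 * T * (1 + ln Y%:R) by rewrite ler_wpM2r// addr_ge0.
  have : 0 <= T * ln Y%:R by rewrite mulr_ge0// ltW.
  by move=> *; lra.
have k2 := ler_wpM2l (ltW T0) D.
move: O F k1 k2; set a := \sum_(_ <- _) _; set b := \sum_(1 <= d < _) _.
set c := \sum_(_ <- _) _; set x := A ^+ 2 * (10 * _).
have -> : 322 * A ^+ 2 * (1 + ln Y%:R) * T = 2 * (T * (A ^+ 2 * (1 + ln Y%:R))) + 32 * x.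
  by rewrite /x; ring.
set z := T * (A ^+ 2 * _).
move=> *; lra.
Qed.

Lemma abel_sum (u : nat -> C) Y K : (Y <= K)%N ->
  \sum_(Y.+1 <= d < K.+1) (g d)%:C * u d =
  \sum_(Y.+1 <= d < K.+1) (S d)%:C * (u d - u d.+1) +
    ((S K)%:C * u K.+1 - (S Y)%:C * u Y.+1).
Proof.
elim: K => [|K IH]; first by rewrite leqn0 => /eqP ->; rewrite !big_geq// add0r subrr.
rewrite leq_eqVlt => /predU1P[->|YK]; first by rewrite !big_geq// add0r subrr.
rewrite !(big_nat_recr K.+1)//= (IH YK).
have -> : S K.+1 = S K + g K.+1 by rewrite /S big_nat_recr.
by rewrite rmorphD/=; ring.
Qed.

Lemma sin_le_id (x : R) : 0 <= x -> `|sin x| <= x.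
Proof.
move=> x0; have := @mvt_bound R sin cos 0 x 1 x0.
rewrite sin0 !subr0 mul1r; apply=> y _; exact: cos_max.
Qed.

Lemma one_sub_cos_le (x : R) : 0 <= x -> 1 - cos x <= x.
Proof.
move=> x0; have := @mvt_bound R cos (fun y => - sin y) 0 x 1 x0.
rewrite cos0 !subr0 mul1r distrC => H; apply: le_trans (ler_norm _) _; apply: H => y _.
by rewrite normrN sin_max.
Qed.

(** d^(-w) - (d+1)^(-w) is d^(-w) times a slowly varying factor of size O(T/d) for 0 <= v <= T,
    whose v-derivative is O(1/d). So [osc_mean] applies with the frequencies ln d and amplitudes P T
    d^(-3/2); the sums converge beyond Y >= T and give O(P^2 T ln K). *)
Lemma tail_mean Y K (T : R) : 1 <= T -> T <= Y%:R -> (Y < K)%N ->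
  iint (fun v => cm (\sum_(Y.+1 <= d < K.+1)
    (S d)%:C * (natcpow d (- (s +i* v)) - natcpow d.+1 (- (s +i* v)))) ^+ 2) T <=
  136 * P ^+ 2 * (1 + ln K%:R) * T.
Proof.
move=> T1 TY YK; have T0 : 0 < T by lra.
have Y0 : (0 < Y)%N by rewrite -(ltr0n R); apply: lt_le_trans TY.
have Y0' : 0 < Y%:R :> R by rewrite ltr0n.
pose M d := 2 * P * T * (rt d / d%:R).
pose la d : R := ln d.+1%:R - ln d%:R.
pose E d := expR (- (s * la d)).
pose x d := S d * expR (- (s * ln d%:R)).
(* Real and imaginary parts of x(d) (1 - E(d) e^(-i la(d) v)), the amplitude left after factoring
   out e^(-i v ln d). *)
pose p d v := x d * (1 + - (E d * cos (la d * v))).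
pose q d v := x d * (E d * sin (la d * v)).
pose dp d v := x d * (E d * (sin (la d * v) * la d)).
pose dq d v := x d * (E d * (cos (la d * v) * la d)).
have pd d (v : R) : is_derive v 1 (p d) (dp d v).
  by rewrite /p; eapply rd_eq; [rder|rewrite /dp; cbv beta; ring].
have qd d (v : R) : is_derive v 1 (q d) (dq d v).
  by rewrite /q; eapply rd_eq; [rder|rewrite /dq; cbv beta; ring].
have M0 d : 0 <= M d.
  by rewrite mulr_ge0// ?divr_ge0 ?rt_ge0// !mulr_ge0// ltW.
have dY d : d \in index_iota Y.+1 K.+1 -> (0 < d)%N.
  by rewrite mem_index_iota => /andP[d0 _]; exact: leq_trans d0.
have li d e : d \in index_iota Y.+1 K.+1 -> e \in index_iota Y.+1 K.+1 -> d != e ->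
    ln d%:R != ln e%:R :> R.
  by move=> /dY d0 /dY e0; exact: ln_natr_inj.
have s0 : 0 <= s by apply: le_trans s2; rewrite invr_ge0.
have HM d (v : R) : d \in index_iota Y.+1 K.+1 -> 0 <= v <= T -> [/\ `|p d v| <= M d, `|q d v| <= M d,
    T * `|dp d v| <= M d & T * `|dq d v| <= M d].
  move=> /dY d0 /andP[v0 vT].
  have d0' : 0 < d%:R :> R by rewrite ltr0n.
  have di : 0 < (d%:R)^-1 :> R by rewrite invr_gt0.
  have la0 : 0 <= la d by rewrite subr_ge0 ler_ln ?posrE ?ltr0n// ler_nat.
  have lad : la d <= (d%:R)^-1.
    have h1 : -1 < (d%:R)^-1 :> R by apply: lt_trans di; rewrite ltrN10.
    have := le_ln1Dx h1; have -> : 1 + d%:R^-1 = d.+1%:R / d%:R :> R.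
      by rewrite -natr1; field; rewrite gt_eqF.
    by rewrite ln_div ?posrE.
  have E0 : 0 <= E d := expR_ge0 _.
  have sla : 0 <= s * la d by rewrite mulr_ge0.
  have E1 : E d <= 1 by rewrite -[leRHS]expR0 ler_expR oppr_le0.
  have Es : 1 - E d <= s * la d by have := expR_ge1Dx (- (s * la d)); rewrite -/(E d); lra.
  have xd : `|x d| <= P * rt d.
    rewrite /x normrM (ger0_norm (expR_ge0 _)); apply: ler_pM => //.
    exact: expR_le_rt.
  have lv0 : 0 <= la d * v by rewrite mulr_ge0.
  have lv : la d * v <= T / d%:R.
    by rewrite mulrC; apply: ler_pM.
  have ls : s * la d <= 1 / d%:R by apply: ler_pM.
  have Td : 1 / d%:R <= T / d%:R by rewrite ler_wpM2r// ltW.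
  have bnd y : `|y| <= 2 * T / d%:R -> `|x d * y| <= M d.
    move=> yT; rewrite normrM.
    have -> : M d = P * rt d * (2 * T / d%:R) by rewrite /M; ring.
    exact: ler_pM.
  have TT : T / d%:R <= 2 * T / d%:R by rewrite ler_wpM2r ?(ltW di)//; lra.
  have TE : 2 * T / d%:R = T / d%:R + T / d%:R by ring.
  split.
  - apply: bnd; have c1 := one_sub_cos_le lv0; have := cos_le1 (la d * v).
    have : 0 <= E d * (1 - cos (la d * v)) by rewrite mulr_ge0// subr_ge0 cos_le1.
    have : E d * (1 - cos (la d * v)) <= 1 * (la d * v).
      by apply: ler_pM => //; rewrite subr_ge0 cos_le1.
    by move=> ? ? ?; rewrite ger0_norm; lra.
  - apply: bnd; rewrite normrM (ger0_norm E0); apply: le_trans TT; apply: le_trans lv.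
    by rewrite -[leRHS]mul1r; apply: ler_pM => //; exact: sin_le_id.
  - rewrite -(gtr0_norm T0) -normrM mulrCA; apply: bnd.
    rewrite !normrM (gtr0_norm T0) (ger0_norm E0) (ger0_norm la0); apply: le_trans TT.
    apply: ler_pM; rewrite ?mulr_ge0 ?(ltW T0)//; apply: le_trans lad.
    by rewrite mulrA ler_piMl// mulr_ile1// sin_max.
  - rewrite -(gtr0_norm T0) -normrM mulrCA; apply: bnd.
    rewrite !normrM (gtr0_norm T0) (ger0_norm E0) (ger0_norm la0); apply: le_trans TT.
    apply: ler_pM; rewrite ?mulr_ge0 ?(ltW T0)//; apply: le_trans lad.
    by rewrite mulrA ler_piMl// mulr_ile1// cos_max.
have := osc_mean T0 (iota_uniq _ _) pd qd li HM.
have key d (v : R) :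
    re ((S d)%:C * (natcpow d (- (s +i* v)) - natcpow d.+1 (- (s +i* v)))) =
      p d v * cos (ln d%:R * v) + q d v * sin (ln d%:R * v) /\
    im ((S d)%:C * (natcpow d (- (s +i* v)) - natcpow d.+1 (- (s +i* v)))) =
      q d v * cos (ln d%:R * v) - p d v * sin (ln d%:R * v).
  have [r1 i1] := natcpow_vertical d s v; have [r2 i2] := natcpow_vertical d.+1 s v.
  have lE : ln d.+1%:R = la d + ln d%:R by rewrite subrK.
  have xE : expR (- (s * ln d.+1%:R)) = E d * expR (- (s * ln d%:R)).
    by rewrite /E -expRD lE; congr expR; ring.
  rewrite (reZ (S d)) (imZ (S d)) reB imB r1 i1 r2 i2 xE lE mulrDl cosD sinD /p /q /x.
  by split; ring.
have -> : (fun v => (\sum_(i <- index_iota Y.+1 K.+1) (p i v * cos (ln i%:R * v) + q i v * sin (ln i%:R * v))) ^+ 2 +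
    (\sum_(i <- index_iota Y.+1 K.+1) (q i v * cos (ln i%:R * v) - p i v * sin (ln i%:R * v))) ^+ 2) =
   (fun v => cm (\sum_(Y.+1 <= d < K.+1)
    (S d)%:C * (natcpow d (- (s +i* v)) - natcpow d.+1 (- (s +i* v)))) ^+ 2).
  apply/funext => v; rewrite cm_sqr re_sum im_sum; congr (_ ^+ 2 + _ ^+ 2); apply: eq_bigr => d _.
    by rewrite (key d v).1.
  by rewrite (key d v).2.
move=> /le_trans; apply.
have l0 : 0 <= ln K%:R :> R by rewrite ln_ge0// ler1n (leq_ltn_trans _ YK).
have inv2 := @sum_inv_sqr_le Y K Y0.
pose B := 4 * P ^+ 2 * T ^+ 2; have B0 : 0 <= B by rewrite /B mulr_ge0 ?sqr_ge0// mulr_ge0 ?sqr_ge0.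
have MM d : M d ^+ 2 = B * ((d%:R ^+ 2)^-1 * d%:R^-1).
  by rewrite -rt_sqr -exprVn /M /B; ring.
have D : \sum_(d <- index_iota Y.+1 K.+1) M d ^+ 2 <= B * (Y%:R^-1 * Y%:R^-1).
  rewrite (eq_bigr (fun d => B * ((d%:R ^+ 2)^-1 * d%:R^-1))); last by move=> d _; exact: MM.
  rewrite -mulr_sumr; apply: ler_wpM2l => //.
  apply: le_trans (ler_wpM2r _ inv2); last by rewrite invr_ge0 ltW.
  rewrite mulr_suml; apply: ler_sum_nat => d /andP[Yd _].
  apply: ler_wpM2l; first by rewrite invr_ge0 sqr_ge0.
  by rewrite lef_pV2 ?posrE ?ltr0n ?ler_nat ?(ltnW Yd)// (ltn_trans Y0).
pose f d j : R := B * ((d%:R ^+ 2)^-1 * j%:R^-1).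
have f0 d j : 0 <= f d j by rewrite mulr_ge0// mulr_ge0 ?invr_ge0 ?sqr_ge0.
have fz d : f d 0%N = 0 by rewrite /f invr0 !mulr0.
have fM d e : (Y.+1 <= d < e)%N -> M d * M e * (e%:R / (e - d)%N%:R) <= f d (e - d)%N.
  move=> /andP[Yd de]; have d0 : (0 < d)%N by exact: leq_ltn_trans Yd.
  have e0 := ltn_trans d0 de.
  have d0' : 0 < d%:R :> R by rewrite ltr0n.
  have e0' : 0 < e%:R :> R by rewrite ltr0n.
  have j0 : 0 < (e - d)%N%:R :> R by rewrite ltr0n subn_gt0.
  rewrite /M /f.
  have -> : 2 * P * T * (rt d / d%:R) * (2 * P * T * (rt e / e%:R)) * (e%:R / (e - d)%N%:R) =
    B * (rt d * rt e / d%:R / (e - d)%N%:R).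
    by rewrite /B; field; rewrite !gt_eqF.
  apply: ler_wpM2l => //; rewrite ler_wpM2r ?invr_ge0 ?(ltW j0)//.
  have -> : (d%:R ^+ 2)^-1 = rt d * rt d / d%:R by rewrite -expr2 rt_sqr -invfM -expr2.
  rewrite ler_wpM2r ?invr_ge0 ?(ltW d0')//; apply: ler_wpM2l; first exact: rt_ge0.
  rewrite /rt lef_pV2 ?posrE ?sqrtr_gt0// ler_wsqrtr// ler_nat; exact: ltnW.
have O := off_sum K.+1 (isT : (0 < Y.+1)%N) M0 f0 fz fM.
have F : \sum_(Y.+1 <= d < K.+1) \sum_(1 <= j < K.+1) f d j <= B * (Y%:R^-1 * (1 + ln K%:R)).
  have -> : \sum_(Y.+1 <= d < K.+1) \sum_(1 <= j < K.+1) f d j =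
    B * ((\sum_(Y.+1 <= d < K.+1) (d%:R ^+ 2)^-1) * (\sum_(1 <= j < K.+1) j%:R^-1)).
    under eq_bigr do rewrite -mulr_sumr -mulr_sumr.
    by rewrite -mulr_sumr -mulr_suml.
  apply: ler_wpM2l => //; apply: ler_pM => //; rewrite ?sumr_ge0//.
  by case: (K) YK => // n _; exact: harmonic_le.
have TYi : T / Y%:R <= 1 by rewrite ler_pdivrMr ?mul1r.
have TYi0 : 0 <= T / Y%:R by rewrite divr_ge0// ltW.
have P2 : 0 <= P ^+ 2 by exact: sqr_ge0.
have k1 : T * (B * (Y%:R^-1 * Y%:R^-1)) <= 4 * P ^+ 2 * T.
  have -> : T * (B * (Y%:R^-1 * Y%:R^-1)) = 4 * P ^+ 2 * T * (T / Y%:R * (T / Y%:R)) by rewrite /B; ring.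
  by rewrite ler_piMr ?mulr_ge0 ?(ltW T0)// mulr_ile1.
have k2 : B * (Y%:R^-1 * (1 + ln K%:R)) <= 4 * P ^+ 2 * T * (1 + ln K%:R).
  have -> : B * (Y%:R^-1 * (1 + ln K%:R)) = 4 * P ^+ 2 * T * (1 + ln K%:R) * (T / Y%:R) by rewrite /B; ring.
  by rewrite ler_piMr// !mulr_ge0 ?(ltW T0)// addr_ge0.
have k3 : 0 <= 4 * P ^+ 2 * T * ln K%:R by rewrite !mulr_ge0// ltW.
have k4 := ler_wpM2l (ltW T0) D.
have -> y : 2 * T * y = 2 * (T * y) by ring.
move: O F k1 k2 k3 k4; set a := \sum_(_ <- _) _; set b := \sum_(_ <= _ < _) _.
set c := \sum_(_ <- _) _.
have -> : 136 * P ^+ 2 * (1 + ln K%:R) * T = 32 * (4 * P ^+ 2 * T * (1 + ln K%:R)) +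
  2 * (4 * P ^+ 2 * T) + 2 * (4 * P ^+ 2 * T * ln K%:R) by ring.
set z := 4 * P ^+ 2 * T * (1 + _).
set y := T * (B * _); set y' := B * (_ * (1 + _)).
move=> *; lra.
Qed.

Lemma cm_sqr3 (a b c : C) : cm (a + b + c) ^+ 2 <= 3 * cm a ^+ 2 + 3 * cm b ^+ 2 + 3 * cm c ^+ 2.
Proof.
have h : cm (a + b + c) <= cm a + cm b + cm c.
  by apply: le_trans (cmD _ _) _; rewrite lerD2r cmD.
apply: (@le_trans _ _ ((cm a + cm b + cm c) ^+ 2)).
  by rewrite lerXn2r ?nnegrE ?addr_ge0 ?cm_ge0.
move: (cm a) (cm b) (cm c) => x y z.
have := sqr_ge0 (x - y); have := sqr_ge0 (x - z); have := sqr_ge0 (y - z); nra.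
Qed.

(** Cut near T: coefficients below it are used through A <= P, those above it through their partial
    sums, and the Abel boundary terms are at most 2P. The constant covers 3 * 322 + 3 * 136 + 12. *)
Lemma dsum_mean K (T : R) : (0 < K)%N -> 1 <= T ->
  iint (fun v => cm (\sum_(1 <= d < K.+1) (g d)%:C * natcpow d (- (s +i* v))) ^+ 2) T <=
  1400 * P ^+ 2 * (1 + ln K%:R) * T.
Proof.
move=> K0 T1; have T0 : 0 < T by lra.
have lK : 0 <= ln K%:R :> R by rewrite ln_ge0// ler1n.
have AP2 : A ^+ 2 <= P ^+ 2 by rewrite lerXn2r ?nnegrE.
have P2 : 0 <= P ^+ 2 by exact: sqr_ge0.
have head Y : Y%:R <= 2 * T -> (0 < Y)%N -> (Y <= K)%N ->
    iint (fun v => cm (\sum_(1 <= d < Y.+1) (g d)%:C * natcpow d (- (s +i* v))) ^+ 2) T <=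
    322 * (P ^+ 2 * (1 + ln K%:R) * T).
  move=> YT Y0 YK; apply: le_trans (head_mean T0 YT Y0) _.
  have lY : 0 <= ln Y%:R :> R by rewrite ln_ge0// ler1n.
  have lYK : ln Y%:R <= ln K%:R :> R by rewrite ler_ln ?posrE ?ltr0n// ler_nat.
  have : A ^+ 2 * (1 + ln Y%:R) * T <= P ^+ 2 * (1 + ln K%:R) * T.
    rewrite ler_wpM2r ?(ltW T0)//; apply: ler_pM; rewrite ?sqr_ge0 ?lerD2l//.
    by rewrite addr_ge0.
  have -> : 322 * A ^+ 2 * (1 + ln Y%:R) * T = 322 * (A ^+ 2 * (1 + ln Y%:R) * T) by ring.
  move: (A ^+ 2 * _ * T) (P ^+ 2 * _ * T) => ? ? ?; lra.
have X0 : 0 <= P ^+ 2 * (1 + ln K%:R) * T by rewrite !mulr_ge0 ?addr_ge0// ltW.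
(* T < D <= 2T: the tail needs D >= T and the head D <= 2T. *)
pose D := (Num.trunc T).+1.
have /andP[tT Tt] : ((Num.trunc T)%:R <= T) && (T < D%:R) by apply: trunc_itv; lra.
have Y2 : D%:R <= 2 * T by rewrite /D -natr1; lra.
have EX : 1400 * P ^+ 2 * (1 + ln K%:R) * T = 1400 * (P ^+ 2 * (1 + ln K%:R) * T) by ring.
have [KY|YK] := leqP K D.
  have KT : K%:R <= 2 * T by apply: le_trans Y2; rewrite ler_nat.
  by apply: le_trans (head K KT K0 (leqnn _)) _; rewrite EX; lra.
have s0 : 0 < s by apply: lt_le_trans s2; rewrite invr_gt0.
have hs (c : nat -> C) (a b : nat) : hol2 0 (fun w => \sum_(a <= d < b) c d * natcpow d (- w)).
  by apply: hol2_sum => d; apply: hol2M; [exact: hol2c|exact: hol2_natcpow].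
have c1 := hol2_cont_cm2 (hs (fun d => (g d)%:C) 1 K.+1) s0.
have c2 := hol2_cont_cm2 (hs (fun d => (g d)%:C) 1 D.+1) s0.
have h3 : hol2 0 (fun w => \sum_(D.+1 <= d < K.+1) (S d)%:C * (natcpow d (- w) + (-1) * natcpow d.+1 (- w))).
  apply: hol2_sum => d; apply: hol2M; first exact: hol2c.
  apply: hol2D; first exact: hol2_natcpow.
  by apply: hol2M; [exact: hol2c|exact: hol2_natcpow].
have c3 := hol2_cont_cm2 h3 s0.
have E3 : (fun v => cm (\sum_(D.+1 <= d < K.+1) (S d)%:C * (natcpow d (- (s +i* v)) + (-1) * natcpow d.+1 (- (s +i* v)))) ^+ 2) =
  (fun v => cm (\sum_(D.+1 <= d < K.+1)
    (S d)%:C * (natcpow d (- (s +i* v)) - natcpow d.+1 (- (s +i* v)))) ^+ 2).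
  apply/funext => v; congr (cm _ ^+ 2); apply: eq_bigr => d _.
  by rewrite mulN1r.
rewrite E3 in c3.
have c5 : continuous (fun _ : R => 3 * (2 * P) ^+ 2) by move=> x; exact: cst_continuous.
apply: (@le_trans _ _ (iint (fun v => 3 * cm (\sum_(1 <= d < D.+1) (g d)%:C * natcpow d (- (s +i* v))) ^+ 2 +
   3 * cm (\sum_(D.+1 <= d < K.+1)
    (S d)%:C * (natcpow d (- (s +i* v)) - natcpow d.+1 (- (s +i* v)))) ^+ 2 +
   3 * (2 * P) ^+ 2) T)).
  apply: iint_le => //; first by do 2?[apply: continuous_add] => //; exact: continuous_cM.
    exact: ltW.
  move=> v _; rewrite (big_cat_nat (n := D.+1))//= 1?ltnW//.
  rewrite (@abel_sum (fun d => natcpow d (- (s +i* v))) D K (ltnW YK)) addrA.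
  apply: le_trans (cm_sqr3 _ _ _) _; rewrite lerD2l ler_pM2l// lerXn2r ?nnegrE ?cm_ge0 ?mulr_ge0//.
  apply: le_trans (cmB _ _) _.
  have bn d : cm ((S d)%:C * natcpow d.+1 (- (s +i* v))) <= P.
    rewrite (cmM (S d)%:C) cm_real -[leRHS]mulr1; apply: ler_pM; rewrite ?cm_ge0//.
    rewrite cm_natcpow reN /= -[leRHS]expR0 ler_expR mulNr oppr_le0 mulr_ge0 ?(ltW s0)//.
    by rewrite ln_ge0// ler1n.
  by have := bn K; have := bn D; lra.
rewrite (iintD _ c5 (ltW T0)); last by apply: continuous_add; exact: continuous_cM.
rewrite (iintD (continuous_cM c2) (continuous_cM c3) (ltW T0)).
rewrite (iintZ _ c2 (ltW T0)) (iintZ _ c3 (ltW T0)) iint_c ?(ltW T0)// EX.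
have hd := head D Y2 isT (ltnW YK).
have tl := tail_mean T1 (ltW Tt) YK.
have PT : P ^+ 2 * T <= P ^+ 2 * (1 + ln K%:R) * T.
  by rewrite ler_wpM2r ?(ltW T0)// ler_peMr// lerDl.
move: hd tl PT X0.
have -> : 136 * P ^+ 2 * (1 + ln K%:R) * T = 136 * (P ^+ 2 * (1 + ln K%:R) * T) by ring.
have -> : 3 * (2 * P) ^+ 2 * T = 12 * (P ^+ 2 * T) by ring.
set a := iint _ _; set b := iint _ _; set x := P ^+ 2 * (1 + _) * T; set y := P ^+ 2 * T.
move=> *; lra.
Qed.

End MeanSquare.

(** * Logarithmic means of the Moebius function *)

Section SmoothedBound.
Context {R : realType}.
Local Notation C := R[i].
Implicit Types (w : C) (v T x : R).

(** The weight (4+|v|)^(-1-e), integrable over the half line. *)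
Definition decay (e v : R) : R := expR (- ((1 + e) * ht v)).
Local Notation W := decay.

Lemma continuous_mul (f g : R -> R) : continuous f -> continuous g ->
  continuous (fun x => f x * g x).
Proof. by move=> fc gc x; apply: continuousM; [exact: fc|exact: gc]. Qed.

Lemma ht_cont : continuous (@ht R).
Proof.
move=> x; apply: (@continuous_comp _ _ _ (fun x : R => 4 + `|x|) (@ln R)).
  by apply: continuousD; [exact: cst_continuous|exact: (@norm_continuous R R)].
exact: (@rd_cont R _ _ _ (is_derive1_ln (ht_pos x))).
Qed.

Lemma W_cont e : continuous (W e).
Proof.
move=> x; apply: (@continuous_comp _ _ _ (fun v : R => - ((1 + e) * ht v)) (@expR R)).
  apply: continuousN; apply: continuousM; [exact: cst_continuous|exact: ht_cont].
exact: continuous_expR.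
Qed.

Lemma W_gt0 e v : 0 < W e v. Proof. exact: expR_gt0. Qed.

Lemma W_primitive e x : 0 <= x ->
  is_derive x 1 (fun y => expR (- (e * ln (4 + y)))) (- (e * W e x)) /\
  W e x * (4 + x) = expR (- (e * ln (4 + x))).
Proof.
move=> x0; have p0 : 0 < 4 + x by lra.
have WE : W e x * (4 + x) = expR (- (e * ln (4 + x))).
  rewrite /decay /ht (ger0_norm x0) -{2}[4 + x](@lnK R) ?posrE// -expRD; congr expR; ring.
split; last exact: WE.
have d : is_derive x 1 (fun y => ln (4 + y)) ((4 + x)^-1 * (0 + 1)).
  exact: (@rdln _ (fun y => 4 + y) x _ p0 (rdD (rdc 4 x) (rdid x))).
apply: (rd_eq (rdexp (rdN (rdM (rdc e x) d)))).
by rewrite -WE; field; rewrite gt_eqF.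
Qed.

Lemma iint_W e T : 0 < e -> 0 <= T -> iint (W e) T <= e^-1.
Proof.
move=> e0 T0.
have d x : 0 <= x <= T -> is_derive x 1 (fun y => - e^-1 * expR (- (e * ln (4 + y)))) (W e x).
  move=> /andP[x0 _]; have [d _] := W_primitive e x0.
  by apply: (rd_eq (rdM (rdc _ _) d)); field; rewrite gt_eqF.
rewrite (iintE (@W_cont e) T0 d) addr0 !mulNr opprK addrC.
apply: (@le_trans _ _ (e^-1 * expR (- (e * ln 4)))).
  by rewrite gerBl mulr_ge0 ?expR_ge0// invr_ge0 ltW.
rewrite ler_piMr ?invr_ge0 ?(ltW e0)// -[leRHS]expR0 ler_expR oppr_le0 mulr_ge0 ?(ltW e0)//.
by rewrite ln_ge0//; lra.
Qed.

(** Cauchy-Schwarz in the pointwise form |f| <= L/2 + f^2/(2L), followed by partial integration of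
    the mean square against the weight. *)
Lemma weighted_l1 (f : R -> R) (L e : R) : continuous f -> 0 < L -> 0 < e ->
  (forall T, 1 <= T -> iint (fun v => f v ^+ 2) T <= L ^+ 2 * T) ->
  forall T, 0 <= T -> iint (fun v => `|f v| * W e v) T <= L * (1 + e^-1).
Proof.
move=> fc L0 e0 HB T T0.
have f2c : continuous (fun v => f v ^+ 2).
  have -> : (fun v => f v ^+ 2) = (fun v => f v * f v) by apply/funext => v; rewrite expr2.
  exact: continuous_mul.
have f2W : continuous (fun v => f v ^+ 2 * W e v).
  by apply: continuous_mul => //; exact: W_cont.
have fW : continuous (fun v => `|f v| * W e v).
  apply: (@continuous_mul (fun v => `|f v|)); last exact: W_cont.
  move=> v; apply: (@continuous_comp _ _ _ f (@Num.norm _ R)); first exact: fc.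
  exact: (@norm_continuous R R).
have L2 : 0 < L ^+ 2 by rewrite exprn_gt0.
have psi x : 0 <= x -> iint (fun v => f v ^+ 2) x <= L ^+ 2 * (4 + x).
  move=> x0; have [x1|x1] := leP 1 x.
    by apply: le_trans (HB x x1) _; rewrite ler_wpM2l ?(ltW L2)//; lra.
  apply: (@le_trans _ _ (iint (fun v => f v ^+ 2) 1)).
    apply: (@mvt_nondecr R _ (fun v => f v ^+ 2)); first exact: ltW.
      by move=> y /andP[xy _]; apply: iint_deriv => //; exact: le_trans xy.
    by move=> y _; exact: sqr_ge0.
  by apply: le_trans (HB 1 (lexx _)) _; rewrite ler_wpM2l ?(ltW L2)//; lra.
have sq : iint (fun v => f v ^+ 2 * W e v) T <= L ^+ 2 * (2 + e^-1).
  pose G y := expR (- (e * ln (4 + y))).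
  pose Ps := iint (fun v => f v ^+ 2).
  pose c := (1 + e) * L ^+ 2.
  have c0 : 0 <= c by rewrite mulr_ge0 ?(ltW L2)// addr_ge0// ltW.
  have dW x : 0 <= x -> is_derive x 1 (fun y => (4 + y)^-1 * G y) (- ((1 + e) * (W e x / (4 + x)))).
    move=> x0; have [d WE] := W_primitive e x0.
    have p0 : 0 < 4 + x by lra.
    have d2 : is_derive x 1 (fun y : R => 4 + y) (0 + 1) by exact: (rdD (rdc 4 x) (rdid x)).
    apply: (rd_eq (rdM (rdV _ d2) d)); first by rewrite gt_eqF.
    by rewrite -WE; field; rewrite gt_eqF.
  have WG x : 0 <= x -> (4 + x)^-1 * G x = W e x.
    move=> x0; have [_ WE] := W_primitive e x0; rewrite /G -WE; field.
    by rewrite gt_eqF//; lra.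
  pose D x := f x ^+ 2 * ((4 + x)^-1 * G x) + Ps x * - ((1 + e) * (W e x / (4 + x))) +
    c * W e x + - (f x ^+ 2 * W e x).
  (* Partial integration as monotonicity: the derivative is (1+e) W/(4+x) times L^2 (4+x) - Ps,
     nonnegative by [psi]. The product [(4 + x)^-1 * G x] is the weight W on x >= 0. *)
  have := @mvt_nondecr R (fun x => Ps x * ((4 + x)^-1 * G x) + c * iint (W e) x +
    - iint (fun v => f v ^+ 2 * W e v) x) D 0 T T0.
  rewrite /Ps !iint0 mul0r mulr0 oppr0 !addr0 => H.
  have {}H := H _ _.
  have : 0 <= iint (fun v => f v ^+ 2) T * ((4 + T)^-1 * G T) + c * iint (W e) T
       - iint (fun v => f v ^+ 2 * W e v) T.
    apply: H => x /andP[x0 _].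
      apply: rdD; last by apply: rdN; exact: iint_deriv.
      apply: rdD; first by apply: rdM; [exact: iint_deriv|exact: dW].
      by apply: (rd_eq (rdM (rdc c x) (iint_deriv (@W_cont e) x0))); rewrite mul0r add0r.
    rewrite /D (WG x x0).
    have p0 : 0 < 4 + x by lra.
    have -> : f x ^+ 2 * W e x + Ps x * - ((1 + e) * (W e x / (4 + x))) + c * W e x + - (f x ^+ 2 * W e x) =
      (1 + e) * W e x / (4 + x) * (L ^+ 2 * (4 + x) - Ps x) by rewrite /c; field; rewrite gt_eqF.
    rewrite mulr_ge0 ?subr_ge0 ?psi// divr_ge0 ?(ltW p0)// mulr_ge0 ?(ltW (W_gt0 _ _))//.
    by rewrite addr_ge0// ltW.
  have p0 : 0 < 4 + T by lra.
  have G1 : G T <= 1.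
    rewrite -[leRHS]expR0 ler_expR oppr_le0 mulr_ge0 ?(ltW e0)//.
    by rewrite ln_ge0//; lra.
  have h1 : iint (fun v => f v ^+ 2) T * ((4 + T)^-1 * G T) <= L ^+ 2.
    apply: (@le_trans _ _ (L ^+ 2 * (4 + T) * ((4 + T)^-1 * G T))).
      by rewrite ler_wpM2r ?psi// mulr_ge0 ?expR_ge0// invr_ge0 ltW.
    by rewrite mulrA mulfK ?gt_eqF// ler_piMr// ltW.
  have h2 : c * iint (W e) T <= L ^+ 2 * (1 + e^-1).
    apply: le_trans (ler_wpM2l c0 (iint_W e0 T0)) _.
    by rewrite /c le_eqVlt; apply/orP; left; apply/eqP; field; rewrite gt_eqF.
  lra.
apply: (@le_trans _ _ (iint (fun v => (L / 2) * W e v + (L^-1 / 2) * (f v ^+ 2 * W e v)) T)).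
  apply: iint_le => //.
    by apply: continuous_add; apply: continuous_cM => //; exact: W_cont.
  move=> x _.
  have -> : L / 2 * W e x + L^-1 / 2 * (f x ^+ 2 * W e x) =
    (L / 2 + L^-1 / 2 * f x ^+ 2) * W e x by ring.
  rewrite ler_wpM2r ?(ltW (W_gt0 _ _))// -[f x ^+ 2](real_normK (num_real _)).
  have : 0 <= L^-1 / 2 * (L - `|f x|) ^+ 2 by rewrite mulr_ge0 ?sqr_ge0// divr_ge0// invr_ge0 ltW.
  have -> : L^-1 / 2 * (L - `|f x|) ^+ 2 = L / 2 + L^-1 / 2 * `|f x| ^+ 2 - `|f x|.
    by field; rewrite gt_eqF.
  by rewrite subr_ge0.
rewrite (iintD (continuous_cM (@W_cont e)) (continuous_cM f2W) T0).
rewrite (iintZ _ (@W_cont e) T0) (iintZ _ f2W T0).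
have -> : L * (1 + e^-1) = L / 2 * e^-1 + L^-1 / 2 * (L ^+ 2 * (2 + e^-1)) by field; rewrite !gt_eqF.
apply: lerD; apply: ler_wpM2l => //; [|exact: iint_W|].
  by rewrite divr_ge0// ltW.
by rewrite divr_ge0// invr_ge0 ltW.
Qed.

(** Interpolates between |e^z - 1| << |z| near 0 and the trivial bound. With z = th w, giving up the
    small power b of th leaves enough decay in w for convergence. *)
Lemma cexp_sub1_pow (z : C) (b : R) : z != 0 -> 0 <= b <= 1 -> re z <= 1 ->
  cm (cexp z - 1) <= (expR 1 + 1) * expR ((1 - b) * ln (cm z)).
Proof.
move=> z0 /andP[b0 b1] zr; have cz : 0 < cm z by rewrite cm_gt0.
have e1 : 0 <= expR 1 + 1 :> R by rewrite addr_ge0 ?expR_ge0.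
have [le1|gt1] := leP (cm z) 1.
  have ln0 : ln (cm z) <= 0 by exact: ln_le0.
  apply: le_trans (cexp1_bound _) _; rewrite mulrC; apply: ler_pM; rewrite ?expR_ge0 ?cm_ge0//.
    have : expR (cm z) <= expR 1 by rewrite ler_expR.
    lra.
  rewrite -{1}(lnK cz) ler_expR mulrBl mul1r lerDl oppr_ge0 mulr_ge0_le0//.
apply: le_trans (cmB _ _) _; rewrite cm1 cm_cexp -[leLHS]mulr1.
apply: ler_pM; rewrite ?addr_ge0 ?expR_ge0 ?lerD2r ?ler_expR//.
by rewrite -[leLHS]expR0 ler_expR mulr_ge0 ?subr_ge0// ln_ge0// ltW.
Qed.

Lemma pker_diff_bound (Y th e s v : R) : 2^-1 <= s <= 1 -> 0 <= v -> 0 < th <= 1 ->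
  0 <= e <= 2^-1 ->
  cm (pker (Y + th) (s +i* v) - pker Y (s +i* v) : C) <=
  (expR 1 + 1) * expR (2 * ln 9) * expR (Y * s) * expR ((1 - 2 * e) * ln th) *
    expR (- ((1 + 2 * e) * ht v)).
Proof.
move=> /andP[s2 s1] v0 /andP[th0 th1] /andP[e0 e2]; set w : C := s +i* v.
have s0 : 0 < s by apply: lt_le_trans s2; rewrite invr_gt0.
have ws : s <= cm w by exact: cm_ge_rec (ltW s0).
have wv : v <= cm w by exact: cm_ge_im.
have w0 : 0 < cm w by exact: lt_le_trans ws.
have wn : w != 0 by rewrite -cm_gt0.
have z0 : th%:C * w != 0 by rewrite -cm_gt0 cmM cm_real gtr0_norm// mulr_gt0.
have -> : pker (Y + th) w - pker Y w = cexp (Y%:C * w) * (cexp (th%:C * w) - 1) * w ^- 2.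
  by rewrite /pker rmorphD/= mulrDl cexpD; ring.
rewrite (cmM (_ * (cexp (th%:C * w) - 1))) cmV cmX (cmM (cexp (Y%:C * w))) cm_cexp (reZ Y) /=.
have b01 : 0 <= 2 * e <= 1 by apply/andP; split; lra.
have rz : re (th%:C * w) <= 1 by rewrite (reZ th) /= mulr_ile1// ltW.
have h := cexp_sub1_pow z0 b01 rz.
(* 4 + v <= 9 |w|, from |w| >= 1/2 and |w| >= v. *)
have lw : ht v - ln 9 <= ln (cm w).
  rewrite -ln_div ?posrE ?ht_pos// ler_ln ?posrE ?divr_gt0 ?ht_pos// ler_pdivrMr// (ger0_norm v0).
  lra.
have Ew : (cm w ^+ 2)^-1 = expR (- (2 * ln (cm w))).
  rewrite expRN; congr (_^-1); have -> : 2 * ln (cm w) = ln (cm w) + ln (cm w) by ring.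
  by rewrite expRD lnK// expr2.
rewrite cmM cm_real (gtr0_norm th0) lnM ?posrE// in h.
have -> : (expR 1 + 1) * expR (2 * ln 9) * expR (Y * s) * expR ((1 - 2 * e) * ln th) *
    expR (- ((1 + 2 * e) * ht v)) = expR (Y * s) * ((expR 1 + 1) *
    (expR (2 * ln 9) * expR ((1 - 2 * e) * ln th) * expR (- ((1 + 2 * e) * ht v)))) by ring.
rewrite -[leLHS]mulrA; apply: ler_wpM2l; first exact: expR_ge0.
apply: le_trans (ler_wpM2r _ h) _; first by rewrite invr_ge0 sqr_ge0.
rewrite -[leLHS]mulrA; apply: ler_wpM2l; first by rewrite addr_ge0 ?expR_ge0.
rewrite Ew -!expRD ler_expR.
have l9 : 0 <= ln 9 :> R by rewrite ln_ge0//; lra.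
have k1 : (1 + 2 * e) * (ht v - ln 9) <= (1 + 2 * e) * ln (cm w) by rewrite ler_wpM2l//; lra.
have k2 : 2 * e * ln 9 <= 1 * ln 9 by rewrite ler_wpM2r//; lra.
lra.
Qed.

Definition tends (f : R -> R) (l : R) :=
  forall e : R, 0 < e -> exists T0 : R, forall T, T0 <= T -> `|f T - l| <= e.

Lemma tendsD f g l m : tends f l -> tends g m -> tends (fun T => f T + g T) (l + m).
Proof.
move=> F G e e0; have e20 : 0 < e / 2 by rewrite divr_gt0.
have [T1 H1] := F _ e20; have [T2 H2] := G _ e20.
exists (Num.max T1 T2) => T; rewrite ge_max => /andP[/H1 h1 /H2 h2].
have -> : f T + g T - (l + m) = (f T - l) + (g T - m) by ring.
by apply: le_trans (ler_normD _ _) _; lra.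
Qed.

Lemma tendsZ (c : R) f l : tends f l -> tends (fun T => c * f T) (c * l).
Proof.
move=> F e e0; have c1 : 0 < `|c| + 1 by rewrite ltr_wpDl.
have [T1 H1] := F (e / (`|c| + 1)) (divr_gt0 e0 c1).
exists T1 => T /H1 h; rewrite -mulrBr normrM.
apply: le_trans (ler_wpM2l (normr_ge0 _) h) _.
by rewrite mulrCA ler_piMr ?(ltW e0)// ler_pdivrMr// mul1r lerDl.
Qed.

Lemma tends_sum (r : seq nat) (f : nat -> R -> R) (l : nat -> R) :
  (forall d, d \in r -> tends (f d) (l d)) ->
  tends (fun T => \sum_(d <- r) f d T) (\sum_(d <- r) l d).
Proof.
elim: r => [_|d r IH H].
  have -> : (fun T => \sum_(d <- [::]) f d T) = fun=> 0.
    by apply/funext => T; rewrite big_nil.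
  by rewrite big_nil => e e0; exists 0 => T _; rewrite subrr normr0 ltW.
have -> : (fun T => \sum_(i <- d :: r) f i T) = (fun T => f d T + \sum_(i <- r) f i T).
  by apply/funext => T; rewrite big_cons.
rewrite big_cons; apply: tendsD; first by apply: H; rewrite mem_head.
by apply: IH => i ir; apply: H; rewrite inE ir orbT.
Qed.

Lemma tends_bound f l B : tends f l -> (forall T, 1 <= T -> `|f T| <= B) -> `|l| <= B.
Proof.
move=> F fB; apply/ler_addgt0Pl => e e0; have [T0 H] := F e e0.
have := H (Num.max T0 1); rewrite le_max lexx => /(_ isT) h1.
have := fB (Num.max T0 1); rewrite le_max lexx orbT => /(_ isT) h2.
move: h1 h2; set y := f _; rewrite !ler_norml => /andP[? ?] /andP[? ?].
by apply/andP; split; lra.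
Qed.

Hypothesis RH : generalized_riemann_hypothesis R.

(** K is kept apart from n, because the difference between n = N + K and n = N is taken with the
    same range of d. *)
Definition logmean (g : nat -> R) (K n : nat) : R :=
  \sum_(1 <= d < K.+1) g d *
    \sum_(1 <= m < (n %/ d).+1) (moebius m)%:~R * (ln n%:R - ln d%:R - ln m%:R).

Lemma logmean_limit (g : nat -> R) (K n : nat) (s : R) : 2^-1 < s <= 2 -> (K <= n)%N ->
  tends (fun T => \sum_(1 <= d < K.+1) g d *
    iint (fun v => re (pker (ln n%:R - ln d%:R) (s +i* v) * invzeta (s +i* v))) T)
    (pi * logmean g K n).
Proof.
move=> ss Kn; rewrite /logmean mulr_sumr; apply: tends_sum => d; rewrite mem_index_iota ltnS => /andP[d0 dK].
rewrite mulrCA; apply: tendsZ => e e0.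
have dn := leq_trans dK Kn.
have n0 : (0 < n)%N by exact: leq_trans dn.
have d0' : 0 < d%:R :> R by rewrite ltr0n.
have n0' : 0 < n%:R :> R by rewrite ltr0n.
apply: (@moebius_log_limit R RH s (ln n%:R - ln d%:R) (n %/ d)) => //.
- by rewrite subr_ge0 ler_ln ?posrE// ler_nat.
- move=> m /andP[m0 mM]; rewrite lerBrDr -lnM ?posrE ?ltr0n// -natrM ler_ln ?posrE ?ltr0n ?muln_gt0 ?m0//.
  by rewrite ler_nat -leq_divRL.
- move=> m mM; have m0 : (0 < m)%N by exact: leq_ltn_trans mM.
  rewrite lerBlDr -lnM ?posrE ?ltr0n// -natrM ler_ln ?posrE ?ltr0n ?muln_gt0 ?m0//.
  by rewrite ler_nat ltnW// -ltn_divLR.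
Qed.

End SmoothedBound.

(** * Logarithmic means over a short interval *)

Section LogMeanDifference.
Context {R : realType}.
Local Notation C := R[i].
Hypothesis RH : generalized_riemann_hypothesis R.

Definition dsum (g : nat -> R) (K : nat) (w : C) : C :=
  \sum_(1 <= d < K.+1) (g d)%:C * natcpow d (- w).

Lemma hol2_dsum lo g K : hol2 lo (dsum g K).
Proof.
by apply: hol2_sum => d; apply: hol2M; [exact: hol2c|exact: hol2_natcpow].
Qed.

Lemma logmean_integral (g : nat -> R) (K : nat) (Y s T : R) : 2^-1 < s -> 0 <= T ->
  \sum_(1 <= d < K.+1) g d *
    iint (fun v => re (pker (Y - ln d%:R) (s +i* v) * invzeta (s +i* v))) T =
  iint (fun v => re (pker Y (s +i* v) * (dsum g K (s +i* v) * invzeta (s +i* v)))) T.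
Proof.
move=> s2 T0.
have Hi := hol2_invzeta RH.
have Hk (L : R) : hol2 2^-1 (pker L) by apply: (hol2_le _ (hol2_pker L)); rewrite invr_ge0.
have c d := hol2_cont (hol2M (Hk (Y - ln d%:R)) Hi) s2.
rewrite (eq_bigr (fun d : nat => iint (fun v => g d * re (pker (Y - ln d%:R) (s +i* v) * invzeta (s +i* v))) T)); last first.
  by move=> d _; rewrite (iintZ _ (c d) T0).
have gc d := continuous_cM (c := g d) (c d).
rewrite -(iint_sum _ _ gc T0); congr iint; apply/funext => v.
rewrite /dsum mulr_suml mulr_sumr re_sum; apply: eq_bigr => d _.
by rewrite -pker_natcpow -reZ; congr re; ring.
Qed.

Lemma logmean_diff (eta e : R) : 0 < eta -> eta <= 8^-1 -> 0 < e -> e <= 2^-1 ->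
  exists2 c : R, 0 < c &
  forall (g : nat -> R) (A P : R) (K N : nat), (0 < K)%N -> (K <= N)%N ->
  (forall n, `|g n| <= A) -> A <= P -> 0 < P ->
  (forall n, `|\sum_(1 <= d < n.+1) g d| <= P) ->
  `|logmean g K (N + K) - logmean g K N| <=
    c * (P * (1 + ln K%:R) * expR ((2^-1 + 3 * eta) * ln N%:R) *
    expR ((1 - 2 * e) * ln (ln (N + K)%N%:R - ln N%:R))).
Proof.
move=> eta0 eta8 e0 e2; have [K1 K10 HK1] := invzeta_growth RH eta0 eta8 e0.
pose c0 : R := (expR 1 + 1) * expR (2 * ln 9).
have c00 : 0 < c0 by rewrite mulr_gt0 ?expR_gt0// addr_gt0 ?expR_gt0.
have ei : 0 < 1 + e^-1 by rewrite addr_gt0// invr_gt0.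
exists (pi^-1 * (c0 * K1 * (40 * (1 + e^-1)))).
  apply: mulr_gt0; first by rewrite invr_gt0 pi_gt0.
  by apply: mulr_gt0; apply: mulr_gt0.
move=> g A P K N K0 KN gA AP P0 SP.
set s := 2^-1 + 3 * eta; set th := ln (N + K)%N%:R - ln N%:R.
have s2 : 2^-1 < s by rewrite ltrDl mulr_gt0.
have s2' := ltW s2.
have s1 : s <= 1 by rewrite /s; lra.
have N0 : (0 < N)%N := leq_trans K0 KN.
have N0' : 0 < N%:R :> R by rewrite ltr0n.
have NK0' : 0 < (N + K)%N%:R :> R by rewrite ltr0n addn_gt0 N0.
have K0' : 0 < K%:R :> R by rewrite ltr0n.
have th0 : 0 < th by rewrite subr_gt0 ltr_ln ?posrE// ltr_nat -[X in (X < _)%N]addn0 ltn_add2l.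
have th1 : th <= 1.
  have h1 : -1 < K%:R / N%:R :> R.
    by apply: (@lt_le_trans _ _ 0); rewrite ?ltrN10// divr_ge0.
  have := le_ln1Dx h1.
  have -> : 1 + K%:R / N%:R = (N + K)%N%:R / N%:R :> R by rewrite natrD; field; rewrite gt_eqF.
  rewrite ln_div ?posrE// -/th => /le_trans; apply.
  by rewrite ler_pdivrMr// mul1r ler_nat.
have lK : 0 <= ln K%:R :> R by rewrite ln_ge0// ler1n.
(* 40^2 = 1600 covers the 1400 of [dsum_mean], and squaring 1 + ln K only enlarges it. *)
pose L : R := 40 * (P * (1 + ln K%:R)).
have L0 : 0 < L by rewrite mulr_gt0// mulr_gt0// ltr_pwDl.
have s22 : 2^-1 < s <= 2 by rewrite s2/=; lra.
have lim1 := logmean_limit RH g s22 (leq_trans KN (leq_addr K N)).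
have lim0 := logmean_limit RH g s22 KN.
have lim := tendsD lim1 (tendsZ (-1) lim0).
have Hi := hol2_invzeta RH.
have Hk (Y : R) : hol2 2^-1 (pker Y) by apply: (hol2_le _ (hol2_pker Y)); rewrite invr_ge0.
have HDi := hol2M (hol2_dsum 2^-1 g K) Hi.
have cD := hol2_cont_cm (hol2_dsum 2^-1 g K) s2.
pose E := c0 * expR (s * ln N%:R) * expR ((1 - 2 * e) * ln th) * K1.
have E0 : 0 <= E by rewrite !mulr_ge0 ?expR_ge0 ?(ltW K10) ?(ltW c00).
have B T : 1 <= T -> `|\sum_(1 <= d < K.+1) g d *
    iint (fun v => re (pker (ln (N + K)%N%:R - ln d%:R) (s +i* v) * invzeta (s +i* v))) T +
    -1 * (\sum_(1 <= d < K.+1) g d *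
    iint (fun v => re (pker (ln N%:R - ln d%:R) (s +i* v) * invzeta (s +i* v))) T)| <=
    E * (L * (1 + e^-1)).
  move=> T1; have T0 : 0 <= T by lra.
  rewrite !logmean_integral//.
  have ck Y := hol2_cont (hol2M (Hk Y) HDi) s2.
  rewrite -(iintZ _ (ck (ln N%:R)) T0) -(iintD (ck _) (continuous_cM (ck _)) T0).
  have cW : continuous (fun v => `|cm (dsum g K (s +i* v))| * decay e v).
    have -> : (fun v => `|cm (dsum g K (s +i* v))| * decay e v) = (fun v => cm (dsum g K (s +i* v)) * decay e v).
      by apply/funext => v; rewrite ger0_norm ?cm_ge0.
    by apply: continuous_mul; [exact: cD|exact: W_cont].
  apply: (@le_trans _ _ (iint (fun v => E * (`|cm (dsum g K (s +i* v))| * decay e v)) T)).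
    apply: iint_abs => //.
    - by apply: continuous_add; [exact: ck|exact: (continuous_cM (ck _))].
    - exact: (continuous_cM cW).
    move=> v /andP[v0 _]; set w : C := s +i* v.
    have -> : re (pker (ln (N + K)%N%:R) w * (dsum g K w * invzeta w)) +
        -1 * re (pker (ln N%:R) w * (dsum g K w * invzeta w)) =
        re ((pker (ln N%:R + th) w - pker (ln N%:R) w) * (dsum g K w * invzeta w)).
      by rewrite mulN1r -reB -mulrBl; congr (re ((pker _ w - _) * _)); rewrite /th addrC subrK.
    apply: le_trans (cm_re _) _.
    rewrite (cmM (pker (ln N%:R + th) w - pker (ln N%:R) w)) (cmM (dsum g K w)).
    have h1 : cm (pker (ln N%:R + th) w - pker (ln N%:R) w) <=
        c0 * expR (s * ln N%:R) * expR ((1 - 2 * e) * ln th) * expR (- ((1 + 2 * e) * ht v)).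
      rewrite /c0 [s * _]mulrC; apply: pker_diff_bound => //; first by rewrite s2' s1.
        by rewrite th0 th1.
      by rewrite (ltW e0) e2.
    have h2 : cm (invzeta w) <= K1 * expR (e * ht v) by apply: HK1.
    have -> : E * (`|cm (dsum g K w)| * decay e v) =
      (c0 * expR (s * ln N%:R) * expR ((1 - 2 * e) * ln th) * expR (- ((1 + 2 * e) * ht v))) *
      (cm (dsum g K w) * (K1 * expR (e * ht v))).
      have -> : decay e v = expR (- ((1 + 2 * e) * ht v)) * expR (e * ht v).
        by rewrite /decay -expRD; congr expR; ring.
      by rewrite ger0_norm ?cm_ge0// /E; ring.
    apply: ler_pM => //; rewrite ?cm_ge0 ?mulr_ge0 ?cm_ge0//.
    by apply: ler_wpM2l => //; exact: cm_ge0.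
  rewrite (iintZ _ cW T0); apply: ler_wpM2l => //.
  apply: weighted_l1 => // T' T1'.
  apply: le_trans (dsum_mean gA AP s2' s1 SP K0 T1') _.
  have l2 : 1 + ln K%:R <= (1 + ln K%:R) ^+ 2 :> R by rewrite expr2 ler_peMl ?addr_ge0// lerDl.
  have p0 : 0 <= P ^+ 2 * (1 + ln K%:R) * T' by rewrite !mulr_ge0 ?sqr_ge0 ?addr_ge0//; lra.
  have : P ^+ 2 * (1 + ln K%:R) * T' <= P ^+ 2 * (1 + ln K%:R) ^+ 2 * T'.
    by rewrite ler_wpM2r//; [lra|rewrite ler_wpM2l ?sqr_ge0].
  have -> : L ^+ 2 * T' = 1600 * (P ^+ 2 * (1 + ln K%:R) ^+ 2 * T') by rewrite /L; ring.
  have -> : 1400 * P ^+ 2 * (1 + ln K%:R) * T' = 1400 * (P ^+ 2 * (1 + ln K%:R) * T') by ring.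
  move: p0; move: (P ^+ 2 * _ * T') (P ^+ 2 * _ ^+ 2 * T') => ? ? ? ?; lra.
have := tends_bound lim B.
have -> : pi * logmean g K (N + K) + -1 * (pi * logmean g K N) =
  pi * (logmean g K (N + K) - logmean g K N) by ring.
rewrite normrM (gtr0_norm (@pi_gt0 R)) -ler_pdivlMl ?pi_gt0// => /le_trans; apply.
by rewrite le_eqVlt; apply/orP; left; apply/eqP; rewrite /E /L; ring.
Qed.

End LogMeanDifference.

(** * From logarithmic means back to the divisor sum *)

Section DivisorSum.
Context {R : realType}.
Local Notation C := R[i].

Section Coefficients.
Variables (g : nat -> R) (A : R).
Hypothesis gA : forall n, `|g n| <= A.

(** Whole periods cancel, and fewer than q terms remain. *)
Lemma period_sums_bound q : (0 < q)%N -> (forall n, g (n + q)%N = g n) ->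
  \sum_(0 <= i < q) g i = 0 -> forall n, `|\sum_(1 <= d < n.+1) g d| <= A * q%:R.
Proof.
move=> q0 gq g0.
have A0 : 0 <= A := le_trans (normr_ge0 _) (gA 0).
have per a : \sum_(a <= i < a + q) g i = 0.
  elim: a => [|a IH]; first by rewrite add0n.
  rewrite addSn; have aq : (a < (a + q).+1)%N by rewrite ltnS leq_addr.
  have := @big_ltn R 0 +%R a _ g aq; rewrite big_nat_recr ?leq_addr//= IH add0r gq.
  by move=> E; apply: (addrI (g a)); rewrite -E addr0.
move=> n; elim/ltn_ind: n => n IH; have [nq|qn] := ltnP n q.
  apply: le_trans (ler_norm_sum _ _ _) _.
  apply: (@le_trans _ _ (\sum_(1 <= d < n.+1) A)); first by apply: ler_sum.
  rewrite big_const_nat subn1 /= iter_addr addr0 -[leLHS]mulr_natr ler_wpM2l// ler_nat.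
  exact: ltnW.
rewrite (big_cat_nat (n := (n - q).+1))//=; last by rewrite ltnS leq_subr.
have -> : n.+1 = ((n - q).+1 + q)%N by rewrite addSn subnK.
by rewrite per addr0; apply: IH; rewrite ltn_subrL q0 (leq_trans q0 qn).
Qed.

Lemma moebius_norm_real m : `|(moebius m)%:~R| <= 1 :> R.
Proof. by rewrite -intr_norm -[leRHS](mulr1z (1 : R)) ler_int moebius_norm. Qed.

(** Pairs with d m <= N gain exactly th. New pairs, N < d m <= N + K, carry a weight in [0, th], and
    each d has at most K/d + 1 of them; the harmonic sum gives K (2 + ln K). *)
Lemma short_interval (K N : nat) : (0 < K)%N -> (K <= N)%N ->
  (ln (N + K)%N%:R - ln N%:R) *
    `|\sum_(1 <= d < K.+1) \sum_(1 <= m < (N %/ d).+1) (moebius m)%:~R * g d| <=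
  `|logmean g K (N + K) - logmean g K N| +
    (ln (N + K)%N%:R - ln N%:R) * (A * (K%:R * (2 + ln K%:R))).
Proof.
move=> K0 KN; have N0 : (0 < N)%N := leq_trans K0 KN.
have A0 : 0 <= A := le_trans (normr_ge0 _) (gA 0).
set th := ln (N + K)%N%:R - ln N%:R.
have N0' : 0 < N%:R :> R by rewrite ltr0n.
have NK0 : 0 < (N + K)%N%:R :> R by rewrite ltr0n addn_gt0 N0.
have th0 : 0 <= th by rewrite subr_ge0 ler_ln ?posrE// ler_nat leq_addr.
set S1 := \sum_(1 <= d < K.+1) _.
pose E d : R := \sum_((N %/ d).+1 <= m < ((N + K) %/ d).+1) (moebius m)%:~R * (ln (N + K)%N%:R - ln d%:R - ln m%:R).
have D : logmean g K (N + K) - logmean g K N = th * S1 + \sum_(1 <= d < K.+1) g d * E d.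
  rewrite /logmean /S1 mulr_sumr -sumrB -big_split/=; apply: eq_big_nat => d _.
  rewrite (big_cat_nat (n := (N %/ d).+1))//=; last by rewrite ltnS leq_div2r// leq_addr.
  rewrite -/(E d) mulrDr addrAC; congr (_ + _).
  rewrite -mulrBr -sumrB mulr_sumr mulr_sumr; apply: eq_bigr => m _.
  by rewrite /th; ring.
have EB d : (0 < d)%N -> `|E d| <= th * (K%:R / d%:R + 1).
  move=> d0; have d0' : 0 < d%:R :> R by rewrite ltr0n.
  apply: le_trans (ler_norm_sum _ _ _) _.
  apply: (@le_trans _ _ (\sum_((N %/ d).+1 <= m < ((N + K) %/ d).+1) th)).
    apply: ler_sum_nat => m /andP[Nm]; rewrite ltnS => mK.
    have m0 : (0 < m)%N by exact: leq_ltn_trans Nm.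
    have m0' : 0 < m%:R :> R by rewrite ltr0n.
    have lo : ln N%:R <= ln d%:R + ln m%:R :> R.
      by rewrite -lnM ?posrE// -natrM ler_ln ?posrE ?ltr0n ?muln_gt0 ?m0 ?d0// ler_nat mulnC ltnW// -ltn_divLR.
    have hi : ln d%:R + ln m%:R <= ln (N + K)%N%:R :> R.
      by rewrite -lnM ?posrE// -natrM ler_ln ?posrE ?ltr0n ?muln_gt0 ?m0 ?d0 ?addn_gt0 ?N0// ler_nat mulnC -leq_divRL.
    rewrite normrM -[leRHS]mul1r; apply: ler_pM => //; first exact: moebius_norm_real.
    by rewrite ger0_norm /th; lra.
  rewrite big_const_nat iter_addr addr0 -[leLHS]mulr_natr; apply: ler_wpM2l => //.
  rewrite subSS; apply: (@le_trans _ _ (K %/ d + 1)%N%:R).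
    by rewrite ler_nat leq_subLR addnA; exact: leq_divDl.
  by rewrite natrD lerD2r ler_pdivlMr// -natrM ler_nat leq_divM.
have S2 : `|\sum_(1 <= d < K.+1) g d * E d| <= th * (A * (K%:R * (2 + ln K%:R))).
  apply: le_trans (ler_norm_sum _ _ _) _.
  apply: (@le_trans _ _ (\sum_(1 <= d < K.+1) A * (th * (K%:R * d%:R^-1 + 1)))).
    apply: ler_sum_nat => d /andP[d0 _]; rewrite normrM; apply: ler_pM => //; exact: EB.
  rewrite -mulr_sumr -mulr_sumr big_split/= -mulr_sumr mulrCA.
  apply: ler_wpM2l => //; apply: ler_wpM2l => //.
  rewrite big_const_nat subn1 /= iter_addr addr0.
  have -> : K%:R * (2 + ln K%:R) = K%:R * (1 + ln K%:R) + K%:R :> R by ring.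
  rewrite lerD2r; apply: ler_wpM2l => //.
  by case: (K) K0 => // n _; exact: harmonic_le.
rewrite -{1}(ger0_norm th0) -normrM.
have -> : th * S1 = (logmean g K (N + K) - logmean g K N) - \sum_(1 <= d < K.+1) g d * E d.
  by rewrite D addrK.
by apply: le_trans (ler_normB _ _) _; rewrite lerD2l.
Qed.

(** d > K forces m <= N/d <= K. After exchanging the sums, each m sees a difference of two partial
    sums of g. *)
Lemma large_divisors P (K N : nat) : (0 < K)%N -> (N < K.+1 ^ 2)%N ->
  (forall n, `|\sum_(1 <= d < n.+1) g d| <= P) ->
  `|\sum_(K.+1 <= d < N.+1) \sum_(1 <= m < (N %/ d).+1) (moebius m)%:~R * g d| <= 2 * P * K%:R.
Proof.
move=> K0 NK SP; have P0 : 0 <= P := le_trans (normr_ge0 _) (SP 0%N).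
have -> : \sum_(K.+1 <= d < N.+1) \sum_(1 <= m < (N %/ d).+1) (moebius m)%:~R * g d =
  \sum_(K.+1 <= d < N.+1) \sum_(1 <= m < K.+1) (if (m < (N %/ d).+1)%N then (moebius m)%:~R * g d else 0).
  apply: eq_big_nat => d /andP[Kd _].
  rewrite (big_nat_widen _ _ K.+1)/=; first by rewrite big_mkcond.
  rewrite ltnS; apply: (@leq_trans (N %/ K.+1)); first exact: leq_div2l.
  by rewrite -ltnS ltn_divLR// -expnSr.
rewrite exchange_big_nat/=; apply: le_trans (ler_norm_sum _ _ _) _.
apply: (@le_trans _ _ (\sum_(1 <= m < K.+1) 2 * P)); last first.
  by rewrite big_const_nat subn1 /= iter_addr addr0 -[leLHS]mulr_natr.
apply: ler_sum_nat => m /andP[m0 _].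
have -> : \sum_(K.+1 <= d < N.+1) (if (m < (N %/ d).+1)%N then (moebius m)%:~R * g d else 0) =
   (moebius m)%:~R * \sum_(K.+1 <= d < (N %/ m).+1) g d.
  rewrite (big_nat_widen _ (N %/ m).+1 N.+1)/=; last by rewrite ltnS leq_div.
  rewrite mulr_sumr [RHS]big_mkcond/=; apply: eq_big_nat => d /andP[Kd _].
  have d0 : (0 < d)%N by exact: leq_ltn_trans Kd.
  by rewrite !ltnS !leq_divRL// mulnC.
rewrite normrM -[leRHS]mul1r; apply: ler_pM => //; first exact: moebius_norm_real.
have [Km|mK] := leqP (N %/ m) K; first by rewrite big_geq// normr0 mulr_ge0.
have -> : \sum_(K.+1 <= d < (N %/ m).+1) g d =
    \sum_(1 <= d < (N %/ m).+1) g d - \sum_(1 <= d < K.+1) g d.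
  by rewrite [in RHS](big_cat_nat (n := K.+1))//= ?ltnS 1?ltnW// addrAC subrr add0r.
by apply: le_trans (ler_normB _ _) _; have := SP (N %/ m)%N; have := SP K; lra.
Qed.

End Coefficients.
End DivisorSum.

(** * Choice of parameters *)

Section RealPeriodic.
Context {R : realType}.
Hypothesis RH : generalized_riemann_hypothesis R.

Lemma sqrt_floor N : (0 < N)%N -> exists K, [/\ (0 < K)%N, (K ^ 2 <= N)%N & (N < K.+1 ^ 2)%N].
Proof.
move=> N0; have ex : exists k, (k ^ 2 <= N)%N by exists 1%N; rewrite exp1n.
have ub k : (k ^ 2 <= N)%N -> (k <= N)%N by apply: leq_trans; case: k => // k; rewrite leq_pmulr.
have [K KN HK] := ex_maxnP ex ub; exists K; split=> //.
  by apply: HK; rewrite exp1n.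
by rewrite ltnNge; apply/negP => /HK; rewrite ltnn.
Qed.

Lemma mean_zero_sum (eps : R) : 0 < eps -> exists2 c : R, 0 < c &
  forall (g : nat -> R) (A : R) (q N : nat), 0 < A -> (0 < q)%N -> (0 < N)%N ->
  (forall n, g (n + q)%N = g n) -> \sum_(0 <= i < q) g i = 0 -> (forall n, `|g n| <= A) ->
  `|\sum_(1 <= d < N.+1) \sum_(1 <= m < (N %/ d).+1) (moebius m)%:~R * g d| <=
    c * (A * q%:R * expR ((2^-1 + eps) * ln N%:R)).
Proof.
(* The exponent loses 5e: 3e by the position of the line, e by 1 + ln K, and e by th^(-2e) with th
   of order N^(-1/2). *)
move=> eps0; pose e := Num.min 8^-1 (eps / 5).
have e0 : 0 < e by rewrite lt_min; apply/andP; split; [rewrite invr_gt0|rewrite divr_gt0].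
have e8 : e <= 8^-1 by rewrite ge_min lexx.
have e5 : 5 * e <= eps by have : e <= eps / 5 by [rewrite ge_min lexx orbT]; lra.
have e2 : e <= 2^-1 by lra.
have [c c0 Hc] := logmean_diff RH e0 e8 e0 e2.
pose b : R := 1 + e^-1; have b1 : 1 <= b by rewrite lerDl invr_ge0 ltW.
have b0 : 0 < b by lra.
exists (8 * (c * b) + 2 * b + 2).
  by rewrite !addr_gt0// !mulr_gt0.
move=> g A q N A0 q0 N0 gq g0 gA.
have [K [K0 KN NK]] := sqrt_floor N0.
have SP := period_sums_bound gA q0 gq g0.
set P := A * q%:R in SP *.
have q1 : 1 <= q%:R :> R by rewrite ler1n.
have q0' : 0 < q%:R :> R by rewrite ltr0n.
have AP : A <= P by rewrite /P -[leLHS]mulr1 ler_pM2l.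
have P0 : 0 < P by lra.
have KleN : (K <= N)%N by apply: leq_trans KN; rewrite expnS expn1 leq_pmulr.
pose x : R := ln N%:R.
have x0 : 0 <= x by rewrite ln_ge0// ler1n.
have N0' : 0 < N%:R :> R by rewrite ltr0n.
have K0' : 0 < K%:R :> R by rewrite ltr0n.
have NK0 : 0 < (N + K)%N%:R :> R by rewrite ltr0n addn_gt0 N0.
have lK0 : 0 <= ln K%:R :> R by rewrite ln_ge0// ler1n.
have Kx : K%:R <= expR (2^-1 * x).
  rewrite -(@ler_pXn2r _ 2) ?nnegrE ?expR_ge0//.
  have -> : expR (2^-1 * x) ^+ 2 = N%:R.
    by rewrite expr2 -expRD -[RHS](lnK N0'); congr expR; rewrite -/x; field.
  by rewrite -natrX ler_nat.
have lb : 1 + ln K%:R <= b * expR (e * x).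
  have : ln K%:R <= x by rewrite ler_ln ?posrE// ler_nat.
  have h1 : 1 + e * x <= expR (e * x) by exact: expR_ge1Dx.
  have h2 : x <= expR (e * x) / e by rewrite ler_pdivlMr// mulrC; lra.
  have h3 : 1 <= expR (e * x) by have : 0 <= e * x by [rewrite mulr_ge0// ltW]; lra.
  have -> : b * expR (e * x) = expR (e * x) + expR (e * x) / e by rewrite /b; ring.
  by lra.
pose th : R := ln (N + K)%N%:R - ln N%:R.
(* th >= K/(N+K) >= 1/(8 sqrt N), where N + K <= 8 K^2 since N < (K+1)^2 <= 4 K^2. *)
have thlo : - (ln 8 + 2^-1 * x) <= ln th.
  have h : K%:R / (N + K)%N%:R <= th.
    have := @ln_ratio_ge R N (N + K) ; rewrite N0 -[X in (X < _)%N]addn0 ltn_add2l K0 addKn.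
    exact.
  have h0 : 0 < K%:R / (N + K)%N%:R :> R by rewrite divr_gt0.
  have h2 : expR (- (ln 8 + 2^-1 * x)) <= K%:R / (N + K)%N%:R.
    have l8 : 0 < 8 :> R by lra.
    rewrite expRN expRD lnK ?posrE//.
    apply: (@le_trans _ _ (8 * K%:R)^-1).
      by rewrite lef_pV2 ?posrE ?mulr_gt0 ?expR_gt0// ler_pM2l.
    rewrite ler_pdivlMr// ler_pdivrMl ?mulr_gt0//.
    have -> : 8 * K%:R * K%:R = (8 * K ^ 2)%N%:R :> R by rewrite natrM natrX expr2 mulrA.
    rewrite ler_nat.
    have h3 : (N <= 4 * K ^ 2)%N.
      rewrite (leq_trans (ltnW NK))// (_ : 4 = 2 ^ 2)%N// -expnMn leq_exp2r//.
      by rewrite -addn1 mulSn mul1n leq_add2l.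
    rewrite (_ : 8 = 4 + 4)%N// mulnDl; apply: leq_add => //; exact: leq_trans h3.
  by rewrite -ler_expR; apply: le_trans h2 _; rewrite lnK ?posrE// (lt_le_trans h0).
have th0 : 0 < th by rewrite subr_gt0 ltr_ln ?posrE// ltr_nat -[X in (X < _)%N]addn0 ltn_add2l.
pose X := expR ((2^-1 + eps) * x).
have X0 : 0 < X by exact: expR_gt0.
rewrite (big_cat_nat (n := K.+1))//=.
apply: le_trans (ler_normD _ _) _.
have L := large_divisors K0 NK SP.
have SI := short_interval gA K0 KleN.
have D := Hc g A P K N K0 KleN gA AP P0 SP.
rewrite -/th -/x in SI D.
move: L SI; set S1 := \sum_(1 <= d < K.+1) _; set S2 := \sum_(K.+1 <= d < N.+1) _ => L SI.
have XK : K%:R <= X.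
  apply: le_trans Kx _; rewrite ler_expR ler_wpM2r// lerDl; exact: ltW.
have LX : `|S2| <= 2 * (P * X).
  by apply: le_trans L _; rewrite -mulrA ler_pM2l// ler_pM2l.
have S1X : `|S1| <= 8 * (c * b) * (P * X) + 2 * b * (P * X).
  rewrite -(ler_pM2l th0); apply: le_trans SI _; rewrite [leRHS]mulrDr; apply: lerD.
    apply: le_trans D _.
    have -> : expR ((1 - 2 * e) * ln th) = th * expR (- (2 * e) * ln th).
      by rewrite mulrBl mul1r expRD lnK ?posrE// mulNr.
    have h1 : expR (- (2 * e) * ln th) <= 8 * expR (e * x).
      have l8 : 0 < 8 :> R by lra.
      rewrite -{1}(@lnK R 8) ?posrE// -expRD ler_expR.
      have : - (2 * e) * ln th <= (2 * e) * (ln 8 + 2^-1 * x).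
        by rewrite mulNr -mulrN ler_wpM2l ?mulr_ge0 ?(ltW e0)// lerNl.
      have : 2 * e * ln 8 <= 1 * ln 8 by rewrite ler_wpM2r//; [rewrite ln_ge0|]; lra.
      lra.
    have h2 : expR (e * x) * expR ((2^-1 + 3 * e) * x) * expR (e * x) <= X.
      rewrite -!expRD ler_expR; have : 5 * e * x <= eps * x by rewrite ler_wpM2r.
      lra.
    have -> : c * (P * (1 + ln K%:R) * expR ((2^-1 + 3 * e) * x) * (th * expR (- (2 * e) * ln th))) =
      th * (c * P * ((1 + ln K%:R) * expR ((2^-1 + 3 * e) * x) * expR (- (2 * e) * ln th))) by ring.
    rewrite ler_pM2l//.
    have -> : 8 * (c * b) * (P * X) = c * P * (8 * b * X) by ring.
    rewrite ler_pM2l ?mulr_gt0//.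
    apply: (@le_trans _ _ (b * expR (e * x) * expR ((2^-1 + 3 * e) * x) * (8 * expR (e * x)))).
      apply: ler_pM => //; rewrite ?expR_ge0 ?mulr_ge0 ?expR_ge0 ?addr_ge0//.
      by rewrite ler_wpM2r ?expR_ge0.
    have -> : b * expR (e * x) * expR ((2^-1 + 3 * e) * x) * (8 * expR (e * x)) =
      8 * b * (expR (e * x) * expR ((2^-1 + 3 * e) * x) * expR (e * x)) by ring.
    by apply: ler_wpM2l => //; rewrite mulr_ge0// ltW.
  rewrite ler_pM2l//.
  have -> : 2 * b * (P * X) = P * (2 * b * X) by ring.
  apply: ler_pM => //; rewrite ?(ltW A0) ?mulr_ge0 ?addr_ge0//.
  apply: (@le_trans _ _ (expR (2^-1 * x) * (2 * (b * expR (e * x))))).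
    apply: ler_pM => //; rewrite ?addr_ge0//; lra.
  have -> : expR (2^-1 * x) * (2 * (b * expR (e * x))) = 2 * b * (expR (2^-1 * x) * expR (e * x)) by ring.
  apply: ler_wpM2l; first by rewrite mulr_ge0// ltW.
  rewrite -expRD ler_expR; have : e * x <= eps * x by rewrite ler_wpM2r//; lra.
  lra.
have -> : (8 * (c * b) + 2 * b + 2) * (P * X) =
   8 * (c * b) * (P * X) + 2 * b * (P * X) + 2 * (P * X) by ring.
exact: lerD.
Qed.

(** The mean a contributes a at n = 1 and nothing for larger n; g - a is bounded by 2A. Hence the
    constant 2c + 1. *)
Lemma real_periodic_sum (eps : R) : 0 < eps -> exists2 c : R, 0 < c &
  forall (g : nat -> R) (A : R) (q N : nat), 0 < A -> (0 < q)%N -> (0 < N)%N ->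
  (forall n, g (n + q)%N = g n) -> (forall n, `|g n| <= A) ->
  `|\sum_(1 <= n < N.+1) \sum_(d <- divisors n) (moebius (n %/ d))%:~R * g d| <=
    c * (A * q%:R * expR ((2^-1 + eps) * ln N%:R)).
Proof.
move=> eps0; have [c c0 Hc] := mean_zero_sum eps0.
exists (2 * c + 1); first by rewrite addr_gt0// mulr_gt0.
move=> g A q N A0 q0 N0 gq gA.
have q0' : 0 < q%:R :> R by rewrite ltr0n.
pose a := (\sum_(0 <= i < q) g i) / q%:R.
have aA : `|a| <= A.
  rewrite /a normrM normfV (gtr0_norm q0') ler_pdivrMr//.
  apply: le_trans (ler_norm_sum _ _ _) _.
  apply: (@le_trans _ _ (\sum_(0 <= d < q) A)); first by apply: ler_sum.
  by rewrite big_const_nat subn0 iter_addr addr0 -[leLHS]mulr_natr.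
have cst : \sum_(1 <= n < N.+1) \sum_(d <- divisors n) (moebius (n %/ d))%:~R * a = a.
  have E n : (0 < n)%N -> \sum_(d <- divisors n) (moebius (n %/ d))%:~R * a = (n == 1%N)%:R * a.
    move=> n0; rewrite -mulr_suml; congr (_ * a).
    rewrite -(rmorph_sum (intr : int -> R))/=.
    by rewrite (sum_divisors_compl moebius n0) sum_moebius//; case: eqP.
  rewrite big_ltn ?ltnS// E// eqxx mul1r big_nat_cond big1 ?addr0// => n.
  by rewrite andbT => /andP[n1 _]; rewrite E ?(ltnW n1)// gtn_eqF// mul0r.
have -> : \sum_(1 <= n < N.+1) \sum_(d <- divisors n) (moebius (n %/ d))%:~R * g d =
  \sum_(1 <= d < N.+1) \sum_(1 <= m < (N %/ d).+1) (moebius m)%:~R * (g d - a) + a.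
  rewrite -(sum_divisors N (fun m d => (moebius m)%:~R * (g d - a))) -[X in _ + X]cst.
  rewrite -big_split/=; apply: eq_bigr => n _; rewrite -big_split/=; apply: eq_bigr => d _.
  by rewrite -mulrDr subrK.
have X1 : 1 <= expR ((2^-1 + eps) * ln N%:R).
  rewrite -[leLHS]expR0 ler_expR mulr_ge0 ?addr_ge0 ?(ltW eps0)//.
  by rewrite ln_ge0// ler1n.
apply: le_trans (ler_normD _ _) _; rewrite mulrDl mul1r; apply: lerD; last first.
  apply: le_trans aA _; rewrite -mulrA -[leLHS]mulr1 ler_pM2l//.
  by rewrite -[leLHS]mulr1; apply: ler_pM => //; rewrite ler1n.
have -> : 2 * c * (A * q%:R * expR ((2^-1 + eps) * ln N%:R)) =
  c * (2 * A * q%:R * expR ((2^-1 + eps) * ln N%:R)) by ring.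
apply: (Hc (fun n => g n - a)) => //; first by rewrite mulr_gt0.
- by move=> n; rewrite gq.
- rewrite sumrB big_const_nat subn0 iter_addr addr0 -[X in _ - X]mulr_natr.
  by rewrite /a divfK ?subrr// gt_eqF.
by move=> n; apply: le_trans (ler_normB _ _) _; have := gA n; lra.
Qed.

End RealPeriodic.

Theorem theorem7 (R : realType) (GRH : generalized_riemann_hypothesis R)
    (eps : R) (heps : 0 < eps) :
  exists C : R, 0 < C /\
    forall (A : R) (q : nat) (h : int -> R[i]) (N : nat),
      0 < A -> (0 < q)%N -> periodic_mod q h ->
      (forall n : int, `|h n| <= A%:C) -> (0 < N)%N ->
      `|\sum_(1 <= n < N.+1) \sum_(d <- divisors n)
           (moebius (n %/ d))%:~R * h d%:Z|
        <= (C * A * q%:R * N%:R `^ (2^-1 + eps))%:C.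
Proof.
have [c c0 Hc] := real_periodic_sum GRH heps.
(* Real and imaginary parts of h are treated separately, each with the constant c. *)
exists (2 * c); split; first by rewrite mulr_gt0.
move=> A q h N A0 q0 hq hA N0; rewrite normc_def -cmE lecR.
have hn n : cm (h n) <= A by have := hA n; rewrite normc_def -cmE lecR.
have hper (n : nat) : h (n + q)%N = h n by rewrite PoszD hq.
have -> : N%:R `^ (2^-1 + eps) = expR ((2^-1 + eps) * ln N%:R).
  by rewrite /powR gt_eqF ?ltr0n.
set X := expR _; have -> : 2 * c * A * q%:R * X = c * (A * q%:R * X) + c * (A * q%:R * X) by ring.
apply: le_trans (cm_reim _) _; apply: lerD.
  have -> : re (\sum_(1 <= n < N.+1) \sum_(d <- divisors n) (moebius (n %/ d))%:~R * h d%:Z) =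
      \sum_(1 <= n < N.+1) \sum_(d <- divisors n) (moebius (n %/ d))%:~R * re (h d%:Z).
    rewrite re_sum; apply: eq_bigr => n _; rewrite re_sum; apply: eq_bigr => d _.
    by rewrite -(rmorph_int (real_complex R)) (reZ (moebius (n %/ d))%:~R).
  apply: (Hc (fun n : nat => re (h n))) => // n; first by rewrite hper.
  exact: le_trans (cm_re _) (hn _).
have -> : im (\sum_(1 <= n < N.+1) \sum_(d <- divisors n) (moebius (n %/ d))%:~R * h d%:Z) =
    \sum_(1 <= n < N.+1) \sum_(d <- divisors n) (moebius (n %/ d))%:~R * im (h d%:Z).
  rewrite im_sum; apply: eq_bigr => n _; rewrite im_sum; apply: eq_bigr => d _.
  by rewrite -(rmorph_int (real_complex R)) (imZ (moebius (n %/ d))%:~R).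
apply: (Hc (fun n : nat => im (h n))) => // n; first by rewrite hper.
exact: le_trans (cm_im _) (hn _).
Qed.
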